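(* Let $X$ be a fractional Brownian motion with Hurst index $H\in(0,1)$, and let $X^n$ denote the associated $n$-fold conditional process. Then the family of processes $\{(X^n_{T_n+\varepsilon t})_{t\in[0,1]}\}_\varepsilon$ satisfies a large deviation principle on $C([0,1])$ as $\varepsilon\to0$, with inverse speed $\varepsilon^{2H}$ and good rate function $$J_n(h)=\begin{cases}\frac12\|h-x_n\|^2_{\mathscr H_H}&\text{if }h_0=x_n\text{ and }h-x_n\in\mathscr H_H,\\+\infty&\text{otherwise,}\end{cases}$$ where $\mathscr H_H$ is the reproducing kernel Hilbert space associated to the fractional Brownian motion itself on $[0,1]$, i.e. to the covariance function $k_H$ restricted to $[0,1]^2$.
   Context: A fractional Brownian motion with Hurst index $H\in(0,1)$ is a continuous centered Gaussian process $X=(X_t)_{t\ge0}$ with covariance $k_H(t,s)=\frac12(t^{2H}+s^{2H}-|t-s|^{2H})$. Fix $n\ge1$, times $0<T_1<\dots<T_n$ and real numbers $x_1,\dots,x_n$. Set $X^0=X$, $k_0=k_H$ and, for $j=1,\dots,n$, $$\alpha_j(t)=\frac{k_{j-1}(t,T_j)}{k_{j-1}(T_j,T_j)},\qquad X^j_t=X^{j-1}_t-\alpha_j(t)(X^{j-1}_{T_j}-x_j),\qquad k_j(t,s)=k_{j-1}(t,s)-\alpha_j(t)k_{j-1}(s,T_j).$$ Then $k_j$ is the covariance function of $X^j$, and $X^n$ (the $n$-fold conditional process) has the law of $X$ conditioned on $X_{T_1}=x_1,\dots,X_{T_n}=x_n$. $C([0,1])$ is the space of continuous real paths on $[0,1]$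 with the sup-norm; $x_n$ also denotes the constant path. A family $\{U^\varepsilon\}_\varepsilon$ of $C([0,1])$-valued random variables satisfies a large deviation principle with inverse speed $\gamma_\varepsilon^2$ and good rate function $I$ if $\gamma_\varepsilon\to0$, the set $\{I\le a\}$ is compact for every real $a$, $\liminf_{\varepsilon\to0}\gamma_\varepsilon^2\log\mathbb P(U^\varepsilon\in G)\ge-\inf_GI$ for every open $G$, and $\limsup_{\varepsilon\to0}\gamma_\varepsilon^2\log\mathbb P(U^\varepsilon\in F)\le-\inf_FI$ for every closed $F$. The reproducing kernel Hilbert space of a continuous, symmetric, positive (semi)definite kernel $q$ on $[0,1]^2$ is the completion, inside $C([0,1])$, of the paths $h_t=\int_0^1q(t,s)\lambda(ds)$, $\lambda$ a signed Borel measure on $[0,1]$, with $\|h\|^2=\int_0^1\int_0^1q(t,s)\lambda(dt)\lambda(ds)$. *)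

(* Defs.v *)
From HB Require Import structures.
From mathcomp Require Import all_boot all_order all_algebra.
From mathcomp Require Import all_classical all_reals all_analysis.

Set Implicit Arguments.
Unset Strict Implicit.
Unset Printing Implicit Defensive.

Import Order.TTheory GRing.Theory Num.Theory.
Import numFieldNormedType.Exports.

Local Open Scope classical_set_scope.
Local Open Scope ring_scope.

Section path_space.
Variable R : realType.

Definition unit_itv : set R := `[0, 1].

Definition continuous_path : {pred (unit_itv -> R^o)} :=
  fun f => `[< continuous f >].

Lemma continuous_pathP (f : unit_itv -> R^o) :
  reflect (continuous f) (f \in continuous_path).
Proof. exact: asboolP. Qed.

Fact continuous_path_submod : submod_closed continuous_path.
Proof.
split; first (apply/continuous_pathP => t; apply: cst_continuous).
move=> a f g /continuous_pathP cf /continuous_pathP cg.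
apply/continuous_pathP => t.
rewrite /= in cf cg *; apply: (@continuousD _ R^o _ (a \*: f) g); last exact: cg.
by apply: continuousZl_tmp; exact: cf.
Qed.

HB.instance Definition _ :=
  GRing.isSubmodClosed.Build R (unit_itv -> R^o) continuous_path
    continuous_path_submod.

Record C01 := MkC01 {
  path_fun :> unit_itv -> R^o ;
  _ : path_fun \in continuous_path }.

HB.instance Definition _ := [isSub for path_fun].
HB.instance Definition _ := [Choice of C01 by <:].
HB.instance Definition _ := [SubChoice_isSubLmodule of C01 by <:].

Lemma C01P (f g : C01) : (forall t, f t = g t) -> f = g.
Proof. by move=> fg; apply/val_inj/funext. Qed.

Lemma C01_continuous (f : C01) : continuous (f : unit_itv -> R).
Proof. exact/continuous_pathP/valP. Qed.

Lemma unit_itv0 : 0 \in unit_itv.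
Proof. by rewrite inE /unit_itv /= in_itv /= lexx ler01. Qed.

Definition unit0 : unit_itv := SigSub unit_itv0.

(* The norm, hence the topology, of [C01] is the sup-norm. *)
Definition sup_norm (f : C01) : R := sup (range (fun t => `|f t|)).

Lemma has_sup_path (f : C01) : has_sup (range (fun t => `|f t|)).
Proof.
split; first by exists `|f unit0|, unit0.
have cf : {within unit_itv, continuous (valL f : R -> R)}.
  by apply/subspace_sigL_continuousP; rewrite valLK; exact: C01_continuous.
have /compact_bounded[M [_ /(_ (M + 1))]] :=
  continuous_compact cf (@segment_compact R 0 1).
rewrite ltrDl ltr01 => /(_ isT) fM; exists (M + 1) => _ [t _ <-].
apply: fM; exists (val t); first exact: set_valP.
by have := congr1 (@^~ t) (valLK (0:R) (f : unit_itv -> R)).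
Qed.

Lemma le_sup_norm (f : C01) t : `|f t| <= sup_norm f.
Proof. by apply: (sup_upper_bound (has_sup_path f)); exists t. Qed.

Lemma sup_norm_le (f : C01) r : (forall t, `|f t| <= r) -> sup_norm f <= r.
Proof.
by move=> fr; apply: ge_sup; [exists `|f unit0|, unit0|move=> _ [t _ <-]].
Qed.

Fact sup_normD (f g : C01) : sup_norm (f + g) <= sup_norm f + sup_norm g.
Proof.
apply: sup_norm_le => t.
by rewrite (le_trans (ler_normD _ _))// lerD// le_sup_norm.
Qed.

Fact sup_normZ (a : R) (f : C01) : sup_norm (a *: f) = `|a| * sup_norm f.
Proof.
apply/eqP; rewrite eq_le; apply/andP; split.
  apply: sup_norm_le => t; rewrite [X in `|X|](_ : _ = a * f t)// normrM.
  by rewrite ler_wpM2l// le_sup_norm.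
have [->|a0] := eqVneq a 0.
  by rewrite normr0 mul0r (le_trans _ (le_sup_norm _ unit0)).
rewrite -ler_pdivlMl ?normr_gt0//; apply: sup_norm_le => t.
rewrite ler_pdivlMl ?normr_gt0// -normrM.
exact: (le_sup_norm (a *: f)).
Qed.

Fact sup_norm_eq0 (f : C01) : sup_norm f = 0 -> f = 0.
Proof.
move=> f0; apply: C01P => t; apply/eqP.
by rewrite -normr_le0 -f0 le_sup_norm.
Qed.

HB.instance Definition _ :=
  Lmodule_isNormed.Build R C01 sup_normD sup_normZ sup_norm_eq0.

Fact const_path_subproof (c : R) : (fun=> c) \in continuous_path.
Proof. by apply/continuous_pathP => t; apply: cst_continuous. Qed.

Definition const_path (c : R) : C01 := MkC01 (const_path_subproof c).

Definition restrict_path (g : R -> R) : C01 :=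
  insubd 0 (fun t : unit_itv => g (val t)).

Lemma restrict_pathE (g : R -> R) (t : unit_itv) :
  {within unit_itv, continuous g} -> restrict_path g t = g (val t).
Proof.
move=> /subspace_sigL_continuousP cg; rewrite /restrict_path val_insubd.
by case: ifPn => // /negP[]; exact/continuous_pathP.
Qed.

End path_space.

Arguments unit_itv : clear implicits.
Arguments unit0 : clear implicits.

Section rkhs.
Variable R : realType.
Implicit Types (q : R -> R -> R) (nu : {charge set R -> \bar R}).

(* Integral of [f] over [D] against a signed measure, through its Jordan
   decomposition. *)
Definition charge_integral nu (D : set R) (f : R -> R) : R :=
  let: exist _ hahnP := cid (Hahn_decomposition nu) in
  let: exist _ hahnPN := cid hahnP in
  Rintegral (jordan_pos hahnPN) D f - Rintegral (jordan_neg hahnPN) D f.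

(* Signed measures on [0, 1] are represented by charges on [R]; only their
   restriction to [0, 1] plays a role. *)
Definition potential q nu (t : R) : R :=
  charge_integral nu (unit_itv R) (q t).

(* The iterated integral of [q t s] against [nu (ds)], then [nu (dt)]. *)
Definition energy q nu : R :=
  charge_integral nu (unit_itv R) (potential q nu).

Definition csub nu1 nu2 : {charge set R -> \bar R} := cadd nu1 (copp nu2).

(* [h] is the limit in C([0, 1]) of the potentials of the [lam m], which form a
   Cauchy sequence for the norm [nu |-> Num.sqrt (energy q nu)]. *)
Definition rkhs_approx q (lam : nat -> {charge set R -> \bar R}) (h : C01 R) :=
  (forall e : R, 0 < e -> exists N, forall i j, (N <= i)%N -> (N <= j)%N ->
     Num.sqrt (energy q (csub (lam i) (lam j))) < e) /\
  exists2 h_ : nat -> C01 R,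
    (forall m (t : unit_itv R), h_ m t = potential q (lam m) (val t)) &
    h_ m @[m --> \oo] --> h.

Definition rkhs q : set (C01 R) := [set h | exists lam, rkhs_approx q lam h].

(* For a continuous, symmetric, positive semidefinite kernel the limit below
   exists and does not depend on the approximating sequence. *)
Definition rkhs_norm q (h : C01 R) : R :=
  get [set r | exists2 lam, rkhs_approx q lam h &
    Num.sqrt (energy q (lam m)) @[m --> \oo] --> r].

End rkhs.

Section large_deviations.
Context d (Om : measurableType d) (R : realType) (P : probability Om R).
Variable E : topologicalType.
Local Open Scope ereal_scope.

(* Large deviation principle with inverse speed [gamma e ^+ 2] and good rate
   function [I], as [e] tends to 0 from above. The first clause says that the
   [U e] are random variables for the Borel sigma-algebra of [E]; without it
   the probabilities below would not be meaningful. *)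
Definition LDP (U : R -> Om -> E) (gamma : R -> R) (I : E -> \bar R) :=
  [/\ forall e (G : set E), (0 < e)%R -> open G -> measurable (U e @^-1` G),
      gamma e @[e --> 0^'+] --> 0%R,
      forall a : R, compact [set x | I x <= a%:E],
      forall G : set E, open G ->
        - ereal_inf (I @` G) <=
        limf_einf (fun e => (gamma e ^+ 2)%:E * lne (P (U e @^-1` G))) 0^'+ &
      forall F : set E, closed F ->
        limf_esup (fun e => (gamma e ^+ 2)%:E * lne (P (U e @^-1` F))) 0^'+ <=
        - ereal_inf (I @` F)].

End large_deviations.

Section fractional_brownian_motion.
Context d (Om : measurableType d) (R : realType) (P : probability Om R).
Implicit Types (X : R -> {RV P >-> R}) (H : R).

Definition fbm_cov H (t s : R) : R :=
  (t `^ (2 * H) + s `^ (2 * H) - `|t - s| `^ (2 * H)) / 2.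

(* Degenerate Gaussian laws are Dirac masses; they have to be singled out
   because [normal_prob m 0] is not one. *)
Definition gaussian_law (m s : R) (A : set R) : \bar R :=
  if s == 0 then dirac m A else normal_prob m s A.

Definition gaussian (Y : Om -> R) :=
  exists m s, forall A : set R, measurable A ->
    P (Y @^-1` A) = gaussian_law m s A.

Definition gaussian_process X :=
  forall (N : nat) (t a : 'I_N -> R), (forall i, 0 <= t i) ->
    gaussian (fun w => \sum_(i < N) a i * X (t i) w).

(* The time set is [0, +oo[: the variables [X t] with [t < 0] are
   unconstrained. *)
Definition fBm H X :=
  [/\ forall w, {within `[0, +oo[, continuous (fun t => X t w)},
      gaussian_process X,
      forall t, 0 <= t -> ('E_P[X t] = 0)%E &
      forall t s, 0 <= t -> 0 <= s ->
        covariance P (X t) (X s) = (fbm_cov H t s)%:E].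

Definition cond_coef (k : R -> R -> R) (Tj t : R) : R := k t Tj / k Tj Tj.

(* Conditioning times and values are [T 1], ..., [T n] and [x 1], ..., [x n];
   the other terms of the sequences [T] and [x] are not used. *)
Fixpoint cond_cov (k0 : R -> R -> R) (T : nat -> R) (j : nat) : R -> R -> R :=
  if j is i.+1 then
    let k := cond_cov k0 T i in
    fun t s => k t s - cond_coef k (T j) t * k s (T j)
  else k0.

Fixpoint cond_process (k0 : R -> R -> R) (X : R -> Om -> R) (T x : nat -> R)
    (j : nat) : R -> Om -> R :=
  if j is i.+1 then
    let k := cond_cov k0 T i in
    let Y := cond_process k0 X T x i in
    fun t w => Y t w - cond_coef k (T j) t * (Y (T j) w - x j)
  else X.

(* [restrict_path] sends a function that is not continuous on [0, 1] to the null
   path; [shifted_pathE] shows that this case does not occur for [0 < e]. *)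
Definition shifted_path H (X : R -> Om -> R) (T x : nat -> R)
    (n : nat) (e : R) (w : Om) : C01 R :=
  restrict_path (fun t => cond_process (fbm_cov H) X T x n (T n + e * t) w).

Fact normr_powR_continuous (p : R) : 0 < p ->
  continuous (fun t : R => `|t| `^ p).
Proof.
move=> p0 t; have [->|t0] := eqVneq t 0.
  rewrite /continuous_at normr0 powR0 ?gt_eqF//.
  apply/cvgrPdist_lt => e e0; near=> u.
  rewrite sub0r normrN ger0_norm ?powR_ge0//.
  have -> : e = (e `^ p^-1) `^ p.
    by rewrite -powRrM mulVf ?gt_eqF// powRr1// ltW.
  rewrite gt0_ltr_powR ?nnegrE// ?powR_ge0//.
  near: u; have := @nbhs0_lt R R^o (e `^ p^-1); apply.
  by rewrite powR_gt0.
apply: (@continuous_comp R R R Num.norm (fun u => u `^ p)).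
  exact: norm_continuous.
apply/differentiable_continuous/derivable1_diffP/derivable_powR.
by rewrite in_itv/= normr_gt0 t0.
Unshelve. all: by end_near. Qed.

Fact fbm_cov_continuous H (s t : R) : 0 < H -> 0 < t ->
  {for t, continuous (fbm_cov H ^~ s)}.
Proof.
move=> H0 t0; have H20 : 0 < 2 * H by rewrite mulr_gt0.
apply: continuousM; last exact: cst_continuous.
apply: (@continuousB _ R^o) => /=.
  apply: (@continuousD _ R^o) => /=; last exact: cst_continuous.
  apply/differentiable_continuous/derivable1_diffP/derivable_powR.
  by rewrite in_itv/= t0.
apply: (@continuous_comp R R R (fun u => u - s) (fun u => `|u| `^ (2 * H))).
  by apply: (@continuousB _ R^o) => //; exact: cst_continuous.
exact: normr_powR_continuous.
Qed.

Fact cond_cov_continuous H (T : nat -> R) j (s t : R) : 0 < H -> 0 < t ->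
  {for t, continuous (cond_cov (fbm_cov H) T j ^~ s)}.
Proof.
move=> H0 t0; elim: j s => [|j IH] s /=; first exact: fbm_cov_continuous.
apply: (@continuousB _ R^o); first exact: IH.
apply: (@continuousM _ _ (cond_coef _ _)); last exact: cst_continuous.
by apply: continuousM; [exact: IH|exact: cst_continuous].
Qed.

Fact cond_process_continuous H X (T x : nat -> R) j w (t : R) :
  0 < H -> fBm H X -> 0 < t ->
  {for t, continuous (fun u => cond_process (fbm_cov H) X T x j u w)}.
Proof.
move=> H0 [cX _ _ _] t0; elim: j => [|j IH] /=.
  have /continuous_within_itvcyP[+ _] := cX w; apply.
  by rewrite in_itv/= t0.
apply: (@continuousB _ R^o); first exact: IH.
apply: (@continuousM _ _ (cond_coef _ _)); last exact: cst_continuous.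
by apply: continuousM; [exact: cond_cov_continuous|exact: cst_continuous].
Qed.

Lemma shifted_pathE H X (T x : nat -> R) n e w (t : unit_itv R) :
  0 < H -> fBm H X -> 0 < T n -> 0 < e ->
  shifted_path H X T x n e w t =
    cond_process (fbm_cov H) X T x n (T n + e * val t) w.
Proof.
move=> H0 fX Tn0 e0; rewrite /shifted_path restrict_pathE//.
apply: (@within_continuous_comp _ _ _ _ (fun u => T n + e * u)
  (fun u => cond_process (fbm_cov H) X T x n u w)).
  move=> _ /set_mem[u /= + <-]; rewrite /unit_itv/= in_itv/= => /andP[u0 _].
  apply: cond_process_continuous => //.
  by rewrite (lt_le_trans Tn0)// lerDl mulr_ge0// ltW.
apply: continuous_subspaceT => u.
apply: (@continuousD _ R^o); first exact: cst_continuous.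
by apply: continuousM => //; exact: cst_continuous.
Qed.

Local Open Scope ereal_scope.
Definition rate_function H (x : R) (h : C01 R) : \bar R :=
  if `[< h (unit0 R) = x /\ rkhs (fbm_cov H) (h - const_path x)%R >]
  then (2^-1 * rkhs_norm (fbm_cov H) (h - const_path x) ^+ 2)%:E
  else +oo.

End fractional_brownian_motion.

Arguments fBm {d Om R} P H X.

(* Main.v *)
(* Put [a = T n], [g = e ^ H] and [V t = X (a + e t) - X a]. Since [X^n] equals
   [x n] at time [a], the shifted path is [x n + V - pert], where [pert t] is the
   sum of the increments of the coefficients [alpha_j] between [a] and [a + e t]
   times Gaussian variables that do not depend on [e]. A shifted kernel
   [k (a + h) s] varies by o(h ^ H), even for [s = a] where the variation is of
   order [h ^ (2 H)]; hence [pert] is negligible at the exponential scale. By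
   stationarity of the increments and self-similarity, [V] has the Gaussian
   exponential moments of [g X], and only those are used.

   For a dense sequence of times let [V_m] be the projection of [V] onto its
   values at the first [m] times, expressed in orthonormal (Cholesky)
   coordinates. Chaining makes the sup-norm of [V - V_m] exponentially
   negligible as [m] grows, and the coordinates of [V_m] form a finite
   dimensional Gaussian vector: with the compactness of the level sets, this
   gives the upper bound. For the lower bound, the exponential change of measure
   by a finite combination of the values of [V] recenters [V] at a projection of
   the target path, and chaining applies under the new measure.

   The rate function is identified by the sum of the squares of the Cholesky
   coordinates of a path, which is the square of its norm in the reproducing
   kernel Hilbert space. *)

Require Import Defs.
From HB Require Import structures.
From mathcomp Require Import all_boot all_order all_algebra.
From mathcomp Require Import all_classical all_reals all_analysis.
From mathcomp Require Import measurable_realfun ring lra zify.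

Set Implicit Arguments.
Unset Strict Implicit.
Unset Printing Implicit Defensive.

Import Order.TTheory GRing.Theory Num.Theory.
Import numFieldNormedType.Exports.
Local Open Scope classical_set_scope.
Local Open Scope ring_scope.

(** * Finite combinations of point evaluations and conditioning *)

(** Gaussian laws enter only through finite linear combinations of values of [X]: each has a law on
    the line, joint laws are never formed and independence is never invoked. This is why discrete
    signed measures are lists, and why conditioning is an algebraic operation on lists. The same
    algebra runs twice: along the conditioning times, and along a dense sequence of [0, 1], where it
    yields orthonormal coordinates.

    The delicate point is degeneracy. A zero conditional variance makes a conditioning step void,
    division by zero being zero, and this is harmless only if it happens at repeated times. That it
    happens only there is a property of the kernel, read off its second differences.

    The perturbation is harmless at every exponential rate: its coefficients are o(g), whereas a
    fixed Gaussian variable exceeds L / g with probability of order exp(- c (L / g)^2), and L is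
    free. The upper bound is a covering by three rare events: outside them the path is close to a
    point of a compact level set which the closed set avoids. *)

Section discrete_measures.
Variable R : realType.
Implicit Types (l : seq (R * R)) (f g : R -> R) (k : R -> R -> R).

(* The list [l] stands for the discrete signed measure
   [\sum_(p <- l) p.1 * dirac p.2]. *)
Definition ev f l : R := \sum_(p <- l) p.1 * f p.2.

Definition scal (a : R) l := [seq (a * p.1, p.2) | p <- l].

Definition bil k l l' : R := ev (fun t => ev (k t) l') l.

Definition nonneg_times l := all (fun p => 0 <= p.2) l.

Lemma ev_nil f : ev f [::] = 0. Proof. by rewrite /ev big_nil. Qed.

Lemma ev_cons f p l : ev f (p :: l) = p.1 * f p.2 + ev f l.
Proof. by rewrite /ev big_cons. Qed.

Lemma ev1 f a t : ev f [:: (a, t)] = a * f t.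
Proof. by rewrite ev_cons ev_nil addr0. Qed.

Lemma ev_cat f l l' : ev f (l ++ l') = ev f l + ev f l'.
Proof. by rewrite /ev big_cat. Qed.

Lemma ev_scal f a l : ev f (scal a l) = a * ev f l.
Proof.
by rewrite /ev /scal big_map mulr_sumr; apply: eq_bigr => p _; rewrite mulrA.
Qed.

Lemma ev_flatten f (s : seq (seq (R * R))) :
  ev f (flatten s) = \sum_(l <- s) ev f l.
Proof.
elim: s => [|l s IH] /=; first by rewrite ev_nil big_nil.
by rewrite ev_cat IH big_cons.
Qed.

Lemma eq_ev f g l : (forall p, p \in l -> f p.2 = g p.2) -> ev f l = ev g l.
Proof. by move=> fg; apply: eq_big_seq => p /fg ->. Qed.

Lemma ev_eq0 f l : (forall p, p \in l -> f p.2 = 0) -> ev f l = 0.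
Proof. by move=> f0; rewrite /ev big_seq big1// => p /f0 ->; rewrite mulr0. Qed.

Lemma evD f g l : ev (fun t => f t + g t) l = ev f l + ev g l.
Proof. by rewrite /ev -big_split; apply: eq_bigr => p _; rewrite mulrDr. Qed.

Lemma evZ a f l : ev (fun t => a * f t) l = a * ev f l.
Proof. by rewrite /ev mulr_sumr; apply: eq_bigr => p _; rewrite mulrCA. Qed.

Lemma evN f l : ev (fun t => - f t) l = - ev f l.
Proof. by rewrite /ev -sumrN; apply: eq_bigr => p _; rewrite mulrN. Qed.

Lemma ev_sum (I : Type) (r : seq I) (F : I -> R -> R) l :
  ev (fun t => \sum_(i <- r) F i t) l = \sum_(i <- r) ev (F i) l.
Proof.
by rewrite /ev exchange_big; apply: eq_bigr => p _; rewrite mulr_sumr.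
Qed.

Lemma ev_exchange k l l' :
  ev (fun t => ev (k t) l') l = ev (fun s => ev (k ^~ s) l) l'.
Proof.
rewrite {1}/ev -[RHS]/(\sum_(p <- l') p.1 * ev (k ^~ p.2) l).
rewrite [RHS](eq_bigr (fun p => \sum_(r <- l) p.1 * (r.1 * k r.2 p.2))).
  rewrite exchange_big /=; apply: eq_bigr => p _.
  by rewrite mulr_sumr; apply: eq_bigr => r _; rewrite mulrCA.
by move=> p _; rewrite mulr_sumr.
Qed.

Lemma bil_cat k l1 l2 l' : bil k (l1 ++ l2) l' = bil k l1 l' + bil k l2 l'.
Proof. exact: ev_cat. Qed.

Lemma bil_catr k l l1 l2 : bil k l (l1 ++ l2) = bil k l l1 + bil k l l2.
Proof. by rewrite /bil -evD; apply: eq_ev => p _; rewrite ev_cat. Qed.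

Lemma bil_scal k a l l' : bil k (scal a l) l' = a * bil k l l'.
Proof. exact: ev_scal. Qed.

Lemma bil_scalr k a l l' : bil k l (scal a l') = a * bil k l l'.
Proof. by rewrite /bil -evZ; apply: eq_ev => p _; rewrite ev_scal. Qed.

Lemma bilC k l l' : (forall t s, k t s = k s t) -> bil k l l' = bil k l' l.
Proof.
move=> ksym; rewrite /bil ev_exchange; apply: eq_ev => p _.
by apply: eq_ev => r _; rewrite ksym.
Qed.

Definition psd k := forall l, nonneg_times l -> 0 <= bil k l l.

Lemma psd_diag k t : psd k -> 0 <= t -> 0 <= k t t.
Proof.
move=> kpsd t0; have := kpsd [:: (1, t)].
by rewrite /bil !ev1 !mul1r; apply; rewrite /= t0.
Qed.

Lemma psd_incr k t s : (forall t s, k t s = k s t) -> psd k ->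
  0 <= t -> 0 <= s -> 0 <= k t t + k s s - 2 * k t s.
Proof.
move=> ksym kpsd t0 s0; have := kpsd [:: (1, t); (-1, s)].
rewrite /bil !ev_cons !ev_nil /= (ksym s t) t0 s0 => /(_ isT) h.
by apply: le_trans h _; lra.
Qed.

Lemma psd_CauchySchwarz k t s : (forall t s, k t s = k s t) -> psd k ->
  0 <= t -> 0 <= s -> k t s ^+ 2 <= k t t * k s s.
Proof.
move=> ksym kpsd t0 s0.
have q a b : 0 <= a ^+ 2 * k t t + 2 * a * b * k t s + b ^+ 2 * k s s.
  have := kpsd [:: (a, t); (b, s)].
  rewrite /bil !ev_cons !ev_nil /= (ksym s t) t0 s0 => /(_ isT) h.
  by apply: le_trans h _; rewrite le_eqVlt; apply/orP; left; apply/eqP; ring.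
have [kss0|kss] := eqVneq (k s s) 0.
  rewrite kss0 mulr0; have [->|kts] := eqVneq (k t s) 0.
    by rewrite expr0n.
  (* With [k s s = 0] the quadratic form is affine in its second weight; this weight makes it equal
     to -1. *)
  have := q 1 (- (k t t + 1) / (2 * k t s)).
  rewrite kss0 mulr0 addr0 expr1n mul1r mulr1.
  have -> : 2 * (- (k t t + 1) / (2 * k t s)) * k t s = - (k t t + 1) by field.
  by move=> h; exfalso; lra.
have kss_gt0 : 0 < k s s by rewrite lt0r kss psd_diag.
(* These weights turn the form into [k s s] times the discriminant. *)
have := q (k s s) (- k t s).
have -> : k s s ^+ 2 * k t t + 2 * k s s * (- k t s) * k t s +
  (- k t s) ^+ 2 * k s s = k s s * (k t t * k s s - k t s ^+ 2) by ring.
by rewrite pmulr_rge0// subr_ge0.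
Qed.

Lemma psd_null k t s : (forall t s, k t s = k s t) -> psd k ->
  0 <= t -> 0 <= s -> k s s = 0 -> k t s = 0.
Proof.
move=> ksym kpsd t0 s0 kss.
have := psd_CauchySchwarz ksym kpsd t0 s0.
by rewrite kss mulr0 => h; apply/eqP; rewrite -sqrf_eq0 eq_le h sqr_ge0.
Qed.

Lemma CauchySchwarz_sum n (a b : nat -> R) :
  (\sum_(i < n) a i * b i) ^+ 2 <=
  (\sum_(i < n) a i ^+ 2) * (\sum_(i < n) b i ^+ 2).
Proof.
elim: n => [|n]; first by rewrite !big_ord0 expr0n mul0r.
rewrite !big_ord_recr /=.
set S := \sum_(i < n) _ * _; set A := \sum_(i < n) _; set B := \sum_(i < n) _.
have A0 : 0 <= A by apply: sumr_ge0 => i _; exact: sqr_ge0.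
have B0 : 0 <= B by apply: sumr_ge0 => i _; exact: sqr_ge0.
move=> IH; set x := a n; set y := b n.
(* The cross term is compared after squaring: the induction hypothesis bounds [S ^+ 2] by [A * B],
   and the arithmetic-geometric mean inequality does the rest. *)
suff : 2 * S * (x * y) <= A * y ^+ 2 + B * x ^+ 2 by move=> h; nra.
apply: (le_trans (ler_norm _)); rewrite -ler_sqr ?nnegrE//; last first.
  by rewrite addr_ge0// mulr_ge0// sqr_ge0.
rewrite real_normK ?num_real//.
have h : 0 <= (A * y ^+ 2 - B * x ^+ 2) ^+ 2 by exact: sqr_ge0.
have : 4 * S ^+ 2 * (x * y) ^+ 2 <= 4 * (A * B) * (x * y) ^+ 2.
  by rewrite ler_wpM2r ?sqr_ge0//; lra.
by move=> h2; nra.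
Qed.

End discrete_measures.

(** * Conditioning along a sequence of times and Cholesky coordinates *)

Section conditioning.
Variables (R : realType) (k : R -> R -> R) (T : nat -> R).
Hypothesis ksym : forall t s, k t s = k s t.
Hypothesis kpsd : psd k.
Hypothesis T0 : forall j, (0 < j)%N -> 0 <= T j.

Local Notation kc := (cond_cov k T).

Lemma cond_cov_sym m t s : kc m t s = kc m s t.
Proof.
elim: m t s => [|m IH] t s /=; first exact: ksym.
by rewrite /cond_coef IH; congr (_ - _); rewrite -!mulrA mulrC -mulrA mulrCA.
Qed.

(** Conditioning at [u] subtracts from a measure the multiple of the Dirac mass at [u] that makes it
    orthogonal to that mass; the conditioned form is the old form at the corrected measure. *)
Lemma cond_cov_psd m : psd (kc m).
Proof.
elim: m => [|m IH]; first exact: kpsd.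
move=> l l0 /=; set u := T m.+1.
have u0 : 0 <= u by exact: T0.
have [k0|k0] := eqVneq (kc m u u) 0.
  rewrite [leRHS](_ : _ = bil (kc m) l l); first exact: IH.
  apply: eq_ev => p _; apply: eq_ev => r _.
  by rewrite /cond_coef k0 invr0 mulr0 mul0r subr0.
have kgt0 : 0 < kc m u u by rewrite lt0r k0 psd_diag.
pose B := ev (kc m ^~ u) l.
have -> : bil (fun t s => kc m t s - cond_coef (kc m) u t * kc m s u) l l =
    bil (kc m) l l - B ^+ 2 / kc m u u.
  rewrite /bil /cond_coef.
  transitivity (ev (fun t => ev (kc m t) l - B / kc m u u * kc m t u) l).
    apply: eq_ev => p _; rewrite evD evN; congr (_ - _).
    by rewrite evZ -/B mulrC mulrA [RHS]mulrAC.
  by rewrite evD evN evZ -/B; congr (_ - _); rewrite expr2 mulrAC.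
(* The added mass is minus the regression coefficient of [l] on the value at [u]. *)
have := IH (l ++ [:: (- (B / kc m u u), u)]).
rewrite /nonneg_times all_cat /= u0 andbT andbT => /(_ l0).
rewrite bil_cat !bil_catr (@bilC _ _ [:: _] l (cond_cov_sym m)).
have -> : bil (kc m) l [:: (- (B / kc m u u), u)] = - (B / kc m u u) * B.
  by rewrite /bil -evZ; apply: eq_ev => p _; rewrite ev1.
rewrite /bil !ev1; set c := kc m u u in kgt0 *.
set q := ev _ _.
suff -> : q - B ^+ 2 / c = q + - (B / c) * B +
  (- (B / c) * B + - (B / c) * (- (B / c) * c)) by [].
by field; rewrite gt_eqF.
Qed.

Lemma cond_cov_null m j t : (0 < j <= m)%N -> 0 <= t -> kc m t (T j) = 0.
Proof.
elim: m t => [|m IH] t; first by case: j.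
move=> /andP[j0 jm] t0; have := jm; rewrite leq_eqVlt => /orP[/eqP ->|jm'] /=.
  rewrite /cond_coef; set u := T m.+1.
  have [k0|k0] := eqVneq (kc m u u) 0; last by rewrite divfK ?subrr.
  rewrite (@psd_null _ _ t u)//; first by rewrite mul0r mul0r subrr.
  - exact: cond_cov_sym.
  - exact: cond_cov_psd.
  - exact: T0.
rewrite IH ?j0// (cond_cov_sym m (T j)) IH ?j0//; last exact: T0.
by rewrite mulr0 subrr.
Qed.

(* [ev f (dl m t)] is the value at [t] of [f] conditioned to vanish at
   [T 1], ..., [T m]. *)
Fixpoint dl (m : nat) (t : R) : seq (R * R) :=
  if m is i.+1 then
    dl i t ++ scal (- cond_coef (kc i) (T m) t) (dl i (T m))
  else [:: (1, t)].

Definition cond_var i := kc i (T i.+1) (T i.+1).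

(* Cholesky factors of [k] along the sequence [T]. When [cond_var i = 0],
   both [chol i] and [coord i] vanish, division by zero being zero. *)
Definition chol i t := kc i t (T i.+1) / Num.sqrt (cond_var i).

Definition coord i := scal (Num.sqrt (cond_var i))^-1 (dl i (T i.+1)).

Lemma cond_var_ge0 i : 0 <= cond_var i.
Proof. by apply: psd_diag; [exact: cond_cov_psd|exact: T0]. Qed.

Lemma ev_dlS f m t : ev f (dl m.+1 t) =
  ev f (dl m t) - cond_coef (kc m) (T m.+1) t * ev f (dl m (T m.+1)).
Proof. by rewrite /= ev_cat ev_scal mulNr. Qed.

Lemma dl_times m t (I : R -> bool) : I t -> (forall j, (0 < j)%N -> I (T j)) ->
  all (fun p => I p.2) (dl m t).
Proof.
move=> It IT; elim: m t It => [|m IH] t It /=; first by rewrite It.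
by rewrite all_cat IH//= all_map; apply: IH; exact: IT.
Qed.

Lemma coord_times i (I : R -> bool) : (forall j, (0 < j)%N -> I (T j)) ->
  all (fun p => I p.2) (coord i).
Proof. by move=> IT; rewrite all_map; apply: dl_times => //; exact: IT. Qed.

(** With [ev_dl_cov_ge], this says that conditioning an already conditioned kernel leaves the finer
    of the two conditionings. Off-diagonal orthogonality of the coordinates follows. *)
Lemma ev_dl_cov m i s t : (m <= i)%N -> 0 <= s ->
  ev (kc m s) (dl i t) = kc i t s.
Proof.
move=> mi s0; elim: i t mi => [|i IH] t.
  by rewrite leqn0 => /eqP ->; rewrite ev1 mul1r cond_cov_sym.
rewrite leq_eqVlt => /orP[/eqP <-|mi]; last first.
  by rewrite ev_dlS !IH//= (cond_cov_sym i s).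
(* [kc m s] vanishes at [T 1], ..., [T m], so the corrections carried by [dl j] contribute nothing
   while [j <= m]. *)
have null j : (j <= m)%N -> ev (kc m s) (dl j t) = kc m s t.
  elim: j t => [|j IHj] t jm; first by rewrite ev1 mul1r.
  rewrite ev_dlS !IHj// 1?ltnW// cond_cov_null ?mulr0 ?subr0//.
by rewrite null// cond_cov_sym.
Qed.

Lemma ev_dl_cov_ge i m s t : (i <= m)%N -> 0 <= s ->
  ev (kc m s) (dl i t) = kc m t s.
Proof.
move=> im s0; rewrite (cond_cov_sym m t); elim: i t im => [|i IH] t im.
  by rewrite ev1 mul1r.
by rewrite ev_dlS !IH 1?ltnW// cond_cov_null// mulr0 subr0.
Qed.

Lemma ev_cov_dl i u v : ev (k u) (dl i v) = kc i v u.
Proof.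
elim: i v => [|i IH] v; first by rewrite ev1 mul1r ksym.
by rewrite ev_dlS !IH/= (cond_cov_sym i u).
Qed.

Lemma bil_dl m t s : 0 <= s -> bil k (dl m t) (dl m s) = kc m t s.
Proof.
move=> s0; rewrite /bil -(ev_dl_cov_ge t (leqnn m) s0); apply: eq_ev => p _.
by rewrite ev_cov_dl cond_cov_sym.
Qed.

Lemma ev_cov_coord i u : ev (k u) (coord i) = chol i u.
Proof. by rewrite ev_scal ev_cov_dl mulrC cond_cov_sym. Qed.

Lemma cond_cov_chol m t s : kc m t s = k t s - \sum_(i < m) chol i t * chol i s.
Proof.
elim: m => [|m IH] /=; first by rewrite big_ord0 subr0.
rewrite big_ord_recr /= opprD addrA -IH; congr (_ - _).
rewrite /chol /cond_coef (cond_cov_sym m s) mulrACA -invfM -expr2.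
by rewrite sqr_sqrtr ?cond_var_ge0// mulrAC (cond_cov_sym m _ s).
Qed.

(** The Gram-Schmidt form of [dl]: what remains of [f] once its first [m] coordinates are
    removed. *)
Lemma ev_dl f m t : ev f (dl m t) = f t - \sum_(i < m) chol i t * ev f (coord i).
Proof.
elim: m => [|m IH]; first by rewrite ev1 mul1r big_ord0 subr0.
rewrite ev_dlS IH big_ord_recr /= opprD addrA; congr (_ - _).
rewrite ev_scal /chol /cond_coef [RHS]mulrA -[_ / Num.sqrt _ / _]mulrA.
by rewrite -invfM -expr2 sqr_sqrtr ?cond_var_ge0.
Qed.

Lemma ev_chol_coord i j :
  ev (chol j) (coord i) = ((i == j) && (cond_var i != 0))%:R.
Proof.
have T0' i' : 0 <= T i'.+1 by exact: T0.
rewrite ev_scal -[chol j]/(fun t => kc j t _ / _).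
(* Both orders of [i] and [j] lead to the kernel of index [maxn i j]. If they differ, one of its
   arguments is already conditioned on and it vanishes. *)
transitivity ((Num.sqrt (cond_var i))^-1 * ((Num.sqrt (cond_var j))^-1 *
    kc (maxn i j) (T i.+1) (T j.+1))).
  congr (_ * _); rewrite -[maxn i j]/(maxn i j).
  have -> : kc (maxn i j) (T i.+1) (T j.+1) =
      ev (kc j (T j.+1)) (dl i (T i.+1)).
    have [ij|ji] := leqP i j; first by rewrite ev_dl_cov_ge.
    by rewrite ev_dl_cov// ltnW.
  by rewrite -evZ; apply: eq_ev => p _; rewrite mulrC cond_cov_sym.
have [->/=|ij/=] := eqVneq i j.
  rewrite maxnn -/(cond_var j) mulrA -invfM -expr2 sqr_sqrtr ?cond_var_ge0//.
  by have [->|v0] := eqVneq (cond_var j) 0; rewrite ?mulr0// mulVf.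
have [ltij|ltji|eqij] := ltngtP i j; last by rewrite eqij eqxx in ij.
- by rewrite cond_cov_sym cond_cov_null ?mulr0//= ltnW.
- by rewrite cond_cov_null ?mulr0//.
Qed.

Definition partial_path (c : nat -> R) m t := \sum_(i < m) c i * chol i t.

Lemma cond_cov_incr m t s : kc m t t + kc m s s - 2 * kc m t s =
  k t t + k s s - 2 * k t s - \sum_(i < m) (chol i t - chol i s) ^+ 2.
Proof.
rewrite !cond_cov_chol.
rewrite [X in _ = _ - X](_ : _ = \sum_(i < m) chol i t * chol i t +
  \sum_(i < m) chol i s * chol i s - 2 * \sum_(i < m) chol i t * chol i s).
  by ring.
rewrite mulr_sumr -big_split -sumrB /=; apply: eq_bigr => i _; ring.
Qed.

(** Bessel's inequality for increments: the difference of the two sides is a variance of the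
    conditioned kernel. *)
Lemma sum_chol_incr m t s : 0 <= t -> 0 <= s ->
  \sum_(i < m) (chol i t - chol i s) ^+ 2 <= k t t + k s s - 2 * k t s.
Proof.
move=> t0 s0; have := psd_incr (cond_cov_sym m) (@cond_cov_psd m) t0 s0.
by rewrite cond_cov_incr subr_ge0.
Qed.

Lemma cond_cov_incr_le m t s : kc m t t + kc m s s - 2 * kc m t s <=
  k t t + k s s - 2 * k t s.
Proof.
by rewrite cond_cov_incr gerBl sumr_ge0// => i _; exact: sqr_ge0.
Qed.

(** By Cauchy-Schwarz and Bessel, a path is as regular as the distance defined by the kernel, with a
    constant depending only on its squared coordinates and not on [m]. Every equicontinuity argument
    below rests on this. *)
Lemma partial_path_incr c m t s : 0 <= t -> 0 <= s ->
  (partial_path c m t - partial_path c m s) ^+ 2 <=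
  (\sum_(i < m) c i ^+ 2) * (k t t + k s s - 2 * k t s).
Proof.
move=> t0 s0; rewrite /partial_path -sumrB.
under eq_bigr do rewrite -mulrBr.
apply: (le_trans (CauchySchwarz_sum m c (fun i => chol i t - chol i s))).
by rewrite ler_wpM2l ?sum_chol_incr// sumr_ge0// => i _; exact: sqr_ge0.
Qed.

Lemma coord_degenerate f i : cond_var i = 0 -> ev f (coord i) = 0.
Proof. by move=> v0; rewrite ev_scal v0 sqrtr0 invr0 mul0r. Qed.

Lemma ev_partial_path c m i : ev (partial_path c m) (coord i) =
  if (i < m)%N && (cond_var i != 0) then c i else 0.
Proof.
rewrite /partial_path (ev_sum _ (fun (i : 'I_m) t => c i * chol i t)).
under eq_bigr do rewrite evZ ev_chol_coord.
case: ifPn => [/andP[im v0]|nim].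
  rewrite (bigD1 (Ordinal im)) //= eqxx v0 mulr1 big1 ?addr0// => j ji.
  rewrite [_ == _](_ : _ = false) ?mulr0//; apply/negbTE.
  by apply: contraNneq ji => ij; apply/eqP/val_inj.
apply: big1 => j _; case: eqVneq => [ij|]; last by rewrite mulr0.
by move: nim; rewrite ij ltn_ord /= => /negbTE ->; rewrite mulr0.
Qed.

(* A repeated conditioning time is degenerate but harmless. *)
Definition nondegenerate :=
  forall i, cond_var i = 0 -> exists2 j, (0 < j <= i)%N & T i.+1 = T j.

(** Unlike [cond_cov_null] this concerns an arbitrary [f], for which positivity says nothing about a
    time of zero variance. Nondegeneracy identifies such a time with an earlier one, where the
    induction hypothesis applies. *)
Lemma ev_dl_null f m j : nondegenerate -> (0 < j <= m)%N ->
  ev f (dl m (T j)) = 0.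
Proof.
move=> nondeg; elim: m j => [|m IH] j; first by case: j.
case/andP => j0; rewrite leq_eqVlt ev_dlS => /orP[/eqP ->|jm].
  rewrite /cond_coef; have [v0|v0] := eqVneq (cond_var m) 0.
    have [i im ->] := nondeg m v0.
    by rewrite IH// mulr0 subr0.
  by rewrite divff// mul1r subrr.
rewrite IH ?j0// /cond_coef (cond_cov_sym m (T j)) cond_cov_null ?j0//;
  last exact: T0.
by rewrite mul0r mul0r subrr.
Qed.

End conditioning.

(** * The kernel of fractional Brownian motion *)

Section negligible_powers.
Variable R : realType.
Implicit Types (D f g : R -> R) (q r a : R).

(* [D h] is o(h ^ q) as [h] tends to 0 from above. *)
Definition negligible D q := forall eta : R, 0 < eta ->
  exists2 delta, 0 < delta &
    forall h, 0 < h < delta -> `|D h| <= eta * h `^ q.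

Lemma negligible_ext D D' q : (forall h, 0 < h -> D h = D' h) ->
  negligible D q -> negligible D' q.
Proof.
move=> DD' oD eta /oD[de de0 h]; exists de => // u udp.
by rewrite -DD' ?h//; case/andP: udp.
Qed.

Lemma negligibleD D D' q : negligible D q -> negligible D' q ->
  negligible (fun h => D h + D' h) q.
Proof.
move=> oD oD' eta eta0; have eta2 : 0 < eta / 2 by rewrite divr_gt0.
have [d d0 Hd] := oD _ eta2; have [d' d'0 Hd'] := oD' _ eta2.
exists (Num.min d d'); first by rewrite lt_min d0.
move=> h; rewrite lt_min => /and3P[h0 hd hd'].
rewrite (le_trans (ler_normD _ _))//.
rewrite (splitr eta) mulrDl lerD// ?Hd ?Hd'// h0//.
Qed.

Lemma negligibleZ c D q : negligible D q -> negligible (fun h => c * D h) q.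
Proof.
move=> oD eta eta0; have c0 : 0 < `|c| + 1 by rewrite ltr_wpDl.
have [d d0 Hd] := oD (eta / (`|c| + 1)) (divr_gt0 eta0 c0).
exists d => // h /Hd hd; rewrite normrM.
apply: (@le_trans _ _ ((`|c| + 1) * `|D h|)).
  by rewrite ler_wpM2r// lerDl.
by rewrite mulrC -ler_pdivlMr// mulrAC.
Qed.

Lemma negligible0 q : negligible (fun=> 0) q.
Proof.
move=> eta eta0; exists 1 => // h _.
by rewrite normr0 mulr_ge0 ?powR_ge0// ltW.
Qed.

Lemma negligible_ev (F : R -> R -> R) q (l : seq (R * R)) :
  (forall p, p \in l -> negligible (F p.2) q) ->
  negligible (fun h => ev (F ^~ h) l) q.
Proof.
elim: l => [_|p l IH Fl].
  apply: (@negligible_ext (fun=> 0)); last exact: negligible0.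
  by move=> h _; rewrite ev_nil.
apply: (@negligible_ext (fun h => p.1 * F p.2 h + ev (F ^~ h) l)).
  by move=> h _; rewrite ev_cons.
apply: negligibleD; first by apply/negligibleZ/Fl; rewrite mem_head.
by apply: IH => r rl; apply: Fl; rewrite in_cons rl orbT.
Qed.

Lemma negligible_powR D q r C d : q < r -> 0 < d ->
  (forall h, 0 < h < d -> `|D h| <= C * h `^ r) -> negligible D q.
Proof.
move=> qr d0 HD eta eta0; have C0 : 0 < `|C| + 1 by rewrite ltr_wpDl.
have rq : 0 < r - q by rewrite subr_gt0.
(* Solves [(|C| + 1) * u ^ (r - q) = eta]. *)
pose u := (eta / (`|C| + 1)) `^ (r - q)^-1.
have u0 : 0 < u by rewrite powR_gt0// divr_gt0.
exists (Num.min d u); first by rewrite lt_min d0.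
move=> h; rewrite lt_min => /and3P[h0 hd hu].
apply: (le_trans (HD h _)); first by rewrite h0.
have -> : h `^ r = h `^ (r - q) * h `^ q.
  by rewrite -powRD ?subrK//; apply/implyP => _; rewrite gt_eqF.
rewrite mulrA ler_wpM2r ?powR_ge0//.
apply: (@le_trans _ _ ((`|C| + 1) * h `^ (r - q))).
  rewrite ler_wpM2r ?powR_ge0// (le_trans (ler_norm _))// lerDl//.
rewrite mulrC -ler_pdivlMr//.
have -> : eta / (`|C| + 1) = u `^ (r - q).
  by rewrite -powRrM mulVf ?gt_eqF// powRr1// ltW// divr_gt0.
by rewrite ge0_ler_powR// ?nnegrE ltW.
Qed.

Lemma derivable_lipschitz f a : derivable f a 1 ->
  exists L, exists2 d, 0 < d & forall h, `|h| < d -> `|f (a + h) - f a| <= L * `|h|.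
Proof.
move=> /cvg_ex[l /= /cvgrPdist_le/(_ 1 ltr01)].
rewrite near_withinE => /nbhs_ballP[d /= d0 Hd].
exists (`|l| + 1), d => // h hd; have [->|h0] := eqVneq h 0.
  by rewrite addr0 subrr normr0 mulr0.
have := Hd h; rewrite /ball/= sub0r normrN => /(_ hd h0).
rewrite [h *: 1]mulr1 (addrC h a) => Hh.
have -> : f (a + h) - f a = h * (h^-1 *: (f (a + h) - f a)).
  by rewrite -[_ *: _]/(_ * _) mulrA divff// mul1r.
rewrite normrM mulrC ler_wpM2r//.
by rewrite -lerBlDl (le_trans _ Hh)// distrC lerB_dist.
Qed.

Lemma negligible_derivable f a q : q < 1 -> derivable f a 1 ->
  negligible (fun h => f (a + h) - f a) q.
Proof.
move=> q1 /derivable_lipschitz[L [d d0 HL]].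
apply: (@negligible_powR _ q 1 L d) => // h /andP[h0 hd].
rewrite powRr1 ?(ltW h0)//; have := HL h.
by rewrite (gtr0_norm h0) => /(_ hd).
Qed.

(** The second difference is O(h ^ 2). The mean value theorem for the symmetric function [g] gives h
    times [dg c], and [dg c] is O(h) because the power of exponent [p - 1] is Lipschitz at [x]. *)
Lemma powR_second_difference p q x : 0 < x -> q < 2 ->
  negligible (fun h => (x + h) `^ p + (x - h) `^ p - 2 * x `^ p) q.
Proof.
move=> x0 q2.
have /derivable_lipschitz[L [d d0 HL]] : derivable (fun u : R => u `^ (p - 1)) x 1.
  by apply: derivable_powR; rewrite in_itv/= x0.
pose e := Num.min d x.
have e0 : 0 < e by rewrite lt_min d0.
apply: (@negligible_powR _ q 2 (`|p| * (L * 2)) e) => // h /andP[h0].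
rewrite lt_min => /andP[hd hx].
pose g u := (x + u) `^ p + (x - u) `^ p.
pose dg u := p * (x + u) `^ (p - 1) - p * (x - u) `^ (p - 1).
have g' u : 0 <= u <= h -> is_derive u 1 g (dg u).
  move=> /andP[u0 uh].
  have xu : 0 < x + u by rewrite ltr_pwDl.
  have xu' : 0 < x - u by rewrite subr_gt0 (le_lt_trans uh).
  have d1 : is_derive u 1 (fun v : R => x + v) 1.
    by have := is_deriveD (is_derive_cst x u 1) (is_derive_id u 1); rewrite add0r.
  have d2 : is_derive u 1 (fun v : R => x - v) (-1).
    by have := is_deriveB (is_derive_cst x u 1) (is_derive_id u 1); rewrite sub0r.
  have := is_derive1_powR p xu; have := is_derive1_powR p xu'.
  move=> D2 D1.
  have c1 := @is_derive1_comp _ (@powR R ^~ p) (fun v => x + v) u _ _ D1 d1.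
  have c2 := @is_derive1_comp _ (@powR R ^~ p) (fun v => x - v) u _ _ D2 d2.
  have := is_deriveD c1 c2.
  by rewrite /dg mulr1 mulrN1.
have [||c /[!in_itv]/= /andP[c0 ch] gh] := @MVT _ g dg 0 h h0.
- by move=> u /[!in_itv]/= /andP[u0 uh]; apply: g'; rewrite !ltW.
- apply: derivable_within_continuous => u /[!in_itv]/= uh.
  by have [] := g' u uh.
have -> : (x + h) `^ p + (x - h) `^ p - 2 * x `^ p = g h - g 0.
  by rewrite /g addr0 subr0; ring.
rewrite gh subr0 normrM (gtr0_norm h0) /dg -mulrBr normrM.
rewrite -!mulrA ler_wpM2l//.
have hc : `|c| < d by rewrite gtr0_norm// (lt_trans ch).
have HL1 := HL c hc; have := HL (- c); rewrite normrN => /(_ hc) HL2.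
rewrite (gtr0_norm c0) in HL1 HL2.
have L0 : 0 <= L.
  by rewrite -(pmulr_lge0 _ c0) (le_trans _ HL1).
have -> : L * (2 * h `^ 2) = L * 2 * h * h by rewrite powR_mulrn ?(ltW h0)//; ring.
rewrite ler_wpM2r ?(ltW h0)//.
apply: (@le_trans _ _ (L * 2 * c)); last by rewrite ler_wpM2l ?mulr_ge0// ltW.
rewrite -(subrKA (x `^ (p - 1))) (le_trans (ler_normD _ _))//.
rewrite (_ : L * 2 * c = L * c + L * c); last by ring.
by rewrite lerD// distrC.
Qed.

End negligible_powers.

(** Isolates the unit mass at [t] from masses at the conditioning times, so that a vanishing
    variance becomes a linear relation between sections of the kernel. *)
Lemma dl_tail (R : realType) (k : R -> R -> R) (T : nat -> R) m t : exists2 l,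
  forall f, ev f (dl k T m t) = f t + ev f l &
  forall p, p \in l -> exists2 j, (0 < j <= m)%N & p.2 = T j.
Proof.
elim: m t => [|m IH] t.
  by exists [::] => // f; rewrite ev1 mul1r ev_nil addr0.
have [l El Tl] := IH t; have [l' El' Tl'] := IH (T m.+1).
pose c := - cond_coef (cond_cov k T m) (T m.+1) t.
exists (l ++ scal c ((1, T m.+1) :: l')).
  move=> f; rewrite ev_dlS El El' ev_cat ev_scal ev_cons mul1r /c.
  by rewrite mulNr addrA.
move=> p; rewrite mem_cat /= in_cons => /or3P[/Tl[j jm ->]|/eqP ->|].
- by exists j => //; case/andP: jm => -> /leqW.
- by exists m.+1 => //=.
- case/mapP => r /Tl'[j jm rj] -> /=.
  by exists j => //; case/andP: jm => -> /leqW.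
Qed.

Section fbm_kernel.
Variables (R : realType) (H : R).
Hypothesis H01 : 0 < H < 1.
Local Notation k := (fbm_cov H).

Let H0 : 0 < H. Proof. by case/andP: H01. Qed.
Let H20 : 2 * H != 0. Proof. by rewrite mulf_neq0// gt_eqF. Qed.

Lemma fbm_cov_sym t s : k t s = k s t.
Proof. by rewrite /fbm_cov distrC (addrC (t `^ _)). Qed.

Lemma fbm_cov_diag t : 0 <= t -> k t t = t `^ (2 * H).
Proof. by move=> t0; rewrite /fbm_cov subrr normr0 powR0// subr0; field. Qed.

Lemma fbm_incr t s : 0 <= t -> 0 <= s ->
  k t t + k s s - 2 * k t s = `|t - s| `^ (2 * H).
Proof. by move=> t0 s0; rewrite !fbm_cov_diag// /fbm_cov; field. Qed.

(* The kernel has stationary increments and is self-similar. *)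
Lemma fbm_cov_scaling a e t s : 0 <= a -> 0 < e -> 0 <= t -> 0 <= s ->
  k (a + e * t) (a + e * s) - k (a + e * t) a - k a (a + e * s) + k a a =
  e `^ (2 * H) * k t s.
Proof.
move=> a0 e0 t0 s0; have e0' := ltW e0.
rewrite /fbm_cov subrr normr0 powR0//.
have -> : a + e * t - (a + e * s) = e * (t - s) by ring.
have -> : a + e * t - a = e * t by ring.
have -> : a - (a + e * s) = - (e * s) by ring.
rewrite normrN !normrM (ger0_norm t0) (ger0_norm s0) (gtr0_norm e0) !powRM//.
by field.
Qed.

Lemma fbm_second_difference s a : s != a -> 0 < a ->
  negligible (fun h => k (a + h) s + k (a - h) s - 2 * k a s) (2 * H).
Proof.
move=> sa a0; have H2 : 2 * H < 2 by case/andP: H01; lra.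
(* For h below this distance, [|a + h - s|] and [|a - h - s|] are [|a - s| + h] and [|a - s| - h] in
   some order, so only second differences of powers at positive points occur. *)
have x0 : 0 < `|a - s| by rewrite normr_gt0 subr_eq0 eq_sym.
have N1 := powR_second_difference (2 * H) a0 H2.
have N2 := negligibleZ (-1) (powR_second_difference (2 * H) x0 H2).
have := negligibleZ 2^-1 (negligibleD N1 N2).
move=> + eta eta0 => /(_ eta eta0)[d d0 Hd].
exists (Num.min d `|a - s|); first by rewrite lt_min d0.
move=> h; rewrite lt_min => /and3P[h0 hd hx].
have := Hd h; rewrite h0 hd => /(_ isT); apply: le_trans.
rewrite le_eqVlt; apply/orP; left; apply/eqP; congr `|_|; rewrite /fbm_cov.
suff : `|a + h - s| `^ (2 * H) + `|a - h - s| `^ (2 * H) =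
  (`|a - s| + h) `^ (2 * H) + (`|a - s| - h) `^ (2 * H) by move=> E; lra.
have [sa'|as'] := ltP s a.
  rewrite gtr0_norm ?subr_gt0// in hx *.
  rewrite gtr0_norm ?subr_gt0//; last by lra.
  by rewrite gtr0_norm ?subr_gt0//; [congr (_ `^ _ + _ `^ _); ring|lra].
have {}as' : a < s by rewrite lt_neqAle as' eq_sym sa.
rewrite ltr0_norm ?subr_lt0// in hx *.
rewrite ltr0_norm ?subr_lt0//; last by lra.
rewrite ltr0_norm ?subr_lt0//; last by lra.
by rewrite addrC; congr (_ `^ _ + _ `^ _); ring.
Qed.

(* The second difference at [a] of [k ^~ a] is [- h `^ (2 * H)] up to a
   negligible term, whereas that of [k ^~ s] is negligible for [s != a]. *)
Lemma fbm_independent a (l : seq (R * R)) : 0 < a ->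
  (forall p, p \in l -> p.2 != a) ->
  (forall u, 0 <= u -> k u a = ev (k u) l) -> False.
Proof.
move=> a0 la kal.
have oev : negligible
    (fun h => ev (fun s => k (a + h) s + k (a - h) s - 2 * k a s) l) (2 * H).
  apply: (@negligible_ev _ (fun s h => k (a + h) s + k (a - h) s - 2 * k a s)).
  by move=> p /la pa; exact: fbm_second_difference.
have H2 : 2 * H < 2 by case/andP: H01; lra.
have ndiff := powR_second_difference (2 * H) a0 H2.
(* With X = h ^ (2 H), the second difference is y / 2 - X with |y| <= X / 4, hence at least 7 X / 8
   in absolute value, while the combination would bound it by X / 4. *)
have q0 : 0 < 4^-1 :> R by rewrite invr_gt0.
have [d1 d10 Hd1] := oev 4^-1 q0.
have [d2 d20 Hd2] := ndiff 4^-1 q0.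
pose h := Num.min (Num.min d1 d2) a / 2.
have m0 : 0 < Num.min (Num.min d1 d2) a by rewrite !lt_min d10 d20.
have h0 : 0 < h by rewrite divr_gt0.
have hm : h < Num.min (Num.min d1 d2) a by rewrite ltr_pdivrMr//; lra.
move: hm; rewrite !lt_min => /andP[/andP[hd1 hd2] ha].
have := Hd1 h; rewrite h0 hd1 => /(_ isT).
rewrite evD evD evN evZ -!kal; [|lra..].
have := Hd2 h; rewrite h0 hd2 => /(_ isT).
have -> : k (a + h) a + k (a - h) a - 2 * k a a =
  ((a + h) `^ (2 * H) + (a - h) `^ (2 * H) - 2 * a `^ (2 * H)) / 2 - h `^ (2 * H).
  rewrite /fbm_cov subrr normr0 powR0//.
  have -> : a + h - a = h by ring.
  have -> : a - h - a = - h by ring.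
  by rewrite normrN gtr0_norm//; field.
have : 0 < h `^ (2 * H) by rewrite powR_gt0.
move: (h `^ _) (_ - 2 * a `^ _) => x y x0.
by rewrite !ler_norml => /andP[? ?] /andP[? ?]; lra.
Qed.

Lemma fbm_nondegenerate (T : nat -> R) : psd k ->
  (forall j, (0 < j)%N -> 0 < T j) -> nondegenerate k T.
Proof.
move=> kpsd T_gt0 i v0; apply: contrapT => noj.
have T_ge0 j : (0 < j)%N -> 0 <= T j by move=> /T_gt0 /ltW.
have [l El Tl] := dl_tail k T i (T i.+1).
(* A zero variance at a new time makes every [k u (T i.+1)] the same combination of values of [k u]
   at earlier times. *)
apply: (@fbm_independent (T i.+1) (scal (-1) l)).
- exact: T_gt0.
- move=> p /mapP[r rl ->] /=; apply/eqP => rT.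
  by have [j ij rj] := Tl r rl; apply: noj; exists j; rewrite -?rT.
- move=> u u0; have := El (k u); rewrite (ev_cov_dl T fbm_cov_sym).
  rewrite cond_cov_sym; last exact: fbm_cov_sym.
  rewrite psd_null ?T_ge0//.
  + by rewrite ev_scal mulN1r => /eqP; rewrite eq_sym addr_eq0 => /eqP.
  + exact/cond_cov_sym/fbm_cov_sym.
  + exact: (cond_cov_psd fbm_cov_sym).
Qed.

End fbm_kernel.

(** * Exponential moments of Gaussian laws *)

Section gaussian_mgf.
Context (R : realType).
Local Notation mu := (@lebesgue_measure R).
Implicit Types (m s v u : R).

(** The Radon-Nikodym derivative of the normal law and [normal_pdf] have the same integrals over
    measurable sets, hence agree almost everywhere. *)
Lemma ge0_integral_normal_prob m s (f : R -> \bar R) :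
  measurable_fun setT f -> (forall x, (0 <= f x)%E) ->
  (\int[normal_prob m s]_x f x = \int[mu]_x (f x * (normal_pdf m s x)%:E))%E.
Proof.
move=> mf f0; pose h := Radon_Nikodym_SigmaFinite.f (normal_prob m s) mu.
have dom := normal_prob_dominates m s.
have inth : mu.-integrable setT h by exact: Radon_Nikodym_SigmaFinite.f_integrable.
have mpdf : measurable_fun setT (fun x => (normal_pdf m s x)%:E).
  by apply/measurable_EFinP; exact: measurable_normal_pdf.
rewrite -(Radon_Nikodym_SigmaFinite.change_of_variables dom)//.
apply: ae_eq_integral => //.
- by apply: emeasurable_funM => //; exact: measurable_int inth.
- exact: emeasurable_funM.
- apply: ae_eqe_mul2l; apply: integral_ae_eq => //.
  move=> A _ mA; rewrite -Radon_Nikodym_SigmaFinite.f_integral//.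
Qed.

Lemma normal_mgf m s u : s != 0 ->
  (\int[normal_prob m s]_x (expR (u * x))%:E =
   (expR (u * m + u ^+ 2 * s ^+ 2 / 2))%:E)%E.
Proof.
move=> s0; rewrite ge0_integral_normal_prob; last 2 first.
- by apply/measurable_EFinP; apply: measurableT_comp.
- by move=> x; rewrite lee_fin expR_ge0.
pose c := expR (u * m + u ^+ 2 * s ^+ 2 / 2).
(* Completing the square: tilting a normal density by an exponential shifts its mean. *)
have E x : expR (u * x) * normal_pdf m s x = c * normal_pdf (m + u * s ^+ 2) s x.
  rewrite !normal_pdfE// mulrCA [RHS]mulrCA; congr (_ * _).
  rewrite /normal_fun /c -!expRD; congr expR; field.
  by rewrite s0.
under eq_integral do rewrite -EFinM E EFinM.
rewrite ge0_integralZl//.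
- by rewrite integral_normal_pdf mule1.
- by apply/measurable_EFinP; exact: measurable_normal_pdf.
- by move=> x _; rewrite lee_fin normal_pdf_ge0.
- by rewrite lee_fin expR_ge0.
Qed.

Context d (Om : measurableType d) (P : probability Om R).

(** The case [v = 0] covers Dirac masses, so degenerate and nondegenerate laws are treated alike. *)
Definition has_gaussian_mgf (Y : Om -> R) m v := forall u,
  (\int[P]_w (expR (u * Y w))%:E = (expR (u * m + u ^+ 2 * v / 2))%:E)%E.

Lemma gaussian_has_mgf (Y : Om -> R) : measurable_fun setT Y -> gaussian P Y ->
  exists m v, has_gaussian_mgf Y m v.
Proof.
move=> mY [m [s Ps]]; exists m, (s ^+ 2) => u.
have mY' : @measurable_fun _ _ Om (measurableTypeR R) setT Y := mY.
pose Y' : {mfun Om >-> measurableTypeR R} :=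
  @mfun_Sub _ _ Om (measurableTypeR R) Y (mem_set mY').
have mexp : measurable_fun setT (fun x : measurableTypeR R => (expR (u * x))%:E).
  by apply/measurable_EFinP; apply: measurableT_comp.
transitivity (\int[distribution P Y']_x (expR (u * x))%:E)%E.
  by rewrite ge0_integral_distribution// => x; rewrite lee_fin expR_ge0.
have [s0|s0] := eqVneq s 0.
  transitivity (\int[@dirac _ (measurableTypeR R) m R]_x (expR (u * x))%:E)%E.
    apply: eq_measure_integral => A mA _.
    by have := Ps A mA; rewrite /gaussian_law s0 eqxx.
  rewrite integral_dirac// diracT mul1e s0; congr (expR _)%:E.
  by rewrite expr0n mulr0 mul0r addr0.
rewrite -(normal_mgf m u s0); apply: eq_measure_integral.
by move=> A mA _; have := Ps A mA; rewrite /gaussian_law (negbTE s0).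
Qed.

End gaussian_mgf.

Lemma norm_le_expR (R : realType) (y : R) : `|y| <= expR y + expR (- y).
Proof.
have h (z : R) : z <= expR z by rewrite (le_trans _ (expR_ge1Dx z))// ler_wpDl.
have [y0|y0] := ger0P y.
  by rewrite (le_trans (h y))// lerDl expR_ge0.
by rewrite (le_trans (h (- y)))// lerDr expR_ge0.
Qed.

Lemma expR_norm_le (R : realType) (y : R) : expR `|y| <= expR y + expR (- y).
Proof.
have [y0|y0] := ger0P y; first by rewrite lerDl expR_ge0.
by rewrite lerDr expR_ge0.
Qed.

Lemma sqr_le_expR (R : realType) (y : R) : y ^+ 2 <= 2 * (expR y + expR (- y)).
Proof.
rewrite -ler_pdivrMl// -real_normK ?num_real//.
apply: le_trans (expR_norm_le y).
have := expR_ge1Dxn 1 (normr_ge0 y); rewrite mulrC.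
by apply: le_trans; rewrite lerDr.
Qed.

Lemma expR_le_quadratic (R : realType) (x : R) : `|x| <= 2^-1 ->
  expR x <= 1 + x + 2 * x ^+ 2.
Proof.
rewrite ler_norml => /andP[x1 x2].
have h : 1 - x <= expR (- x) by exact: expR_ge1Dx.
have e0 : 0 < expR x by exact: expR_gt0.
have e1 : expR x * expR (- x) = 1 by exact: expRxMexpNx_1.
have h1 : expR x * (1 - x) <= 1 by rewrite -[leRHS]e1 ler_wpM2l// ltW.
have x3 : 0 < 1 - x by lra.
rewrite -(ler_pM2r x3) (le_trans h1)//.
have -> : (1 + x + 2 * x ^+ 2) * (1 - x) = 1 + x ^+ 2 * (1 - 2 * x) by ring.
by rewrite lerDl mulr_ge0 ?sqr_ge0//; lra.
Qed.

(** Replaces a passage to the limit when first or second order terms of two expansions are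
    compared. *)
Lemma le0_small_multiple (R : realFieldType) (a t0 D : R) : 0 < t0 ->
  (forall t, 0 < t <= t0 -> a <= t * D) -> a <= 0.
Proof.
move=> t00 h; rewrite leNgt; apply/negP => a0.
have D0 : 0 < D.
  by have := h t0; rewrite t00 lexx => /(_ isT) /(lt_le_trans a0); rewrite pmulr_rgt0.
pose t := Num.min t0 (a / (2 * D)).
have t_gt0 : 0 < t by rewrite lt_min t00 divr_gt0// mulr_gt0.
have tt0 : t <= t0 by rewrite ge_min lexx.
have := h t; rewrite t_gt0 tt0 => /(_ isT).
have : t * D <= a / 2.
  have -> : a / 2 = a / (2 * D) * D by field; rewrite gt_eqF.
  by rewrite ler_wpM2r ?(ltW D0)// ge_min lexx orbT.
by lra.
Qed.

(** Reduces quadratic bounds on cosh, from both sides, to linear bounds on sinh at half the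
    argument. *)
Lemma cosh_half (R : realType) (y : R) :
  expR y + expR (- y) = (expR (y / 2) - expR (- (y / 2))) ^+ 2 + 2.
Proof.
have e1 := expRxMexpNx_1 (y / 2).
have e2 (z : R) : expR z = expR (z / 2) ^+ 2 by rewrite -expRM_natl;
  congr expR; field.
by rewrite (e2 y) (e2 (- y)) mulNr; lra.
Qed.

Lemma sinh_ge (R : realType) (z : R) : 0 <= z -> 2 * z <= expR z - expR (- z).
Proof.
rewrite le_eqVlt => /predU1P[<-|z0]; first by rewrite oppr0 subrr mulr0.
have dN (u : R) : is_derive u 1 (fun v : R => expR (- v)) (- expR (- u)).
  have n1 : is_derive u 1 (@GRing.opp R) (-1) by have := is_deriveN
    (is_derive_id u 1).
  have := @is_derive1_comp _ (@expR R) (@GRing.opp R) u _ _ (is_derive_expR (- u)) n1.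
  by rewrite mulrN1.
have d (u : R) : is_derive u 1 (fun v : R => expR v - expR (- v)) (expR u +
  expR (- u)).
  by have := is_deriveB (is_derive_expR u) (dN u); rewrite opprK.
pose f (v : R) := expR v - expR (- v).
have cf : {within `[0, z], continuous f}.
  by apply: derivable_within_continuous => u _; have [] := d u.
have df u : u \in `]0, z[ -> is_derive u 1 f (expR u + expR (- u)).
  by move=> _; exact: d.
have [c /[!in_itv]/= /andP[c0 _]] := MVT z0 df cf.
rewrite /f /= oppr0 subrr !subr0 addr0 => ->.
rewrite ler_wpM2r ?(ltW z0)//.
rewrite cosh_half.
by rewrite lerDr sqr_ge0.
Qed.

Lemma cosh_ge (R : realType) (y : R) : 2 + y ^+ 2 <= expR y + expR (- y).
Proof.
wlog y0 : y / 0 <= y.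
  move=> h; have [|y0] := leP 0 y; first exact: h.
  by have := h (- y); rewrite opprK sqrrN [expR (- y) + _]addrC; apply; lra.
have h := @sinh_ge R (y / 2) ltac:(by rewrite divr_ge0).
rewrite cosh_half.
rewrite addrC lerD2r.
move: h; have -> : 2 * (y / 2) = y by field.
by move=> h; rewrite ler_sqr// ?nnegrE// (le_trans y0).
Qed.

Lemma cosh_le (R : realType) (y : R) :
  expR y + expR (- y) <= 2 + y ^+ 2 + `|y| ^+ 3 * expR `|y|.
Proof.
wlog y0 : y / 0 <= y.
  move=> h; have [|y0] := leP 0 y; first exact: h.
  by have := h (- y); rewrite opprK sqrrN normrN [expR (- y) + _]addrC; apply; lra.
rewrite ger0_norm//.
rewrite cosh_half.
rewrite [leLHS]addrC -[leRHS]addrA lerD2l.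
have h0 : 0 <= expR (y / 2) - expR (- (y / 2)).
  by have := @sinh_ge R (y / 2) ltac:(by rewrite divr_ge0); lra.
have h : expR (y / 2) - expR (- (y / 2)) <= y * expR (y / 2).
  have -> : expR (- (y / 2)) = expR (y / 2) * expR (- y).
    by rewrite -expRD; congr expR; field.
  rewrite -{1}(mulr1 (expR (y / 2))) -mulrBr mulrC ler_wpM2r ?expR_ge0//.
  by have := expR_ge1Dx (- y); lra.
apply: (@le_trans _ _ ((y * expR (y / 2)) ^+ 2)).
  by rewrite ler_sqr ?nnegrE// mulr_ge0// expR_ge0.
rewrite exprMn -expRM_natl; have -> : 2%:R * (y / 2) = y by field.
have -> : y ^+ 2 + y ^+ 3 * expR y = y ^+ 2 * (1 + y * expR y) by ring.
rewrite ler_wpM2l ?sqr_ge0//.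
have e1 : expR y * expR (- y) = 1 by exact: expRxMexpNx_1.
have : expR y * (1 - y) <= 1.
  by rewrite -[leRHS]e1 ler_wpM2l ?expR_ge0//; exact: expR_ge1Dx.
by rewrite mulrBr mulr1 lerBlDr (mulrC y).
Qed.

Section gaussian_moments.
Context (R : realType) d (Om : measurableType d) (P : probability Om R).
Variables (Y : Om -> R) (m v : R).
Hypotheses (mY : measurable_fun setT Y) (Ymgf : has_gaussian_mgf P Y m v).

Lemma measurable_exp_scale u : measurable_fun setT (fun w => (expR (u * Y w))%:E).
Proof.
apply/measurable_EFinP; apply: measurableT_comp => //.
exact: measurable_funM.
Qed.

Lemma integrable_exp_scale u : P.-integrable setT (fun w => (expR (u * Y w))%:E).
Proof.
apply/integrableP; split; first exact: measurable_exp_scale.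
under eq_integral do rewrite gee0_abs ?lee_fin ?expR_ge0//.
by rewrite Ymgf ltry.
Qed.

Lemma integrable_exp_dominated (f : Om -> R) (C u : R) : measurable_fun setT f ->
  (forall w, `|f w| <= C * (expR (u * Y w) + expR (- u * Y w))) ->
  P.-integrable setT (EFin \o f).
Proof.
move=> mf fC.
apply: (@le_integrable _ _ _ P _ measurableT _
  (fun w => (C%:E * ((expR (u * Y w))%:E + (expR (- u * Y w))%:E))%E)) => //.
- exact/measurable_EFinP.
- move=> w _; rewrite -EFinD -EFinM /= lee_fin (le_trans (fC w))//.
  exact: ler_norm.
- apply: integrableZl => //.
  by apply: integrableD => //; exact: integrable_exp_scale.
Qed.

Lemma gaussian_integrable : P.-integrable setT (EFin \o Y).
Proof.
apply: (@integrable_exp_dominated _ 1 1) => // w.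
by rewrite mul1r mul1r mulN1r norm_le_expR.
Qed.

Lemma gaussian_integrable_sqr : P.-integrable setT (EFin \o (fun w => Y w ^+ 2)).
Proof.
apply: (@integrable_exp_dominated _ 2 1).
  exact: measurable_funX.
by move=> w; rewrite mul1r mulN1r ger0_norm ?sqr_ge0// sqr_le_expR.
Qed.

Local Notation E f := (\int[P]_w f w).

Lemma Rintegral_exp_scale u : E (fun w => expR (u * Y w)) = expR (u * m + u ^+
  2 * v / 2).
Proof. by rewrite /Rintegral Ymgf. Qed.

(** Integrating [1 + u * Y <= expR (u * Y)] shows that the exponential moment is at least 1 for all
    [u]; its first order term at 0 must then vanish. No differentiation under the integral is
    involved. *)
Lemma gaussian_mean : E Y = 0 -> m = 0.
Proof.
move=> EY0.
have lb u : 1 <= expR (u * m + u ^+ 2 * v / 2).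
  rewrite -Rintegral_exp_scale.
  have -> : 1 = E (fun w => 1 + u * Y w).
    rewrite RintegralD//=; last 2 first.
    - exact: finite_measure_integrable_cst.
    - have := integrableZl measurableT u gaussian_integrable; exact.
    rewrite RintegralZl//=; last exact: gaussian_integrable.
    rewrite EY0 mulr0 addr0 Rintegral_cst// mul1r.
    by rewrite /= probability_setT.
  apply: le_Rintegral => //=.
  - have i1 : P.-integrable setT (EFin \o cst 1).
      exact: finite_measure_integrable_cst.
    have i2 := integrableZl measurableT u gaussian_integrable.
    by have := integrableD measurableT i1 i2; exact.
  - exact: integrable_exp_scale.
  - by move=> w _; exact: expR_ge1Dx.
(* The sign of [v] is not known here. For t up to [(2 * (K + 1))^-1] the exponent stays below 1/2 in
   absolute value, where [expR_le_quadratic] applies. *)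
pose K := `|m| + `|v|.
have K0 : 0 <= K by rewrite addr_ge0.
have small s t : `|s| = 1 -> 0 < t <= (2 * (K + 1))^-1 ->
    - (s * m) <= t * (`|v| + 2 * K ^+ 2).
  move=> s1 /andP[t0 tK].
  have tK1 : t * (K + 1) <= 2^-1.
    by rewrite -ler_pdivlMr ?ltr_wpDl// -invfM.
  have t1 : t <= 1 by nra.
  have := lb (s * t); set x := s * t * m + _.
  have ss : s ^+ 2 = 1 by rewrite -real_normK ?num_real// s1 expr1n.
  have xE : x = t * (s * m + t * v / 2) by rewrite /x exprMn ss; ring.
  have smv : `|s * m + t * v / 2| <= K.
    rewrite (le_trans (ler_normD _ _))// !normrM s1 mul1r lerD2l (gtr0_norm t0).
    rewrite [`|2^-1|]ger0_norm ?invr_ge0//.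
    have h : 0 <= (1 - t) * `|v| by rewrite mulr_ge0// subr_ge0.
    by have := normr_ge0 v; lra.
  have xK : `|x| <= t * K.
    by rewrite xE normrM (gtr0_norm t0) ler_wpM2l// ltW.
  have x2 : x ^+ 2 <= (t * K) ^+ 2.
    by rewrite -real_normK ?num_real// ler_sqr ?nnegrE// mulr_ge0// ltW.
  move=> lbx.
  have := @expR_le_quadratic R x; rewrite (le_trans xK); last by nra.
  move=> /(_ isT) /(le_trans lbx).
  rewrite {1}xE => h.
  have : 0 <= t * (s * m + t * v / 2 + 2 * (t * K ^+ 2)).
    by move: h x2; rewrite exprMn expr2; nra.
  rewrite pmulr_rge0// => h2.
  have h3 : t * v <= t * `|v| by rewrite ler_wpM2l ?(ltW t0)// ler_norm.
  have h4 : 0 <= t * `|v| by rewrite mulr_ge0// ltW.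
  by lra.
have t00 : 0 < (2 * (K + 1))^-1 by rewrite invr_gt0 mulr_gt0// ltr_wpDl.
apply/eqP; rewrite eq_le; apply/andP; split.
  apply: (le0_small_multiple t00) => t /(small (-1)).
  by rewrite normrN1 mulN1r opprK; apply.
rewrite -oppr_le0; apply: (le0_small_multiple t00) => t /(small 1).
by rewrite normr1 mul1r; apply.
Qed.

(** The sum of the exponential moments at [u] and [- u] lies between [2 + u ^+ 2 * V] and the same
    plus O(u ^ 3); comparing the terms of order two gives the value. *)
Lemma gaussian_variance : m = 0 -> v = E (fun w => Y w ^+ 2).
Proof.
move=> m0; set V := E _.
have mgf u : expR (u * m + u ^+ 2 * v / 2) = expR (u ^+ 2 * v / 2).
  by rewrite m0 mulr0 add0r.
have intE u : P.-integrable setT (EFin \o (fun w => expR (u * Y w) + expR (- u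
  * Y w))).
  have := integrableD measurableT (integrable_exp_scale u)
    (integrable_exp_scale (- u)).
  exact.
have intq u : P.-integrable setT (EFin \o (fun w => 2 + u ^+ 2 * Y w ^+ 2)).
  have i2 := integrableZl measurableT (u ^+ 2) gaussian_integrable_sqr.
  have i1 : P.-integrable setT (EFin \o cst 2) by exact:
    finite_measure_integrable_cst.
  by have := integrableD measurableT i1 i2; exact.
have EE u : E (fun w => expR (u * Y w) + expR (- u * Y w)) = 2 * expR (u ^+ 2 *
  v / 2).
  rewrite RintegralD//=; [|exact: integrable_exp_scale..].
  by rewrite !Rintegral_exp_scale !mgf sqrrN; ring.
have Eq u : E (fun w => 2 + u ^+ 2 * Y w ^+ 2) = 2 + u ^+ 2 * V.
  have i2 := gaussian_integrable_sqr.
  rewrite RintegralD//=; last 2 first.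
  - exact: finite_measure_integrable_cst.
  - by have := integrableZl measurableT (u ^+ 2) i2; exact.
  rewrite Rintegral_cst//= probability_setT mulr1; congr (_ + _).
  by rewrite RintegralZl.
have lb u : 2 + u ^+ 2 * V <= 2 * expR (u ^+ 2 * v / 2).
  rewrite -EE -Eq; apply: le_Rintegral => //.
  by move=> w _; rewrite mulNr -exprMn; exact: cosh_ge.
(* The remainder |Y| ^ 3 exp |Y| is at most 6 exp (2 |Y|), hence at most 6 times the sum of the
   exponentials of 2 Y and -2 Y, whose expectation is twice the exponential moment at 2. *)
pose C := 12 * expR (2 ^+ 2 * v / 2).
have ub u : 0 < u <= 1 -> 2 * expR (u ^+ 2 * v / 2) <= 2 + u ^+ 2 * V + u ^+ 3 * C.
  move=> /andP[u0 u1].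
  have -> : 2 + u ^+ 2 * V + u ^+ 3 * C = E (fun w => (2 + u ^+ 2 * Y w ^+ 2) +
      (u ^+ 3 * 6) * (expR (2 * Y w) + expR (- 2 * Y w))).
    rewrite RintegralD//=; last first.
      by have := integrableZl measurableT (u ^+ 3 * 6) (intE 2); exact.
    rewrite Eq RintegralZl//= EE /C; ring.
  rewrite -EE; apply: le_Rintegral => //=.
    have := integrableD measurableT (intq u)
      (integrableZl measurableT (u ^+ 3 * 6) (intE 2)).
    exact.
  move=> w _; have := @cosh_le R (u * Y w).
  rewrite !mulNr exprMn => /le_trans; apply; rewrite lerD2l.
  rewrite normrM (gtr0_norm u0) exprMn -mulrA -mulrA.
  rewrite ler_wpM2l ?exprn_ge0 ?(ltW u0)//.
  set y := Y w.
  have h3 : `|y| ^+ 3 <= 6 * expR `|y|.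
    have := expR_ge1Dxn 2 (normr_ge0 y).
    have -> : 3`!%:R = 6 :> R by [].
    by lra.
  have hu : expR (u * `|y|) <= expR `|y|.
    by rewrite ler_expR ler_piMl.
  apply: (@le_trans _ _ (6 * expR `|y| * expR `|y|)).
    exact: ler_pM.
  rewrite -mulrA ler_wpM2l// -expRD.
  have -> : `|y| + `|y| = `|2 * y| by rewrite normrM ger0_norm//; ring.
  exact: expR_norm_le.
apply/eqP; rewrite eq_le; apply/andP; split; rewrite -subr_le0.
  apply: (@le0_small_multiple _ _ 1 C) => // u u01.
  have := ub u u01; have := expR_ge1Dx (u ^+ 2 * v / 2).
  case/andP: u01 => u0 _ h1 h2.
  have : u ^+ 2 * (v - V) <= u ^+ 2 * (u * C) by move: h1 h2;
    rewrite !exprS expr0; lra.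
  by rewrite ler_pM2l// exprn_gt0.
pose K := `|v| + 1; have K0 : 0 < K by rewrite ltr_wpDl.
apply: (@le0_small_multiple _ _ K^-1 (K ^+ 2)); first by rewrite invr_gt0.
move=> u /andP[u0 uK].
have uK1 : u * K <= 1 by rewrite -ler_pdivlMr// mul1r.
have K1 : 1 <= K by rewrite lerDr.
have u1 : u <= 1 by nra.
have vK : `|v| <= K by rewrite lerDl.
have x1 : `|u ^+ 2 * v / 2| <= 2^-1.
  rewrite 2!normrM [`|u ^+ 2|]ger0_norm ?sqr_ge0// [`|2^-1|]ger0_norm ?invr_ge0//.
  by have := normr_ge0 v; nra.
have := lb u; have := expR_le_quadratic x1 => h1 h2.
have v2 : v ^+ 2 <= K ^+ 2.
  by rewrite -real_normK ?num_real// ler_sqr ?nnegrE// ltW.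
have : u ^+ 2 * (V - v) <= u ^+ 2 * (u ^+ 2 * v ^+ 2).
  by move: h1 h2; rewrite [X in _ + 2 * X](_ : _ = u ^+ 4 * v ^+ 2 / 4); [lra|field].
rewrite ler_pM2l ?exprn_gt0// => /le_trans; apply.
apply: ler_pM => //; [exact: sqr_ge0..|].
by rewrite expr2 ler_piMl// ltW.
Qed.

End gaussian_moments.

(** * Moments of linear combinations of fractional Brownian motion *)

Section fbm_mgf.
Context (R : realType) d (Om : measurableType d) (P : probability Om R).
Variables (H : R) (X : R -> {RV P >-> R}).
Hypothesis fX : fBm P H X.
Local Notation k := (fbm_cov H).

Lemma integrable_sqr_Lfun2 (Y : Om -> R) : measurable_fun setT Y ->
  P.-integrable setT (EFin \o (fun w => Y w ^+ 2)) -> Y \in Lfun P 2%:E.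
Proof.
move=> mY /integrableP[_ iY]; rewrite inE; apply/andP; split; rewrite inE//=.
rewrite /finite_norm unlock poweR_lty//; apply: le_lt_trans iY.
rewrite le_eqVlt; apply/orP; left; apply/eqP; apply: eq_integral => w _ /=.
by rewrite normrX powR_mulrn.
Qed.

Lemma evX_nil : (fun w => ev (X ^~ w) [::]) = cst 0.
Proof. by apply/funext => w; rewrite ev_nil. Qed.

Lemma evX_cons p l : (fun w => ev (X ^~ w) (p :: l)) =
  ((p.1 \o* X p.2) \+ (fun w => ev (X ^~ w) l)).
Proof. by apply/funext => w; rewrite ev_cons /= mulrC. Qed.

Lemma measurable_ev l : measurable_fun setT (fun w => ev (X ^~ w) l).
Proof.
elim: l => [|p l IH]; first by rewrite evX_nil.
by rewrite evX_cons; apply: measurable_funD.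
Qed.

Lemma gaussian_ev l : nonneg_times l -> gaussian P (fun w => ev (X ^~ w) l).
Proof.
move=> l0; have [_ gX _ _] := fX.
have := gX (size l) (fun i => (nth (0, 0) l i).2) (fun i => (nth (0, 0) l i).1).
have t0 (i : 'I_(size l)) : 0 <= (nth (0, 0) l i).2.
  by have /allP/(_ _ (mem_nth (0, 0) (ltn_ord i))) := l0.
move=> /(_ t0); congr (gaussian P _); apply/funext => w.
by rewrite /ev (big_nth (0, 0)) big_mkord.
Qed.

Lemma fbm_Lfun2 t : 0 <= t -> (X t : Om -> R) \in Lfun P 2%:E.
Proof.
move=> t0; apply: integrable_sqr_Lfun2 => //.
have : gaussian P (fun w => ev (X ^~ w) [:: (1, t)]).
  by apply: gaussian_ev; rewrite /= t0.
have -> : (fun w => ev (X ^~ w) [:: (1, t)]) = X t.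
  by apply/funext => w; rewrite ev1 mul1r.
move=> /gaussian_has_mgf[//|m [v mgf]].
exact: (gaussian_integrable_sqr _ mgf).
Qed.

Lemma scaled_Lfun2 a t : 0 <= t -> (a \o* X t : Om -> R) \in Lfun P 2%:E.
Proof. by move=> t0; apply: Lfun_scale; [rewrite ler1n|exact: fbm_Lfun2]. Qed.

Lemma ev_Lfun2 l : nonneg_times l -> (fun w => ev (X ^~ w) l) \in Lfun P 2%:E.
Proof.
elim: l => [_|p l IH /= /andP[p0 l0]].
  by rewrite evX_nil Lfun_cst.
rewrite evX_cons.
apply: rpredD => [|p1|p1]; first by rewrite lee_fin ler1n.
- by have := scaled_Lfun2 p.1 p0.
- exact: IH.
Qed.

Lemma covariance_ev l l' : nonneg_times l -> nonneg_times l' ->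
  covariance P (fun w => ev (X ^~ w) l) (fun w => ev (X ^~ w) l') =
  (bil k l l')%:E.
Proof.
have [_ _ _ cX] := fX.
have Pfin : P setT \is a fin_num := fin_num_measure P _ measurableT.
have L1 Z : Z \in Lfun P 2%:E -> Z \in Lfun P 1 by exact: Lfun_subset12.
have covX t s : 0 <= t -> nonneg_times s ->
    covariance P (X t) (fun w => ev (X ^~ w) s) = (ev (k t) s)%:E.
  move=> t0; elim: s => [|p s IH] /= => [_|/andP[p0 s0]].
    by rewrite evX_nil covariance_cst_r ev_nil.
  have X2 := fbm_Lfun2 t0; have Y2 := fbm_Lfun2 p0.
  rewrite evX_cons covarianceDr ?scaled_Lfun2//; last exact: ev_Lfun2.
  rewrite covarianceZr; [|exact: L1|exact: L1|exact: Lfun2_mul_Lfun1].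
  by rewrite IH// cX// ev_cons EFinD EFinM.
elim: l => [|p l IH] /= => [_ _|/andP[p0 l0] l'0].
  by rewrite evX_nil covariance_cst_l /bil ev_nil.
have X2 := fbm_Lfun2 p0; have Y2 := ev_Lfun2 l'0.
rewrite evX_cons covarianceDl ?scaled_Lfun2//; last exact: ev_Lfun2.
rewrite covarianceZl; [|exact: L1|exact: L1|exact: Lfun2_mul_Lfun1].
by rewrite IH// covX// /bil ev_cons EFinD EFinM.
Qed.

Lemma expectation_ev l : nonneg_times l -> ('E_P[fun w => ev (X ^~ w) l] = 0)%E.
Proof.
have [_ _ EX _] := fX.
have Pfin : P setT \is a fin_num := fin_num_measure P _ measurableT.
have L1 Z : Z \in Lfun P 2%:E -> Z \in Lfun P 1 by exact: Lfun_subset12.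
elim: l => [_|p l IH /= /andP[p0 l0]].
  by rewrite evX_nil expectation_cst.
rewrite evX_cons expectationD ?L1 ?scaled_Lfun2 ?fbm_Lfun2 ?ev_Lfun2//.
rewrite expectationZl ?L1 ?fbm_Lfun2//.
by rewrite IH// EX// mule0 adde0.
Qed.

Lemma fbm_mgf l : nonneg_times l ->
  has_gaussian_mgf P (fun w => ev (X ^~ w) l) 0 (bil k l l).
Proof.
move=> l0; set Y := fun w => _.
have mY : measurable_fun setT Y by exact: measurable_ev.
have [m [v mgf]] := gaussian_has_mgf mY (gaussian_ev l0).
have EY : (\int[P]_w Y w)%R = 0.
  by have := expectation_ev l0; rewrite unlock /Rintegral => ->.
have m0 := gaussian_mean mY mgf EY.
have vE := gaussian_variance mY mgf m0.
suff <- : v = bil k l l by rewrite m0 in mgf.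
rewrite vE /Rintegral; have := covariance_ev l0 l0.
rewrite unlock expectation_ev//= => E.
have -> : (\int[P]_w (Y w ^+ 2)%:E)%E = (bil k l l)%:E; last by [].
rewrite -E unlock; apply: eq_integral => w _.
by rewrite -[RHS]/(((Y w - 0) * (Y w - 0))%:E) !subr0 expr2.
Qed.

(** Positivity is read off the process: the form at [l] is the second moment of the corresponding
    combination. *)
Lemma fbm_psd : psd k.
Proof.
move=> l l0; set Y := fun w => ev (X ^~ w) l.
have mY : measurable_fun setT Y by exact: measurable_ev.
rewrite (gaussian_variance mY (fbm_mgf l0) erefl).
by apply: Rintegral_ge0 => w _; exact: sqr_ge0.
Qed.

End fbm_mgf.

(** * Chaining *)

Section dense_points.
Variable R : realType.
Implicit Types (f : R -> R) (s t r : R).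

Lemma within_itv_near f t e : {within `[0, 1], continuous f} ->
  0 <= t <= 1 -> 0 < e -> exists2 delta, 0 < delta &
    forall s, 0 <= s <= 1 -> `|s - t| < delta -> `|f s - f t| < e.
Proof.
move=> /subspace_continuousP cf t01 e0.
have /cvgrPdist_lt/(_ _ e0) := cf t ltac:(by rewrite /= in_itv).
rewrite near_withinE => /nbhs_ballP[d /= d0 Hd]; exists d => // s s01 st.
rewrite distrC; apply: Hd; last by rewrite /= in_itv.
by rewrite /ball /= distrC.
Qed.

Definition dense01 (S : set R) :=
  forall t delta, 0 <= t <= 1 -> 0 < delta ->
    exists s, [/\ S s, 0 <= s <= 1 & `|s - t| < delta].

Lemma dense01_le S f r : dense01 S -> {within `[0, 1], continuous f} ->
  (forall s, S s -> 0 <= s <= 1 -> `|f s| <= r) ->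
  forall t, 0 <= t <= 1 -> `|f t| <= r.
Proof.
move=> dS cf fr t t01; rewrite leNgt; apply/negP => rt.
have [d d0 Hd] := within_itv_near cf t01 (ltac:(by rewrite subr_gt0) : 0 < `|f
  t| - r).
have [s [Ss s01 st]] := dS t d t01 d0.
have := Hd s s01 st; have := fr s Ss s01.
by have := lerB_dist (f t) (f s); rewrite (distrC (f t)); lra.
Qed.

Lemma pow2_inv_lt (delta : R) : 0 < delta -> exists l, 2 ^- l < delta.
Proof.
move=> d0; exists (Num.truncn delta^-1).+1.
rewrite invf_plt ?posrE ?exprn_gt0//.
rewrite (lt_le_trans (truncnS_gt _))// -natrX ler_nat.
exact/ltnW/ltn_expl.
Qed.

Lemma dense01_dyadic :
  dense01 [set s | exists l i, (i <= 2 ^ l)%N /\ s = i%:R * 2 ^- l].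
Proof.
move=> t delta /andP[t0 t1] /pow2_inv_lt[l ld].
have l0 : 0 < 2 ^+ l :> R by exact: exprn_gt0.
have := truncn_itv (mulr_ge0 t0 (ltW l0)).
set i := Num.truncn _ => /andP[i1 i2].
have it : i%:R * 2 ^- l <= t by rewrite ler_pdivrMr.
have ti : t < (i%:R + 1) * 2 ^- l by rewrite ltr_pdivlMr// natr1.
exists (i%:R * 2 ^- l); split.
- exists l, i; split=> //; rewrite -(ler_nat R) (le_trans i1)// natrX.
  by rewrite ler_piMl// ltW.
- by rewrite (le_trans it)// andbT mulr_ge0// invr_ge0 ltW.
- by rewrite ler0_norm ?subr_le0// opprB; move: ti; rewrite mulrDl mul1r; lra.
Qed.

Lemma dyadic_chain f (rho : nat -> R) r : {within `[0, 1], continuous f} ->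
  f 0 = 0 ->
  (forall l i, (i < 2 ^ l)%N ->
    `|f (i.+1%:R * 2 ^- l) - f (i%:R * 2 ^- l)| <= rho l) ->
  (forall n, \sum_(l < n) rho l <= r) ->
  forall t, 0 <= t <= 1 -> `|f t| <= r.
Proof.
move=> cf f0 frho rhor; apply: (dense01_le dense01_dyadic cf).
suff H l i : (i <= 2 ^ l)%N -> `|f (i%:R * 2 ^- l)| <= \sum_(j < l.+1) rho j.
  by move=> s [l [i [il ->]]] _; rewrite (le_trans (H l i il)).
have rho0 j : 0 <= rho j.
  by rewrite (le_trans _ (frho j 0%N _))// expn_gt0.
elim: l i => [|l IH] i il.
  have h0 : 0 <= rho 0%N by [].
  rewrite big_ord1 expr0 invr1 mulr1; case: i il => [|[|//]] _.
    by rewrite f0 normr0.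
  by have := frho 0%N 0%N isT; rewrite expr0 invr1 !mulr1 f0 subr0.
have half j : (j.*2)%:R * 2 ^- l.+1 = j%:R * 2 ^- l :> R.
  rewrite -muln2 natrM exprS invfM -mulrA; congr (_ * _).
  by rewrite mulrA divff// mul1r.
(* An even numerator belongs to the previous level; an odd one is a single link of level [l.+1] away
   from its left neighbour there. *)
rewrite big_ord_recr /=; have := odd_double_half i.
case: (odd i) => /= ii; last first.
  rewrite -ii add0n half (le_trans (IH _ _)) ?lerDl//.
  by move: il; rewrite expnS; lia.
have il2 : (i./2.*2 < 2 ^ l.+1)%N by rewrite -ii add1n in il.
have := frho l.+1 _ il2; rewrite -[X in f (X%:R * _)]add1n ii half => h.
rewrite -(subrK (f (i./2%:R * 2 ^- l)) (f _)) addrC (le_trans (ler_normD _ _))//.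
rewrite lerD// IH//.
by move: il; rewrite expnS; lia.
Qed.

End dense_points.

(** * Chernoff bounds under a change of measure *)

Section density_measure.
Context d (T : measurableType d) (R : realType) (P : {measure set T -> \bar R}).
Variable D : T -> \bar R.
Hypotheses (mD : measurable_fun setT D) (D0 : forall w, (0 <= D w)%E).

(** The two proofs are arguments so that the measure structure can be attached to the definition.
    Density 1 gives back [P]; the exponential density gives the recentered law. *)
Definition density_measure of measurable_fun setT D & (forall w, (0 <= D w)%E) :=
  fun A => (\int[P]_(w in A) D w)%E.

Local Notation Q := (density_measure mD D0).

Let Q0 : Q set0 = 0%E. Proof. exact: integral_set0. Qed.
Let Q_ge0 A : (0 <= Q A)%E. Proof. by apply: integral_ge0 => w _. Qed.
Let Q_additive : semi_sigma_additive Q.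
Proof. exact: semi_sigma_additive_nng_induced. Qed.

HB.instance Definition _ := isMeasure.Build _ _ _ Q Q0 Q_ge0 Q_additive.

Lemma chernoff_density (Z : T -> R) (V u : R) : measurable_fun setT Z ->
  0 < V -> 0 <= u ->
  (forall a, (\int[P]_w ((expR (a * Z w))%:E * D w) <=
              (expR (a ^+ 2 * V / 2))%:E)%E) ->
  (Q [set w | (u <= Z w)%R] <= (expR (- (u ^+ 2 / (2 * V))))%:E)%E.
Proof.
(* The minimizer of [a ^+ 2 * V / 2 - a * u]. *)
move=> mZ V0 u0 HZ; pose a := u / V.
have a0 : 0 <= a by rewrite divr_ge0// ltW.
have mA : measurable [set w | u <= Z w].
  rewrite (_ : [set w | _] = Z @^-1` `[u, +oo[); last first.
    by apply/seteqP; split => w /=; rewrite in_itv/= andbT.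
  by rewrite -[X in measurable X]setTI; exact: mZ.
have mexp (b : R) : measurable_fun setT (fun w => (expR (b + a * Z w))%:E).
  apply/measurable_EFinP; apply: measurableT_comp => //.
  by apply: measurable_funD => //; exact: measurable_funM.
apply: (@le_trans _ _ (\int[P]_w ((expR (- (a * u) + a * Z w))%:E * D w))%E).
  rewrite /density_measure integral_mkcond; apply: ge0_le_integral => //.
  - by move=> w _; rewrite patchE; case: ifP.
  - by apply/(measurable_restrictT D mA); exact: measurable_funTS.
  - exact: emeasurable_funM.
  - move=> w _; rewrite patchE; case: ifPn => [|_]; last first.
      by rewrite mule_ge0// lee_fin expR_ge0.
    rewrite inE /= => uZ; rewrite -[leLHS]mul1e lee_wpmul2r// lee_fin.
    rewrite -expR0 ler_expR addrC -mulrBr mulr_ge0//; lra.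
under eq_integral do rewrite expRD EFinM -muleA.
rewrite ge0_integralZl//; last 2 first.
- apply: emeasurable_funM => //.
  by have := mexp 0; under eq_fun do rewrite add0r.
- by move=> w _; rewrite mule_ge0// lee_fin expR_ge0.
apply: (le_trans (lee_wpmul2l _ (HZ a))); first by rewrite lee_fin expR_ge0.
rewrite -EFinM -expRD lee_fin ler_expR le_eqVlt; apply/orP; left; apply/eqP.
by rewrite /a; field; rewrite gt_eqF.
Qed.

Lemma chernoff_density_abs (Z : T -> R) (V u : R) : measurable_fun setT Z ->
  0 < V -> 0 <= u ->
  (forall a, (\int[P]_w ((expR (a * Z w))%:E * D w) <=
              (expR (a ^+ 2 * V / 2))%:E)%E) ->
  (Q [set w | (u <= `|Z w|)%R] <= (2 * expR (- (u ^+ 2 / (2 * V))))%:E)%E.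
Proof.
move=> mZ V0 u0 HZ.
have mN : measurable_fun setT (fun w => - Z w) by exact: measurableT_comp.
have mA (Z' : T -> R) : measurable_fun setT Z' -> measurable [set w | u <= Z' w].
  move=> mZ'; rewrite (_ : [set w | _] = Z' @^-1` `[u, +oo[); last first.
    by apply/seteqP; split => w /=; rewrite in_itv/= andbT.
  by rewrite -[X in measurable X]setTI; exact: mZ'.
rewrite (_ : [set w | _] = [set w | u <= Z w] `|` [set w | u <= - Z w]); last first.
  by apply/seteqP; split => w /=; rewrite ler_normr => /orP.
apply: (@le_trans _ _ (Q [set w | (u <= Z w)%R] + Q [set w | (u <= - Z w)%R])%E).
  by apply: measureU2; exact: mA.
rewrite mulrC mulr_natr mulr2n EFinD; apply: leeD; first exact: chernoff_density.
apply: chernoff_density => // a.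
have := HZ (- a); rewrite sqrrN; apply: le_trans.
by rewrite le_eqVlt; apply/orP; left; apply/eqP/eq_integral => w _;
  rewrite mulrN mulNr.
Qed.

End density_measure.

Section sup_events.
Context d (T : measurableType d) (R : realType).
Variable Y : R -> T -> R.
Hypothesis mY : forall t, 0 <= t <= 1 -> measurable_fun setT (Y t).
Hypothesis cY : forall w, {within `[0, 1], continuous (Y ^~ w)}.

Definition exceeds (r : R) := [set w | exists2 t, 0 <= t <= 1 & r < `|Y t w|].

Lemma measurable_norm_ge (Z : T -> R) u : measurable_fun setT Z ->
  measurable [set w | u <= `|Z w|].
Proof.
move=> mZ; rewrite (_ : [set w | _] = (fun w => `|Z w|) @^-1` `[u, +oo[).
  rewrite -[X in measurable X]setTI.
  exact: (measurableT_comp (@normr_measurable R setT) mZ).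
by apply/seteqP; split => w /=; rewrite in_itv/= andbT.
Qed.

Lemma measurable_exceeds r : measurable (exceeds r).
Proof.
pose S : set R := [set s | exists l i, (i <= 2 ^ l)%N /\ s = i%:R * 2 ^- l].
pose t_ (li : nat * nat) : R := li.2%:R * 2 ^- li.1.
pose B li := if (li.2 <= 2 ^ li.1)%N then [set w | r < `|Y (t_ li) w|] else set0.
have t01 (li : nat * nat) : (li.2 <= 2 ^ li.1)%N -> 0 <= t_ li <= 1.
  move=> h; rewrite mulr_ge0 ?invr_ge0 ?exprn_ge0//=.
  by rewrite ler_pdivrMr ?exprn_gt0// mul1r -natrX ler_nat.
rewrite (_ : exceeds r = \bigcup_li B li).
  apply: countable_bigcupT_measurable; first exact: countableP.
  move=> li; rewrite /B; case: ifPn => // h.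
  rewrite (_ : [set w | _] = (fun w => `|Y (t_ li) w|) @^-1` `]r, +oo[).
    rewrite -[X in measurable X]setTI.
    exact: (measurableT_comp (@normr_measurable R setT) (mY (t01 _ h))).
  by apply/seteqP; split => w /=; rewrite in_itv/= andbT.
apply/seteqP; split => w.
  move=> [t tI rt]; apply: contrapT => nB.
  suff : `|Y t w| <= r by rewrite leNgt rt.
  apply: (@dense01_le _ _ (Y ^~ w) r (@dense01_dyadic R) (@cY w) _ t tI).
  move=> s [l [i [il ->]]] _.
  rewrite leNgt; apply/negP => ri; apply: nB.
  by exists (l, i) => //; rewrite /B /= il.
move=> [li _]; rewrite /B; case: ifPn => // h rl.
by exists (t_ li) => //; exact: t01.
Qed.

End sup_events.

Section chaining.
Context d (T : measurableType d) (R : realType) (Q : {measure set T -> \bar R}).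
Variables (Y : R -> T -> R) (p : R).
Hypothesis mY : forall t, 0 <= t <= 1 -> measurable_fun setT (Y t).
Hypothesis cY : forall w, {within `[0, 1], continuous (Y ^~ w)}.
Hypothesis Y0 : forall w, Y 0 w = 0.
Hypothesis p0 : 0 < p.

(** With x this base, links of level l get tolerance r (1 - 1/x) x^(-l), of total at most r, and
    have variance v 2^(-l p) = v x^(-4 l). Their Gaussian exponent is therefore A x^(2 l) with A =
    [chaining_const * r ^+ 2 / v]. The threshold is A (x^2 - 1) >= 2, which by Bernoulli gives A
    x^(2 l) >= A + 2 l. *)
Definition chaining_base : R := 2 `^ (p / 4).
Definition chaining_const : R := (1 - chaining_base^-1) ^+ 2 / 2.
Definition chaining_threshold : R := 2 / (chaining_base ^+ 2 - 1).

Local Notation x := chaining_base.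

Lemma chaining_base_gt1 : 1 < x.
Proof.
have p4 : 0 < p / 4 by rewrite divr_gt0.
have := gt0_ltr_powR p4 (_ : 1 \in Num.nneg) (_ : 2 \in Num.nneg).
by rewrite powR1; apply; rewrite ?nnegrE// ltr1n.
Qed.

Let x0 : 0 < x. Proof. exact: lt_trans ltr01 chaining_base_gt1. Qed.
Let x1 := chaining_base_gt1.

Lemma chaining_const_gt0 : 0 < chaining_const.
Proof. by rewrite divr_gt0// exprn_gt0// subr_gt0 invf_lt1. Qed.

Lemma chaining_threshold_gt0 : 0 < chaining_threshold.
Proof. by rewrite divr_gt0// subr_gt0 exprn_egt1. Qed.

Lemma dyadic_powR l : (2 ^- l) `^ p = x ^- (4 * l).
Proof.
have -> : 2 ^- l = 2 `^ (- l%:R) :> R by rewrite powR_invn.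
by rewrite /x -powRrM -powR_invn ?powR_ge0// -powRrM; congr (_ `^ _);
  rewrite natrM; field.
Qed.

Lemma bernoulli_ineq (y : R) l : 1 <= y -> 1 + l%:R * (y - 1) <= y ^+ l.
Proof.
move=> y1; elim: l => [|l IH]; first by rewrite mul0r addr0 expr0.
rewrite exprS -natr1.
apply: (@le_trans _ _ (y * (1 + l%:R * (y - 1)))); last first.
  by rewrite ler_wpM2l// (le_trans ler01).
have : 0 <= l%:R * (y - 1) ^+ 2 by rewrite mulr_ge0// sqr_ge0.
by rewrite expr2; lra.
Qed.

Theorem chaining (v r : R) : 0 < v -> 0 < r ->
  chaining_threshold <= chaining_const * r ^+ 2 / v ->
  (forall s t u, 0 <= s <= 1 -> 0 <= t <= 1 -> s != t -> 0 <= u ->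
    (Q [set w | (u <= `|Y t w - Y s w|)%R] <=
     (2 * expR (- (u ^+ 2 / (2 * (v * `|t - s| `^ p)))))%:E)%E) ->
  (Q (exceeds Y r) <= (4 * expR (- (chaining_const * r ^+ 2 / v)))%:E)%E.
Proof.
move=> v0 r0; set A := chaining_const * r ^+ 2 / v => A_ge tail.
pose rho l := r * (1 - x^-1) * x ^- l.
have xi0 : 0 < 1 - x^-1 by rewrite subr_gt0 invf_lt1.
have rho0 l : 0 <= rho l by rewrite !mulr_ge0 ?invr_ge0 ?exprn_ge0 ?ltW.
have sum_rho n : \sum_(l < n) rho l <= r.
  rewrite /rho -mulr_sumr -[leRHS]mulr1 -mulrA ler_wpM2l ?(ltW r0)//.
  have -> : \sum_(l < n) x ^- l = \sum_(l < n) x^-1 ^+ l.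
    by apply: eq_bigr => l _; rewrite exprVn.
  have := subrX1 x^-1 n; have : 0 <= x^-1 ^+ n by rewrite exprn_ge0 ?invr_ge0
    ?(ltW x0).
  by move=> h1 h2; lra.
pose t_ l i : R := i%:R * 2 ^- l.
have t01 l i : (i <= 2 ^ l)%N -> 0 <= t_ l i <= 1.
  move=> h; rewrite mulr_ge0 ?invr_ge0 ?exprn_ge0//=.
  by rewrite ler_pdivrMr ?exprn_gt0// mul1r -natrX ler_nat.
pose G l i := [set w | rho l <= `|Y (t_ l i.+1) w - Y (t_ l i) w|].
pose F l := \big[setU/set0]_(i < 2 ^ l) G l i.
have mG l i : (i < 2 ^ l)%N -> measurable (G l i).
  move=> il; apply: measurable_norm_ge.
  by apply: measurable_funB; apply: mY; apply: t01 => //; exact: ltnW.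
have mF l : measurable (F l).
  by apply: bigsetU_measurable => i _; exact: mG.
(* If every link at every level is within its tolerance, the tolerances add up to a bound on the
   whole path. *)
have sub : exceeds Y r `<=` \bigcup_l F l.
  move=> w [t tI rt]; apply: contrapT => nF.
  suff : `|Y t w| <= r by rewrite leNgt rt.
  apply: (@dyadic_chain _ (Y ^~ w) rho r (@cY w) (Y0 w) _ sum_rho t tI) => l i il.
  rewrite leNgt; apply/negP => ri; apply: nF; exists l => //.
  by rewrite /F -bigcup_mkord; exists i => //; rewrite /G /= ltW.
(* Each level multiplies the number of links by 2 and the probability of one link by at most 1/4,
   which leaves a geometric series of ratio 1/2. *)
have e2 : expR (- 2) <= 4^-1 :> R.
  rewrite expRN lef_pV2 ?posrE ?expR_gt0//.
  have := expR_ge1Dx (1 : R); have -> : 2 = 2%:R * 1 :> R by rewrite mulr1.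
  by rewrite expRM_natl; nra.
have FQ l : (Q (F l) <= ((4 * expR (- A)) / (2 ^ (l + 1))%:R)%:E)%E.
  apply: (@le_trans _ _ (\sum_(i < 2 ^ l) Q (G l i))%E).
    by apply: Boole_inequality => i il; exact: mG.
  apply: (@le_trans _ _ (\sum_(i < 2 ^ l) (2 * expR (- (A * x ^+ (2 * l))))%:E)%E).
    apply: lee_sum => i _.
    have il := ltn_ord i.
    have ne : t_ l i != t_ l i.+1.
      rewrite /t_ -subr_eq0 -mulrBl mulf_neq0 ?invr_eq0 ?expf_neq0//.
      by rewrite -natr1 opprD addrA subrr sub0r oppr_eq0 oner_eq0.
    have := tail _ _ (rho l) (t01 _ _ (ltnW il)) (t01 _ _ il) ne (rho0 l).
    move=> /le_trans; apply; rewrite lee_fin ler_wpM2l// ler_expR lerN2.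
    have -> : `|t_ l i.+1 - t_ l i| = 2 ^- l.
      by rewrite /t_ -mulrBl -natr1 addrAC subrr add0r mul1r ger0_norm.
    rewrite dyadic_powR /rho /A /chaining_const le_eqVlt; apply/orP; left.
    apply/eqP; rewrite [(4 * l)%N](_ : _ = (2 * l + 2 * l)%N); last by lia.
    rewrite exprD [(2 * l)%N]mul2n -addnn exprD.
    have xl : x ^+ l != 0 by rewrite expf_neq0// gt_eqF.
    by field; rewrite xl !gt_eqF.
  rewrite sumEFin lee_fin sumr_const card_ord.
  have b : 1 + l%:R * (x ^+ 2 - 1) <= x ^+ (2 * l).
    by rewrite exprM bernoulli_ineq// exprn_ege1// ltW.
  have A0 : 0 <= A by rewrite (le_trans (ltW chaining_threshold_gt0)).
  have A2 : 2 <= A * (x ^+ 2 - 1).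
    by rewrite -ler_pdivrMr// subr_gt0 exprn_egt1.
  have h : expR (- (A * x ^+ (2 * l))) <= expR (- A) * 4^-1 ^+ l.
    apply: (@le_trans _ _ (expR (- A) * expR (- 2) ^+ l)).
      rewrite -expRM_natl -expRD ler_expR.
      have : A * (1 + l%:R * (x ^+ 2 - 1)) <= A * x ^+ (2 * l) by rewrite ler_wpM2l.
      have : l%:R * 2 <= l%:R * (A * (x ^+ 2 - 1)) by rewrite ler_wpM2l.
      by lra.
    by rewrite ler_wpM2l ?expR_ge0// lerXn2r// nnegrE// expR_ge0.
  rewrite addn1 expnS -[leLHS]mulr_natr natrX.
  have -> : 4 * expR (- A) / (2 * 2 ^ l)%N%:R =
      2 * (expR (- A) * 4^-1 ^+ l) * 2 ^+ l.
    rewrite natrM natrX exprVn (_ : 4 = 2 * 2 :> R) ?exprMn; last by ring.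
    by field; rewrite expf_neq0.
  by rewrite ler_wpM2r ?exprn_ge0// ler_wpM2l.
apply: (@le_trans _ _ (Q (\bigcup_l F l))).
  by apply: le_measure => //; rewrite inE;
    [exact: measurable_exceeds|exact: bigcupT_measurable].
apply: (le_trans (generalized_Boole_inequality Q mF (bigcupT_measurable _ mF))).
have /cvg_lim := @cvg_geometric_eseries_half R (4 * expR (- A)) 0%N.
rewrite expr0 divr1 => <-//.
by apply: lee_nneseries => // l _; rewrite measure_ge0.
Qed.

End chaining.

(** * Exponential estimates for fractional Brownian motion *)

Section fbm_paths.
Variables (R : realType) (H : R).
Hypothesis H01 : 0 < H < 1.
Local Notation k := (fbm_cov H).

Definition times01 (l : seq (R * R)) := all (fun p => 0 <= p.2 <= 1) l.

Lemma times01_nonneg l : times01 l -> nonneg_times l.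
Proof. by apply: sub_all => p /andP[]. Qed.

Lemma times01_cat l l' : times01 (l ++ l') = times01 l && times01 l'.
Proof. exact: all_cat. Qed.

Lemma times01_scal a l : times01 (scal a l) = times01 l.
Proof. by rewrite /times01 all_map. Qed.

Lemma fbm_cov_within_continuous s : {within `[0, 1], continuous (k ^~ s)}.
Proof.
have H2 : 0 < 2 * H by case/andP: H01 => H0 _; rewrite mulr_gt0.
(* The absolute value gives a function continuous on the whole line, at 0 in particular, and equal
   to the kernel section on [0, 1]. *)
pose g t : R := (`|t| `^ (2 * H) + s `^ (2 * H) - `|t - s| `^ (2 * H)) / 2.
apply: (@subspace_eq_continuous _ _ _ g).
  by move=> t /set_mem /=; rewrite in_itv /= => /andP[t0 _];
    rewrite /from_subspace /g /fbm_cov ger0_norm.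
apply: continuous_subspaceT => t; rewrite -/({for t, continuous g}) /g.
apply: continuousM; last exact: cst_continuous.
apply: (@continuousB _ R^o) => /=.
  apply: (@continuousD _ R^o) => /=; last exact: cst_continuous.
  exact: normr_powR_continuous.
apply: (@continuous_comp R R R (fun u => u - s) (fun u => `|u| `^ (2 * H))).
  by apply: (@continuousB _ R^o) => //; exact: cst_continuous.
exact: normr_powR_continuous.
Qed.

Lemma within_continuousD (f g : R -> R) : {within `[0, 1], continuous f} ->
  {within `[0, 1], continuous g} -> {within `[0, 1], continuous (fun t => f t + g t)}.
Proof.
by move=> cf cg t; apply: (@continuousD _ R^o); [exact: cf|exact: cg].
Qed.

Lemma within_continuousZ a (f : R -> R) : {within `[0, 1], continuous f} ->
  {within `[0, 1], continuous (fun t => a * f t)}.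
Proof.
by move=> cf t; apply: continuousM; [exact: cst_continuous|exact: cf].
Qed.

Lemma ev_within_continuous (F : R -> R -> R) l :
  (forall s, {within `[0, 1], continuous (F ^~ s)}) ->
  {within `[0, 1], continuous (fun t => ev (F t) l)}.
Proof.
move=> cF; elim: l => [|p l IH].
  rewrite (_ : (fun t => _) = cst 0); last by apply/funext => t; rewrite ev_nil.
  by move=> t; exact: cst_continuous.
rewrite (_ : (fun t => _) = (fun t => p.1 * F t p.2 + ev (F t) l)).
  by apply: within_continuousD => //; apply: within_continuousZ; exact: cF.
by apply/funext => t; rewrite ev_cons.
Qed.

Lemma bil_cov_within_continuous l :
  {within `[0, 1], continuous (fun t => ev (k t) l)}.
Proof. by apply: ev_within_continuous => s; exact: fbm_cov_within_continuous. Qed.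

Definition norm1 (l : seq (R * R)) : R := \sum_(p <- l) `|p.1|.

Lemma ev_norm_le (f : R -> R) r l : times01 l ->
  (forall t, 0 <= t <= 1 -> `|f t| <= r) -> ev f l <= r * norm1 l.
Proof.
move=> l01 fr; rewrite /norm1; elim: l l01 => [_|p l IH /= /andP[p01 l01]].
  by rewrite ev_nil big_nil mulr0.
rewrite ev_cons big_cons mulrDr lerD ?IH//.
by rewrite (le_trans (ler_norm _))// normrM mulrC ler_wpM2r// fr.
Qed.

End fbm_paths.

Section scaled_fbm.
Context (R : realType) d (Om : measurableType d) (P : probability Om R).
Variables (H : R) (V : R -> Om -> R) (gamma : R) (T : nat -> R).
Hypothesis H01 : 0 < H < 1.
Local Notation k := (fbm_cov H).
Hypothesis kpsd : psd k.
Hypothesis gamma0 : 0 < gamma.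
Hypothesis mV : forall t, 0 <= t <= 1 -> measurable_fun setT (V t).
Hypothesis cV : forall w, {within `[0, 1], continuous (V ^~ w)}.
Hypothesis V0 : forall w, V 0 w = 0.
Hypothesis Vmgf : forall l, times01 l ->
  has_gaussian_mgf P (fun w => ev (V ^~ w) l) 0 (gamma ^+ 2 * bil k l l).
Hypothesis T01 : forall j, (0 < j)%N -> 0 < T j <= 1.

Let T0 j : (0 < j)%N -> 0 <= T j.
Proof. by move=> /T01 /andP[/ltW]. Qed.

Let ksym := fbm_cov_sym H.

Let H20 : 0 < 2 * H.
Proof. by case/andP: H01 => H0 _; rewrite mulr_gt0. Qed.

Lemma measurable_evV l : times01 l -> measurable_fun setT (fun w => ev (V ^~ w) l).
Proof.
elim: l => [_|p l IH /= /andP[p01 l01]].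
  by rewrite (_ : (fun w => _) = cst 0)//; apply/funext => w; rewrite ev_nil.
rewrite (_ : (fun w => _) = (fun w => p.1 * V p.2 w + ev (V ^~ w) l)).
  apply: measurable_funD; last exact: IH.
  by apply: measurable_funM => //; exact: mV.
by apply/funext => w; rewrite ev_cons.
Qed.

Lemma density_cst1 A : measurable A ->
  density_measure P (measurable_cst 1%E) (fun=> lee01) A = P A.
Proof. by move=> mA; rewrite /density_measure integral_cst// mul1e. Qed.

Lemma evV_tail l (b u : R) : times01 l -> 0 < b -> bil k l l <= b -> 0 <= u ->
  (P [set w | (u <= ev (V ^~ w) l)%R] <=
    (expR (- (u ^+ 2 / (2 * (gamma ^+ 2 * b)))))%:E)%E.
Proof.
move=> l01 b0 lb u0.
have mZ := measurable_evV l01.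
have mA : measurable [set w | u <= ev (V ^~ w) l].
  rewrite (_ : [set w | _] = (fun w => ev (V ^~ w) l) @^-1` `[u, +oo[).
    by rewrite -[X in measurable X]setTI; exact: mZ.
  by apply/seteqP; split => w /=; rewrite in_itv/= andbT.
rewrite -density_cst1//; apply: chernoff_density => //.
  by rewrite mulr_gt0// exprn_gt0.
move=> a; under eq_integral do rewrite mule1.
rewrite (Vmgf l01 a) lee_fin ler_expR mulr0 add0r.
by rewrite ler_pM2r// ler_wpM2l ?sqr_ge0// ler_wpM2l ?sqr_ge0.
Qed.

Lemma evV_tail_abs l (b u : R) : times01 l -> 0 < b -> bil k l l <= b -> 0 <= u ->
  (P [set w | (u <= `|ev (V ^~ w) l|)%R] <=
    (2 * expR (- (u ^+ 2 / (2 * (gamma ^+ 2 * b)))))%:E)%E.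
Proof.
move=> l01 b0 lb u0.
have mZ := measurable_evV l01.
rewrite -density_cst1//; last exact: measurable_norm_ge.
apply: chernoff_density_abs => //.
  by rewrite mulr_gt0// exprn_gt0.
move=> a; under eq_integral do rewrite mule1.
rewrite (Vmgf l01 a) lee_fin ler_expR mulr0 add0r.
by rewrite ler_pM2r// ler_wpM2l ?sqr_ge0// ler_wpM2l ?sqr_ge0.
Qed.

Definition residual m t w := ev (V ^~ w) (dl k T m t).

Lemma dl_times01 m t : 0 <= t <= 1 -> times01 (dl k T m t).
Proof.
move=> t01; apply: (@dl_times _ _ _ _ _ (fun t => 0 <= t <= 1)) => // j j0.
by have /andP[/ltW -> ->] := T01 j0.
Qed.

Lemma coord_times01 i : times01 (coord k T i).
Proof.
apply: (@coord_times _ _ _ _ (fun t => 0 <= t <= 1)) => // j j0.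
by have /andP[/ltW -> ->] := T01 j0.
Qed.

Lemma residualE m t w : residual m t w =
  V t w - \sum_(i < m) chol k T i t * ev (V ^~ w) (coord k T i).
Proof. by rewrite /residual (ev_dl ksym kpsd T0). Qed.

Lemma residual_within_continuous m w :
  {within `[0, 1], continuous (residual m ^~ w)}.
Proof.
pose l := flatten [seq scal (- ev (V ^~ w) (coord k T i)) (coord k T i) | i <-
  iota 0 m].
rewrite (_ : _ ^~ w = fun t => V t w + ev (k t) l).
  by apply: within_continuousD; [exact: cV|exact: bil_cov_within_continuous].
apply/funext => t; rewrite residualE; congr (_ + _).
rewrite ev_flatten big_map -sumrN -(big_mkord xpredT
  (fun i => - (chol k T i t * ev (V ^~ w) (coord k T i)))) /index_iota subn0.
by apply: eq_bigr => i _; rewrite ev_scal ev_cov_coord// mulNr mulrC.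
Qed.

Lemma measurable_residual m t : 0 <= t <= 1 -> measurable_fun setT (residual m t).
Proof. by move=> t01; apply: measurable_evV; exact: dl_times01. Qed.

(** An increment of the residual has variance at most [|t - s| ^ (2 H)] and at most [(2 s) ^ 2],
    hence at most the geometric mean [2 s |t - s| ^ H]. Half of the regularity is traded for the
    small factor [s], and chaining runs with exponent [H]. *)
Lemma residual_tail m s r : 0 < s -> 0 < r ->
  (forall t, 0 <= t <= 1 -> cond_cov k T m t t <= s ^+ 2) ->
  chaining_threshold H <=
    chaining_const H * r ^+ 2 / (gamma ^+ 2 * (2 * s)) ->
  (P (exceeds (residual m) r) <=
   (4 * expR (- (chaining_const H * r ^+ 2 / (gamma ^+ 2 * (2 * s)))))%:E)%E.
Proof.
move=> s0 r0 ks A_ge.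
have H0 : 0 < H by case/andP: H01.
apply: chaining => //.
- exact: measurable_residual.
- exact: residual_within_continuous.
- move=> w; rewrite residualE V0 sub0r; apply/eqP; rewrite oppr_eq0; apply/eqP.
  apply: big1 => i _; rewrite -ev_cov_coord// [X in X * _]ev_eq0 ?mul0r// => p pl.
  rewrite /fbm_cov powR0 ?gt_eqF// add0r sub0r normrN.
  rewrite ger0_norm ?subrr ?mul0r//.
  by have /allP/(_ p pl)/andP[] := coord_times01 i.
- by rewrite mulr_gt0// ?exprn_gt0// mulr_gt0.
move=> t1 t2 u t101 t201 t12 u0.
pose L := dl k T m t2 ++ scal (-1) (dl k T m t1).
have L01 : times01 L by rewrite times01_cat times01_scal !dl_times01.
have -> : [set w | u <= `|residual m t2 w - residual m t1 w|] =
    [set w | u <= `|ev (V ^~ w) L|].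
  by apply/seteqP; split => w /=; rewrite /residual /L ev_cat ev_scal mulN1r.
have [t10 t20] : 0 <= t1 /\ 0 <= t2 by case/andP: t101; case/andP: t201.
have bilL : bil k L L = cond_cov k T m t2 t2 + cond_cov k T m t1 t1 -
    2 * cond_cov k T m t2 t1.
  rewrite /L !bil_cat !bil_catr !bil_scal !bil_scalr !bil_dl//.
  by rewrite (cond_cov_sym T ksym m t1 t2); ring.
have d0 : 0 < `|t2 - t1| by rewrite normr_gt0 subr_eq0 eq_sym.
rewrite -mulrA; apply: evV_tail_abs => //.
  by rewrite !mulr_gt0// powR_gt0.
have L0 : 0 <= bil k L L by apply: kpsd; exact: times01_nonneg.
have b1 : bil k L L <= (`|t2 - t1| `^ H) ^+ 2.
  rewrite -powR_mulrn ?powR_ge0// -powRrM (mulrC H) -fbm_incr//.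
  by rewrite bilL cond_cov_incr_le.
have b2 : bil k L L <= (2 * s) ^+ 2.
  have kt1 := ks _ t101; have kt2 := ks _ t201.
  have cs := psd_CauchySchwarz (cond_cov_sym T ksym m)
    (cond_cov_psd ksym kpsd T0 m) t20 t10.
  have kt12 : `|cond_cov k T m t2 t1| <= s ^+ 2.
    rewrite -ler_sqr ?nnegrE ?sqr_ge0// real_normK ?num_real//.
    rewrite (le_trans cs)// expr2 ler_pM//;
      by apply: psd_diag => //; exact: (cond_cov_psd ksym kpsd T0 m).
  by move: kt12; rewrite bilL ler_norml => /andP[h1 h2]; rewrite exprMn; lra.
have X0 : 0 <= `|t2 - t1| `^ H by exact: powR_ge0.
rewrite -ler_sqr ?nnegrE ?mulr_ge0// ?(ltW s0)//.
rewrite exprMn [leLHS]expr2; apply: ler_pM => //.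
Qed.

Definition coord_comb m (u : nat -> R) :=
  flatten [seq scal (u i) (coord k T i) | i <- iota 0 m].

Lemma ev_coord_comb f m u :
  ev f (coord_comb m u) = \sum_(i < m) u i * ev f (coord k T i).
Proof.
rewrite ev_flatten big_map -(big_mkord xpredT (fun i => u i * ev f (coord k T i))).
by rewrite /index_iota subn0; apply: eq_bigr => i _; rewrite ev_scal.
Qed.

Lemma coord_comb_times01 m u : times01 (coord_comb m u).
Proof.
rewrite /coord_comb; elim: (iota 0 m) => //= i s IH.
by rewrite times01_cat times01_scal coord_times01.
Qed.

Lemma ev_cov_coord_comb m u t :
  ev (k t) (coord_comb m u) = partial_path k T u m t.
Proof. by rewrite ev_coord_comb; apply: eq_bigr => i _; rewrite ev_cov_coord. Qed.

Lemma bil_coord_comb m u : bil k (coord_comb m u) (coord_comb m u) =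
  \sum_(i < m | cond_var k T i != 0) u i ^+ 2.
Proof.
transitivity (ev (partial_path k T u m) (coord_comb m u)).
  by apply: eq_ev => p _; rewrite ev_cov_coord_comb.
rewrite ev_coord_comb [RHS]big_mkcond; apply: eq_bigr => i _.
rewrite (ev_partial_path ksym kpsd T0) ltn_ord /=.
by case: ifP => _; rewrite ?mulr0 ?expr2.
Qed.

Lemma bil_coord_comb_le m u : bil k (coord_comb m u) (coord_comb m u) <=
  \sum_(i < m) u i ^+ 2.
Proof.
rewrite bil_coord_comb [leLHS]big_mkcond; apply: ler_sum => i _.
by case: ifP => // _; exact: sqr_ge0.
Qed.

Lemma measure_bigsetU_le (I : Type) (r : seq I) (B : I -> set Om) :
  (forall i, measurable (B i)) ->
  (P (\big[setU/set0]_(i <- r) B i) <= \sum_(i <- r) P (B i))%E.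
Proof.
move=> mB; elim: r => [|i r IH]; first by rewrite !big_nil measure0.
rewrite !big_cons; apply: (@le_trans _ _ (P (B i) + P (\big[setU/set0]_(j <- r)
  B j))%E).
  by apply: measureU2 => //; exact: bigsetU_measurable.
exact: leeD2l.
Qed.

Lemma measurable_coords_ge m a :
  measurable [set w | a <= \sum_(i < m) ev (V ^~ w) (coord k T i) ^+ 2].
Proof.
rewrite (_ : [set w | _] =
  (fun w => \sum_(i < m) ev (V ^~ w) (coord k T i) ^+ 2) @^-1` `[a, +oo[); last first.
  by apply/seteqP; split => w /=; rewrite in_itv/= andbT.
rewrite -[X in measurable X]setTI.
suff : measurable_fun setT (fun w => \sum_(i < m) ev (V ^~ w) (coord k T i) ^+ 2).
  by apply.
apply: measurable_sum => i; apply: measurable_funX.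
by apply: measurable_evV; exact: coord_times01.
Qed.

(* A vector of norm at least [rho] has scalar product at least
   [(1 - m / K) * rho] with one of the finitely many vectors of norm at most 1
   whose coordinates are multiples of [1 / K]. *)
Lemma coords_tail m K rho : (0 < K)%N -> (m <= K)%N -> 0 < rho ->
  (P [set w | (rho ^+ 2 <= \sum_(i < m) ev (V ^~ w) (coord k T i) ^+ 2)%R] <=
   (#|{: {ffun 'I_m -> bool * 'I_K.+1}}|%:R *
     expR (- (((1 - m%:R / K%:R) * rho) ^+ 2 / (2 * gamma ^+ 2))))%:E)%E.
Proof.
move=> K0 mK rho0; set theta := 1 - m%:R / K%:R.
have theta0 : 0 <= theta by rewrite subr_ge0 ler_pdivrMr ?ltr0n// mul1r ler_nat.
(* A grid vector is given by signs and integers up to [K]; it is extended by 0 to all indices to fit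
   [coord_comb]. *)
pose ug (g : {ffun 'I_m -> bool * 'I_K.+1}) (i : nat) : R :=
  if insub i is Some i' then (-1) ^+ (g i').1 * ((g i').2%:R / K%:R) else 0.
pose B g := if \sum_(i < m) ug g i ^+ 2 <= 1 then
  [set w | theta * rho <= ev (V ^~ w) (coord_comb m (ug g))] else set0.
have mB g : measurable (B g).
  rewrite /B; case: ifP => // _.
  rewrite (_ : [set w | _] =
      (fun w => ev (V ^~ w) (coord_comb m (ug g))) @^-1` `[theta * rho, +oo[).
    rewrite -[X in measurable X]setTI.
    by apply: (measurable_evV (coord_comb_times01 _ _)).
  by apply/seteqP; split => w /=; rewrite in_itv/= andbT.
have PB g : (P (B g) <= (expR (- ((theta * rho) ^+ 2 / (2 * gamma ^+ 2))))%:E)%E.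
  rewrite /B; case: ifPn => [u1|_]; last by rewrite measure0 lee_fin expR_ge0.
  have -> : 2 * gamma ^+ 2 = 2 * (gamma ^+ 2 * 1) by rewrite mulr1.
  apply: evV_tail => //; first exact: coord_comb_times01.
    exact: le_trans (bil_coord_comb_le _ _) u1.
  by rewrite mulr_ge0// ltW.
apply: (@le_trans _ _ (P (\big[setU/set0]_g B g))).
  apply: le_measure; rewrite ?inE.
  - exact: measurable_coords_ge.
  - by apply: bigsetU_measurable => g _; exact: mB.
  move=> w /= rw; pose c i := ev (V ^~ w) (coord k T i).
  pose s := \sum_(i < m) c i ^+ 2; pose q := Num.sqrt s.
  have s0 : 0 < s by rewrite (lt_le_trans _ rw)// exprn_gt0.
  have q0 : 0 < q by rewrite sqrtr_gt0.
  have q2 : q ^+ 2 = s by rewrite sqr_sqrtr// ltW.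
  have rq : rho <= q by rewrite -ler_sqr ?nnegrE ?(ltW rho0) ?(ltW q0)// q2.
  have cq (i : 'I_m) : `|c i| <= q.
    rewrite -ler_sqr ?nnegrE// ?(ltW q0)// real_normK ?num_real// q2.
    by rewrite /s (bigD1 i)//= lerDl sumr_ge0// => j _; exact: sqr_ge0.
  have K0' : 0 < K%:R :> R by rewrite ltr0n.
  (* The normalized vector is rounded towards 0, which keeps its norm at most 1 and costs at most
     [q / K] per coordinate in the scalar product. *)
  pose j (i : 'I_m) := Num.truncn (K%:R * `|c i| / q).
  have jitv (i : 'I_m) : (j i)%:R <= K%:R * `|c i| / q < (j i).+1%:R.
    by apply: truncn_itv; rewrite divr_ge0// ?mulr_ge0// ltW.
  have jK (i : 'I_m) : (j i < K.+1)%N.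
    rewrite ltnS -(ler_nat R); have /andP[+ _] := jitv i.
    by move=> /le_trans; apply; rewrite ler_pdivrMr// ler_wpM2l.
  pose g : {ffun 'I_m -> bool * 'I_K.+1} := [ffun i : 'I_m => (c i < 0, Ordinal
    (jK i))].
  have ugE (i : 'I_m) : ug g i = (-1) ^+ (c i < 0)%R * ((j i)%:R / K%:R).
    by rewrite /ug valK ffunE.
  have ju (i : 'I_m) : `|c i| / q - K%:R^-1 <= (j i)%:R / K%:R <= `|c i| / q.
    have /andP[h1 h2] := jitv i.
    have e : K%:R * `|c i| / q = `|c i| / q * K%:R by ring.
    rewrite e in h1 h2; rewrite ler_pdivrMr// h1 andbT.
    by rewrite ler_pdivlMr// mulrBl mulVf ?gt_eqF// lerBlDr natr1 ltW.
  rewrite (bigD1 g)//=; left.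
  rewrite /B ifT /=.
    rewrite ev_coord_comb; apply: (@le_trans _ _ (theta * q)).
      by rewrite ler_wpM2l.
    apply: (@le_trans _ _ (\sum_(i < m) (c i ^+ 2 / q - q / K%:R))).
      rewrite sumrB -mulr_suml -/s -q2 sumr_const card_ord.
      rewrite expr2 mulfK ?gt_eqF// -[_ *+ m]mulr_natl /theta le_eqVlt;
        apply/orP; left.
      by apply/eqP; ring.
    apply: ler_sum => i _; rewrite -/(c i).
    have -> : ug g i * c i = (j i)%:R / K%:R * `|c i|.
      have -> : `|c i| = (-1) ^+ (c i < 0)%R * c i.
        case: (ltP (c i) 0) => c0 /=.
          by rewrite expr1 mulN1r ltr0_norm.
        by rewrite expr0 mul1r ger0_norm.
      by rewrite ugE mulrAC mulrC.
    have /andP[h1 _] := ju i.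
    apply: (@le_trans _ _ ((`|c i| / q - K%:R^-1) * `|c i|)); last first.
      by rewrite ler_wpM2r.
    have -> : c i ^+ 2 = `|c i| ^+ 2 by rewrite real_normK ?num_real.
    have -> : (`|c i| / q - K%:R^-1) * `|c i| = `|c i| ^+ 2 / q - `|c i| / K%:R.
      by move: `|c i| K%:R => y z; ring.
    by rewrite lerD2l lerN2 ler_wpM2r// invr_ge0 ltW.
  have <- : \sum_(i < m) (`|c i| / q) ^+ 2 = 1.
    under eq_bigr do rewrite expr_div_n real_normK ?num_real//.
    by rewrite -mulr_suml -/s q2 divff// gt_eqF.
  apply: ler_sum => i _; rewrite ugE exprMn sqrr_sign mul1r.
  have /andP[_ h] := ju i.
  by rewrite ler_sqr ?nnegrE// ?divr_ge0// ltW.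
apply: (@le_trans _ _ (\sum_g P (B g))%E); first exact: measure_bigsetU_le.
apply: (@le_trans _ _ (\sum_(g : {ffun 'I_m -> bool * 'I_K.+1})
  (expR (- ((theta * rho) ^+ 2 / (2 * gamma ^+ 2))))%:E)%E).
  by apply: lee_sum => g _; exact: PB.
by rewrite sumEFin sumr_const lee_fin -[leLHS]mulr_natl.
Qed.

(** Under [D] the path is centered at [ev (k t) l], so the tube around it has mass at least 1/2. On
    the tube [D] is bounded above, and dividing by that bound returns to [P]. *)
Lemma tilted_lower_bound l r : times01 l -> 0 < r ->
  chaining_threshold (2 * H) <= chaining_const (2 * H) * r ^+ 2 / gamma ^+ 2 ->
  3 <= chaining_const (2 * H) * r ^+ 2 / gamma ^+ 2 ->
  ((2^-1 * expR (- ((bil k l l / 2 + r * norm1 l) / gamma ^+ 2)))%:E <=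
   P (~` exceeds (fun t w => (V t w - ev (k t) l)%R) r))%E.
Proof.
move=> l01 r0 Ath A3; set Y := fun t w => _ - _; set b := bil k l l.
have g2 : 0 < gamma ^+ 2 by rewrite exprn_gt0.
pose D w := (expR (ev (V ^~ w) l / gamma ^+ 2 - b / (2 * gamma ^+ 2)))%:E.
have mD : measurable_fun setT D.
  apply/measurable_EFinP; apply: measurableT_comp => //.
  apply: measurable_funB => //; apply: measurable_funM => //.
  exact: measurable_evV.
have D0 w : (0 <= D w)%E by rewrite lee_fin expR_ge0.
have mY t : 0 <= t <= 1 -> measurable_fun setT (Y t).
  by move=> t01; apply: measurable_funB => //; exact: mV.
have cY w : {within `[0, 1], continuous (Y ^~ w)}.
  rewrite (_ : Y ^~ w = fun t => V t w + (-1) * ev (k t) l).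
    apply: within_continuousD; first exact: cV.
    by apply: within_continuousZ; exact: bil_cov_within_continuous.
  by apply/funext => t; rewrite mulN1r.
have Y0 w : Y 0 w = 0.
  rewrite /Y V0 sub0r ev_eq0 ?oppr0// => p pl.
  rewrite /fbm_cov powR0 ?gt_eqF// add0r sub0r normrN.
  by rewrite ger0_norm ?subrr ?mul0r//; have /allP/(_ p pl)/andP[] := l01.
(* Under the density [D] the process [Y] has the exponential moments of [V]
   under [P]. *)
have DE (a t s : R) : 0 <= t <= 1 -> 0 <= s <= 1 ->
    (\int[P]_w ((expR (a * (Y t w - Y s w)))%:E * D w) =
     (expR (a ^+ 2 * (gamma ^+ 2 * (k t t + k s s - 2 * k t s)) / 2))%:E)%E.
  move=> t01 s01.
  pose L := scal a [:: (1, t); (-1, s)] ++ scal (gamma ^- 2) l.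
  have L01 : times01 L by rewrite times01_cat !times01_scal /= t01 s01.
  pose z := a * (ev (k t) l - ev (k s) l) + b / (2 * gamma ^+ 2).
  have E w : ((expR (a * (Y t w - Y s w)))%:E * D w)%E =
      ((expR (- z))%:E * (expR (1 * ev (V ^~ w) L))%:E)%E.
    rewrite -!EFinM -!expRD; congr (expR _)%:E.
    by rewrite /L ev_cat !ev_scal !ev_cons ev_nil /= /Y /z; ring.
  under eq_integral do rewrite E.
  rewrite ge0_integralZl//; last first.
    apply/measurable_EFinP; apply: measurableT_comp => //.
    by apply: measurable_funM => //; exact: measurable_evV.
  rewrite (Vmgf L01) -EFinM -expRD; congr (expR _)%:E.
  rewrite /L !bil_cat !bil_catr !bil_scal !bil_scalr -/b.
  rewrite (@bilC _ k l [:: (1, t); (-1, s)] ksym) /bil !ev_cons !ev_nil /=.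
  by rewrite (ksym s t) /z; field; rewrite gt_eqF.
pose Q := density_measure P mD D0.
(* The total mass is the exponential moment at 0 of a null increment. *)
have Q1 : Q setT = 1%E.
  transitivity (\int[P]_w ((expR (0 * (Y 0 w - Y 0 w)))%:E * D w))%E.
    by apply: eq_integral => w _; rewrite mul0r expR0 mul1e.
  by rewrite DE ?lexx ?ler01// expr0n !mul0r expR0.
have mE : measurable (exceeds Y r) by exact: measurable_exceeds.
have QE : (Q (exceeds Y r) <= 2^-1%:E)%E.
  apply: (@le_trans _ _ (4 * expR (- (chaining_const (2 * H) * r ^+ 2 / gamma
    ^+ 2)))%:E).
    apply: chaining => // s t u s01 t01 st u0.
    have ts : 0 < `|t - s| by rewrite normr_gt0 subr_eq0 eq_sym.
    apply: chernoff_density_abs => //.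
    - by apply: measurable_funB; exact: mY.
    - by rewrite mulr_gt0// powR_gt0.
    - move=> a; rewrite DE// fbm_incr//; [by case/andP: t01|by case/andP: s01].
  rewrite lee_fin; apply: (@le_trans _ _ (4 * expR (- 3))).
    by rewrite ler_wpM2l// ler_expR lerN2.
  rewrite expRN -ler_pdivlMl// -invfM lef_pV2 ?posrE ?mulr_gt0 ?expR_gt0//.
  have := expR_ge1Dx (1 : R).
  have -> : 3 = 3%:R * 1 :> R by rewrite mulr1.
  rewrite expRM_natl => h.
  have : 2 ^+ 3 <= expR 1 ^+ 3 :> R.
    by rewrite lerXn2r// ?nnegrE ?expR_ge0//; lra.
  by rewrite !exprS expr0; lra.
have QC : (2^-1%:E <= Q (~` exceeds Y r))%E.
  have : (Q setT <= Q (exceeds Y r) + Q (~` exceeds Y r))%E.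
    by rewrite -(setUv (exceeds Y r)); apply: measureU2 => //; exact: measurableC.
  rewrite Q1 => h.
  have : (1 <= 2^-1%:E + Q (~` exceeds Y r))%E by rewrite (le_trans h)// leeD2r.
  rewrite -leeBlDl// -EFinB; apply: le_trans.
  by rewrite lee_fin; lra.
(* Inside the tube [ev (V ^~ w) l] differs from its center [b] by at most [r * norm1 l] upwards. *)
have bound : (Q (~` exceeds Y r) <=
    (expR ((b / 2 + r * norm1 l) / gamma ^+ 2))%:E * P (~` exceeds Y r))%E.
  rewrite -integral_cst; last exact: measurableC.
  apply: ge0_le_integral => //.
  - exact: measurableC.
  - exact: measurable_funTS.
  - move=> w wE; rewrite lee_fin ler_expR.
    have : ev (Y ^~ w) l <= r * norm1 l.
      apply: ev_norm_le => // t t01; rewrite leNgt; apply/negP => rt.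
      by apply: wE; exists t.
    rewrite /Y evD evN -/(bil k l l) -/b lerBlDr => h.
    have -> : (b / 2 + r * norm1 l) / gamma ^+ 2 =
      (r * norm1 l + b) / gamma ^+ 2 - b / (2 * gamma ^+ 2).
      by field; rewrite gt_eqF.
    by rewrite lerD2r ler_wpM2r// invr_ge0 ltW.
have := le_trans QC bound.
rewrite -lee_pdivrMl ?expR_gt0// => /(le_trans _); apply.
by rewrite -EFinM lee_fin mulrC expRN.
Qed.

End scaled_fbm.

(** * Energy along a dense sequence of times *)

Section dense_times.
Variable R : realType.

(* Every rational number of ]0, 1] occurs among the terms of positive index. *)
Definition dense_times (j : nat) : R :=
  if @unpickle (nat * nat)%type j.-1 is Some pq
  then pq.1.+1%:R / (pq.1 + pq.2).+1%:R else 1.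

Lemma dense_times01 j : 0 < dense_times j <= 1.
Proof.
rewrite /dense_times; case: unpickle => [[p q]/=|]; last by rewrite ltr01 lexx.
rewrite divr_gt0 ?ltr0n//= ler_pdivrMr ?ltr0n// mul1r ler_nat ltnS.
exact: leq_addr.
Qed.

Lemma dense_times_net (delta : R) : 0 < delta -> exists M, forall m, (M <= m)%N ->
  forall t, 0 <= t <= 1 -> exists2 j, (0 < j <= m)%N & `|t - dense_times j| < delta.
Proof.
move=> d0; pose K := (Num.truncn delta^-1).+1.
have K0 : 0 < K%:R :> R by rewrite ltr0n.
have Kd : K%:R^-1 < delta by rewrite invf_plt ?posrE// truncnS_gt.
(* The pair [(i, K.-1 - i)] is decoded as [i.+1 / K]; the successor makes the index positive. *)
pose idx i := (@pickle (nat * nat)%type (i, K.-1 - i)%N).+1.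
have idxE i : (i < K)%N -> dense_times (idx i) = i.+1%:R / K%:R.
  by move=> iK; rewrite /dense_times /idx /= pickleK /= subnKC.
exists (\max_(i < K) idx i) => m Mm t /andP[t0 t1].
have near i : (i < K)%N -> `|t - i.+1%:R / K%:R| <= K%:R^-1 ->
    exists2 j, (0 < j <= m)%N & `|t - dense_times j| < delta.
  move=> iK h; exists (idx i); last by rewrite idxE// (le_lt_trans h).
  apply/andP; split=> //; apply: leq_trans Mm.
  exact: (leq_bigmax (Ordinal iK)).
have [h1 h2] : (Num.truncn (t * K%:R))%:R <= t * K%:R /\
    t * K%:R < (Num.truncn (t * K%:R)).+1%:R.
  by apply/andP/truncn_itv; rewrite mulr_ge0// ltW.
have [iK|Ki] := ltnP (Num.truncn (t * K%:R)) K.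
  apply: (near _ iK).
  rewrite ler0_norm; last by rewrite subr_le0 ler_pdivlMr// ltW.
  rewrite opprB lerBlDr -natr1 mulrDl mul1r addrC lerD2l.
  by rewrite ler_pdivrMr.
(* The truncation reaches [K] only at [t = 1], the last grid point. *)
apply: (near K.-1) => //; rewrite prednK// divff ?gt_eqF//.
have -> : t = 1.
  apply/eqP; rewrite eq_le t1 -(ler_pM2r K0) mul1r (le_trans _ h1)//.
  by rewrite ler_nat.
by rewrite subrr normr0 invr_ge0 ltW.
Qed.

Lemma dense01_dense_times :
  dense01 [set s : R | exists2 j, (0 < j)%N & s = dense_times j].
Proof.
move=> t delta t01 /dense_times_net[M] /(_ M (leqnn M) t t01)[j /andP[j0 _] jd].
exists (dense_times j); split; first by exists j.
  by have /andP[/ltW -> ->] := dense_times01 j.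
by rewrite distrC.
Qed.

End dense_times.

Section energy.
Variables (R : realType) (H : R).
Hypothesis H01 : 0 < H < 1.
Local Notation k := (fbm_cov H).
Hypothesis kpsd : psd k.
Local Notation T := (dense_times R).
Local Notation kc := (cond_cov k T).
Local Notation e_ := (chol k T).
Local Notation C_ := (coord k T).

Let ksym := fbm_cov_sym H.
Let H0 : 0 < H. Proof. by case/andP: H01. Qed.

Lemma dense_times_ge0 j : (0 < j)%N -> 0 <= T j.
Proof. by move=> _; have /andP[/ltW] := dense_times01 R j. Qed.

Lemma dense_times_nondegenerate : nondegenerate k T.
Proof.
by apply: fbm_nondegenerate => // j _; have /andP[] := dense_times01 R j.
Qed.

Local Notation T0 := dense_times_ge0.

(** The conditional variance vanishes at the times already used, one of which is near [t], and
    conditioning does not increase the variance of an increment. *)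
Lemma cond_cov_small (eta : R) : 0 < eta -> exists M, forall m, (M <= m)%N ->
  forall t, 0 <= t <= 1 -> kc m t t <= eta.
Proof.
move=> eta0; have H2 : 0 < 2 * H by rewrite mulr_gt0.
have d0 : 0 < eta `^ (2 * H)^-1 by rewrite powR_gt0.
have [M HM] := dense_times_net d0; exists M => m Mm t t01.
have [j /[dup] jm /andP[j0 _] tj] := HM m Mm t t01.
have t0 : 0 <= t by case/andP: t01.
have := cond_cov_incr_le ksym kpsd T0 m t (T j).
rewrite fbm_incr ?T0// (cond_cov_null ksym kpsd T0 jm t0).
rewrite (cond_cov_null ksym kpsd T0 jm (T0 j0)) addr0 mulr0 subr0.
move=> /le_trans; apply.
have -> : eta = (eta `^ (2 * H)^-1) `^ (2 * H).
  by rewrite -powRrM mulVf ?gt_eqF// powRr1// ltW.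
by rewrite ge0_ler_powR ?nnegrE// ?(ltW H2)// ltW.
Qed.

Lemma cond_cov_small2 (eta : R) : 0 < eta -> exists M, forall m, (M <= m)%N ->
  forall t s, 0 <= t <= 1 -> 0 <= s <= 1 -> `|kc m t s| <= eta.
Proof.
move=> eta0; have [M HM] := cond_cov_small eta0; exists M => m Mm t s t01 s01.
have [t0 s0] : 0 <= t /\ 0 <= s by case/andP: t01; case/andP: s01.
rewrite -ler_sqr ?nnegrE ?(ltW eta0)// real_normK ?num_real//.
rewrite (le_trans (psd_CauchySchwarz (cond_cov_sym T ksym m)
  (cond_cov_psd ksym kpsd T0 m) t0 s0))// expr2 ler_pM ?HM//;
  by apply: psd_diag => //; exact: (cond_cov_psd ksym kpsd T0 m).
Qed.

Definition energy_upto (f : R -> R) m := \sum_(i < m) ev f (C_ i) ^+ 2.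

Lemma energy_upto_mono f m n : (m <= n)%N -> energy_upto f m <= energy_upto f n.
Proof.
move=> mn; rewrite /energy_upto -!(big_mkord xpredT (fun i => ev f (C_ i) ^+ 2)).
rewrite [leRHS](@big_cat_nat _ _ _ m)//= lerDl.
by apply: sumr_ge0 => i _; exact: sqr_ge0.
Qed.

Local Notation proj f := (partial_path k T (fun i => ev f (C_ i))).

Lemma projE f m t : proj f m t = f t - ev f (dl k T m t).
Proof.
rewrite (ev_dl ksym kpsd T0) opprB addrC subrK /partial_path.
by apply: eq_bigr => i _; rewrite mulrC.
Qed.

Lemma proj_interpolates f m j : (0 < j <= m)%N -> proj f m (T j) = f (T j).
Proof.
move=> jm; rewrite projE (ev_dl_null ksym kpsd T0)//.
  by rewrite subr0.
exact: dense_times_nondegenerate.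
Qed.

Lemma proj_incr f B m t s : (forall m, energy_upto f m <= B ^+ 2) -> 0 <= B ->
  0 <= t -> 0 <= s -> `|proj f m t - proj f m s| <= B * `|t - s| `^ H.
Proof.
move=> fB B0 t0 s0.
rewrite -ler_sqr ?nnegrE ?mulr_ge0 ?powR_ge0// real_normK ?num_real//.
rewrite (le_trans (partial_path_incr ksym kpsd T0 _ m t0 s0))// fbm_incr//.
rewrite exprMn -[(_ `^ _) ^+ 2]powR_mulrn ?powR_ge0// -powRrM (mulrC H).
by rewrite ler_wpM2r ?powR_ge0//; exact: fB.
Qed.

Lemma partial_path_within_continuous c m :
  {within `[0, 1], continuous (partial_path k T c m)}.
Proof.
rewrite (_ : partial_path k T c m = fun t => ev (k t) (coord_comb H T m c)).
  exact: bil_cov_within_continuous.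
by apply/funext => t; rewrite ev_cov_coord_comb.
Qed.

(** Hölder continuity of [f] itself is not assumed: the projections share a Hölder bound and
    interpolate [f] at more and more times. Continuity of [f] extends the estimate from the dense
    times. *)
Lemma proj_cvg (f : R -> R) (B : R) : {within `[0, 1], continuous f} -> 0 <= B ->
  (forall m, energy_upto f m <= B ^+ 2) ->
  forall eta, 0 < eta -> exists M, forall m, (M <= m)%N ->
    forall t, 0 <= t <= 1 -> `|f t - proj f m t| <= eta.
Proof.
move=> cf B0 fB eta eta0.
pose c := eta / (2 * (B + 1)).
have B1 : 0 < B + 1 by rewrite ltr_wpDl.
have c0 : 0 < c by rewrite divr_gt0// mulr_gt0.
have d0 : 0 < c `^ H^-1 by rewrite powR_gt0.
have [M HM] := dense_times_net d0; exists M => m Mm.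
apply: (@dense01_le _ _ (fun t => f t - proj f m t) _ (@dense01_dense_times R)).
  rewrite (_ : (fun t => _) = fun t => f t + (-1) * proj f m t).
    apply: within_continuousD => //; apply: within_continuousZ.
    exact: partial_path_within_continuous.
  by apply/funext => t; rewrite mulN1r.
move=> _ [i i0 ->] Ti01.
have [j /[dup] jm /andP[j0 jm'] ij] := HM m Mm (T i) Ti01.
(* A projection fine enough to equal [f] at [T i]; it agrees with the one of order [m] at the nearby
   time [T j]. *)
pose n := maxn i m.
rewrite -(@proj_interpolates f n i) ?i0 ?leq_maxl//.
have hj : proj f n (T j) = proj f m (T j).
  by rewrite !proj_interpolates// j0 (leq_trans jm')// leq_maxr.
have -> : proj f n (T i) - proj f m (T i) =
  (proj f n (T i) - proj f n (T j)) - (proj f m (T i) - proj f m (T j)).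
  by rewrite hj; ring.
rewrite (le_trans (ler_normB _ _))//.
have h1 := proj_incr n fB B0 (T0 i0) (T0 j0).
have h2 := proj_incr m fB B0 (T0 i0) (T0 j0).
have h3 : `|T i - T j| `^ H <= c.
  have -> : c = (c `^ H^-1) `^ H by rewrite -powRrM mulVf ?gt_eqF// powRr1// ltW.
  by rewrite ge0_ler_powR ?nnegrE// ?(ltW H0)// ltW.
have h4 : B * `|T i - T j| `^ H <= (B + 1) * c.
  by apply: ler_pM; rewrite ?powR_ge0// lerDl.
have h5 : (B + 1) * c = eta / 2 by rewrite /c; field; rewrite gt_eqF.
by lra.
Qed.

Lemma energy_hoelder (f : R -> R) (B : R) : {within `[0, 1], continuous f} -> 0
  <= B ->
  (forall m, energy_upto f m <= B ^+ 2) ->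
  forall t s, 0 <= t <= 1 -> 0 <= s <= 1 -> `|f t - f s| <= B * `|t - s| `^ H.
Proof.
move=> cf B0 fB t s t01 s01; apply/ler_addgt0Pr => eta eta0.
have [M /(_ M (leqnn M)) HM] :=
  proj_cvg cf B0 fB (ltac:(by rewrite divr_gt0) : 0 < eta / 2).
have [t0 s0] : 0 <= t /\ 0 <= s by case/andP: t01; case/andP: s01.
have := proj_incr M fB B0 t0 s0.
have := HM t t01; have := HM s s01.
rewrite !ler_norml => /andP[? ?] /andP[? ?] /andP[? ?].
by apply/andP; split; lra.
Qed.

Lemma energy_at0 (f : R -> R) (B : R) : {within `[0, 1], continuous f} -> 0 <= B ->
  (forall m, energy_upto f m <= B ^+ 2) -> f 0 = 0.
Proof.
move=> cf B0 fB; apply/eqP; rewrite -normr_le0; apply/ler_addgt0Pr => eta eta0.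
have [M /(_ M (leqnn M)) HM] := proj_cvg cf B0 fB eta0.
have := HM 0; rewrite lexx ler01 => /(_ isT).
suff -> : proj f M 0 = 0 by rewrite subr0 add0r.
rewrite /partial_path big1// => i _.
rewrite -ev_cov_coord// [X in _ * X]ev_eq0 ?mulr0// => p pl.
have H2 : 2 * H != 0 by rewrite gt_eqF// mulr_gt0.
rewrite /fbm_cov powR0// add0r sub0r normrN ger0_norm ?subrr ?mul0r//.
have T01 j : (0 < j)%N -> 0 < T j <= 1 by move=> _; exact: dense_times01.
by have /allP/(_ p pl)/andP[] := coord_times01 H T01 i.
Qed.

End energy.

(** * Signed measures on the unit interval *)

Section charge_integral_linear.
Variable R : realType.
Local Notation D := (unit_itv R).
Implicit Types (f : R -> R) (nu : {charge set R -> \bar R}).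

Definition bounded_measurable f :=
  measurable_fun D f /\ exists M, forall t, 0 <= t <= 1 -> `|f t| <= M.

Lemma measurable_unit_itv : measurable D.
Proof. exact: measurable_itv. Qed.

Lemma unit_itvP (t : R) : D t <-> 0 <= t <= 1.
Proof. by rewrite /unit_itv /= in_itv. Qed.

Lemma bounded_measurable_integrable (m : {measure set R -> \bar R}) f :
  (m D < +oo)%E -> bounded_measurable f -> m.-integrable D (EFin \o f).
Proof.
move=> mD [mf [M fM]]; apply: measurable_bounded_integrable => //.
  exact: measurable_unit_itv.
exists M; split; first exact: num_real.
by move=> x Mx t /unit_itvP /fM h; exact: (le_trans h (ltW Mx)).
Qed.

Lemma bounded_measurableD f g : bounded_measurable f -> bounded_measurable g ->
  bounded_measurable (fun t => f t + g t).
Proof.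
move=> [mf [M fM]] [mg [N gN]]; split; first exact: measurable_funD.
by exists (M + N) => t t01; rewrite (le_trans (ler_normD _ _))// lerD ?fM ?gN.
Qed.

Lemma bounded_measurableZ a f : bounded_measurable f ->
  bounded_measurable (fun t => a * f t).
Proof.
move=> [mf [M fM]]; split; first exact: measurable_funM.
by exists (`|a| * M) => t t01; rewrite normrM ler_wpM2l ?fM.
Qed.

Lemma bounded_measurable0 : bounded_measurable (fun=> 0).
Proof. by split => //; exists 0 => t _; rewrite normr0. Qed.

Lemma continuous_bounded_measurable f : {within D, continuous f} ->
  bounded_measurable f.
Proof.
move=> cf; split.
  by apply: subspace_continuous_measurable_fun => //; exact: measurable_unit_itv.
have /compact_bounded[M [_ /(_ (M + 1))]] :=
  continuous_compact cf (@segment_compact R 0 1).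
rewrite ltrDl ltr01 => /(_ isT) fM; exists (M + 1) => t t01.
by apply: fM; exists t => //; exact/unit_itvP.
Qed.

Lemma measure_add_setE (m1 m2 : {measure set R -> \bar R}) (A : set R) :
  measure_add m1 m2 A = (m1 A + m2 A)%E.
Proof. exact: measure_addE. Qed.

Lemma Rintegral_measure_add (m1 m2 : {measure set R -> \bar R}) f :
  (m1 D < +oo)%E -> (m2 D < +oo)%E -> bounded_measurable f ->
  \int[measure_add m1 m2]_(x in D) f x =
  \int[m1]_(x in D) f x + \int[m2]_(x in D) f x.
Proof.
move=> m1D m2D bf.
have i1 := bounded_measurable_integrable m1D bf.
have i2 := bounded_measurable_integrable m2D bf.
rewrite /Rintegral integral_measure_add//; last exact: measurable_unit_itv.
by rewrite fineD//; apply: integrable_fin_num => //; exact: measurable_unit_itv.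
Qed.

Lemma Rintegral_mscale_dirac (a : {nonneg R}) (t : R) f : 0 <= t <= 1 ->
  bounded_measurable f ->
  \int[mscale a (@dirac _ R t R)]_(x in D) f x = a%:num * f t.
Proof.
move=> t01 [mf _]; have mD := measurable_unit_itv.
have mfE : measurable_fun D (EFin \o f) by exact/measurable_EFinP.
have dD : (@dirac _ R t R D = 1)%E.
  by rewrite diracE mem_set//; exact/unit_itvP.
rewrite /Rintegral integralE !ge0_integral_mscale//;
  [|exact: measurable_funeneg|exact: measurable_funepos].
rewrite !integral_dirac//; [|exact: measurable_funeneg|exact: measurable_funepos].
rewrite dD !mul1e -muleBr ?fin_num_adde_defr//.
  rewrite [X in (_ * X)%E](_ : _ = (f t)%:E)//.
  exact/esym/(congr1 (@^~ t) (funeposneg (EFin \o f))).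
by rewrite unlock /= -EFin_max.
Qed.

(** [charge_integral] uses a chosen Hahn decomposition, which does not behave well under sums;
    differences of arbitrary finite measures do. *)
Definition represents nu (m1 m2 : {measure set R -> \bar R}) :=
  forall A, measurable A ->
    [/\ m1 A \is a fin_num, m2 A \is a fin_num & nu A = (m1 A - m2 A)%E].

Lemma charge_integral_represents nu m1 m2 f : represents nu m1 m2 ->
  bounded_measurable f ->
  charge_integral nu D f = \int[m1]_(x in D) f x - \int[m2]_(x in D) f x.
Proof.
move=> rep bf; rewrite /charge_integral; case: cid => P hP; case: cid => N hPN.
have mD := measurable_unit_itv.
have finD (m : {measure set R -> \bar R}) : m D \is a fin_num -> (m D < +oo)%E.
  by move=> h; rewrite ltey_eq h.
have [fm1 fm2 _] := rep D mD.
have fp : jordan_pos hPN D \is a fin_num by exact: fin_num_measure.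
have fn : jordan_neg hPN D \is a fin_num by exact: fin_num_measure.
(* Moving the negative parts across turns the claim into an equality of integrals against two equal
   positive measures. *)
suff : \int[jordan_pos hPN]_(x in D) f x + \int[m2]_(x in D) f x =
       \int[m1]_(x in D) f x + \int[jordan_neg hPN]_(x in D) f x by lra.
rewrite -!Rintegral_measure_add ?finD//.
congr fine; apply: eq_measure_integral => A mA _.
have [f1 f2 rA] := rep A mA.
rewrite [LHS](measure_add_setE (jordan_pos hPN) m2 A) [RHS](measure_add_setE m1
  (jordan_neg hPN) A).
have fpA : jordan_pos hPN A \is a fin_num by exact: fin_num_measure.
have fnA : jordan_neg hPN A \is a fin_num by exact: fin_num_measure.
have e : nu A = (jordan_pos hPN A - jordan_neg hPN A)%E.
  by rewrite (jordan_decomp hPN mA) /cadd /= cscaleN1.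
have := congr1 fine (etrans (esym rA) e); rewrite !fineB// => h.
rewrite -[LHS]fineK ?fin_numD ?fpA ?f2// -[RHS]fineK ?fin_numD ?f1 ?fnA//.
by rewrite !fineD//; congr (_%:E); lra.
Qed.

Lemma represents_jordan nu : exists m1 m2, represents nu m1 m2.
Proof.
have [P [N PN]] := Hahn_decomposition nu.
exists (jordan_pos PN), (jordan_neg PN) => A mA; split; try exact: fin_num_measure.
by rewrite (jordan_decomp PN mA) /cadd /= cscaleN1.
Qed.

Section linear.
Variable nu : {charge set R -> \bar R}.
Local Notation L := (charge_integral nu D).

Lemma charge_integral_lin a f g : bounded_measurable f -> bounded_measurable g ->
  L (fun t => a * f t + g t) = a * L f + L g.
Proof.
move=> bf bg; have [m1 [m2 rep]] := represents_jordan nu.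
have bh : bounded_measurable (fun t => a * f t + g t).
  by apply: bounded_measurableD => //; exact: bounded_measurableZ.
rewrite !(charge_integral_represents rep)//.
have mD := measurable_unit_itv; have [f1 f2 _] := rep D mD.
have lin (m : {measure set R -> \bar R}) : m D \is a fin_num ->
    \int[m]_(x in D) (a * f x + g x) =
    a * \int[m]_(x in D) f x + \int[m]_(x in D) g x.
  move=> h; have mDy : (m D < +oo)%E by rewrite ltey_eq h.
  rewrite RintegralD//; last 2 first.
  - by apply: bounded_measurable_integrable => //; exact: bounded_measurableZ.
  - exact: bounded_measurable_integrable.
  by rewrite RintegralZl//; exact: bounded_measurable_integrable.
by rewrite !lin//; ring.
Qed.

Lemma charge_integral0 : L (fun=> 0) = 0.
Proof.
have := charge_integral_lin 0 bounded_measurable0 bounded_measurable0.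
rewrite mul0r add0r => h.
by have := charge_integral_lin 1 bounded_measurable0 bounded_measurable0;
  rewrite mul1r addr0; lra.
Qed.

Lemma charge_integralZ a f : bounded_measurable f ->
  L (fun t => a * f t) = a * L f.
Proof.
move=> bf; have := charge_integral_lin a bf bounded_measurable0.
rewrite charge_integral0 addr0 => <-.
by congr charge_integral; apply/funext => t; rewrite addr0.
Qed.

Lemma charge_integralD f g : bounded_measurable f -> bounded_measurable g ->
  L (fun t => f t + g t) = L f + L g.
Proof.
move=> bf bg; rewrite -[L f]mul1r -charge_integral_lin//.
by congr charge_integral; apply/funext => t; rewrite mul1r.
Qed.

Lemma charge_integral_sum m (F : nat -> R -> R) :
  (forall i, bounded_measurable (F i)) ->
  L (fun t => \sum_(i < m) F i t) = \sum_(i < m) L (F i) /\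
  bounded_measurable (fun t => \sum_(i < m) F i t).
Proof.
move=> bF; elim: m => [|m [IH bm]].
  rewrite big_ord0 (_ : (fun t => _) = fun=> 0).
    by split; [exact: charge_integral0|exact: bounded_measurable0].
  by apply/funext => t; rewrite big_ord0.
rewrite big_ord_recr /= -IH -charge_integralD//.
have -> : (fun t => \sum_(i < m.+1) F i t) = fun t => \sum_(i < m) F i t + F m t.
  by apply/funext => t; rewrite big_ord_recr.
by split => //; exact: bounded_measurableD.
Qed.

Lemma charge_integral_bounded : exists2 C, 0 <= C &
  forall f M, 0 <= M -> bounded_measurable f ->
    (forall t, 0 <= t <= 1 -> `|f t| <= M) -> `|L f| <= C * M.
Proof.
have [m1 [m2 rep]] := represents_jordan nu.
have mD := measurable_unit_itv; have [f1 f2 _] := rep D mD.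
exists (fine (m1 D) + fine (m2 D)); first by rewrite addr_ge0// fine_ge0.
move=> f M M0 bf fM; rewrite (charge_integral_represents rep)//.
have bnd (m : {measure set R -> \bar R}) : m D \is a fin_num ->
    `|\int[m]_(x in D) f x| <= fine (m D) * M.
  move=> h; have mDy : (m D < +oo)%E by rewrite ltey_eq h.
  have fi := bounded_measurable_integrable mDy bf.
  rewrite (le_trans (le_normr_Rintegral _ _))//.
  rewrite mulrC -Rintegral_cst//; apply: le_Rintegral => //.
  - have := integrable_abse fi; exact.
  - apply: bounded_measurable_integrable => //; split => //.
    by exists M => t _; rewrite ger0_norm.
rewrite mulrDl; apply: (le_trans (ler_normB _ _)).
by apply: lerD; exact: bnd.
Qed.

End linear.

Lemma represents_csub nu1 nu2 m1 m2 n1 n2 : represents nu1 m1 m2 ->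
  represents nu2 n1 n2 ->
  represents (csub nu1 nu2) (measure_add m1 n2) (measure_add m2 n1).
Proof.
move=> r1 r2 A mA; have [f1 f2 e1] := r1 A mA; have [g1 g2 e2] := r2 A mA.
suff: [/\ (m1 A + n2 A)%E \is a fin_num, (m2 A + n1 A)%E \is a fin_num &
    csub nu1 nu2 A = (m1 A + n2 A - (m2 A + n1 A))%E].
  by rewrite -(measure_add_setE m1 n2) -(measure_add_setE m2 n1).
split; rewrite ?fin_numD ?f1 ?f2 ?g1 ?g2//.
rewrite -[csub nu1 nu2 A]/(nu1 A - nu2 A)%E e1 e2.
by rewrite -(fineK f1) -(fineK f2) -(fineK g1) -(fineK g2) -!EFinD -?EFinN;
  congr (_%:E); lra.
Qed.

Lemma charge_integral_csub nu1 nu2 f : bounded_measurable f ->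
  charge_integral (csub nu1 nu2) D f =
  charge_integral nu1 D f - charge_integral nu2 D f.
Proof.
move=> bf; have [m1 [m2 r1]] := represents_jordan nu1.
have [n1 [n2 r2]] := represents_jordan nu2.
have mD := measurable_unit_itv.
have [f1 f2 _] := r1 D mD; have [g1 g2 _] := r2 D mD.
rewrite (charge_integral_represents (represents_csub r1 r2))//.
rewrite (charge_integral_represents r1)// (charge_integral_represents r2)//.
by rewrite !Rintegral_measure_add ?ltey_eq ?f1 ?f2 ?g1 ?g2//; ring.
Qed.

Definition dirac_charge (t : R) : {charge set R -> \bar R} :=
  charge_of_finite_measure (@dirac _ R t R).

Fixpoint list_charge (l : seq (R * R)) : {charge set R -> \bar R} :=
  if l is p :: l' then cadd (cscale p.1 (dirac_charge p.2)) (list_charge l')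
  else czero.

Lemma charge_integral_list l f : times01 l -> bounded_measurable f ->
  charge_integral (list_charge l) D f = ev f l.
Proof.
move=> + bf; elim: l => [_|p l IH /= /andP[p01 l01]].
  have rep : represents czero mzero mzero.
    by move=> A mA; rewrite /mzero sube0.
  by rewrite (charge_integral_represents rep)// subrr ev_nil.
have [m1 [m2 rep]] := represents_jordan (list_charge l).
have mD := measurable_unit_itv; have [f1 f2 _] := rep D mD.
(* The coefficient is split into its positive and negative parts, since measures are scaled by
   nonnegative numbers. *)
pose a1 : {nonneg R} := NngNum (ltac:(by rewrite le_max lexx orbT) : 0 <=
  Num.max p.1 0).
pose a2 : {nonneg R} := NngNum (ltac:(by rewrite le_max lexx orbT) : 0 <=
  Num.max (- p.1) 0).
have a12 : p.1 = a1%:num - a2%:num.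
  by rewrite /=; case: (ltP p.1 0) => h; case: (ltP (- p.1) 0) => h'; lra.
pose d1 := mscale a1 (@dirac _ R p.2 R).
pose d2 := mscale a2 (@dirac _ R p.2 R).
have rep' : represents (cadd (cscale p.1 (dirac_charge p.2)) (list_charge l))
    (measure_add d1 m1) (measure_add d2 m2).
  move=> A mA; have [g1 g2 e] := rep A mA.
  suff: [/\ (d1 A + m1 A)%E \is a fin_num, (d2 A + m2 A)%E \is a fin_num &
      cadd (cscale p.1 (dirac_charge p.2)) (list_charge l) A =
      (d1 A + m1 A - (d2 A + m2 A))%E].
    by rewrite -(measure_add_setE d1 m1) -(measure_add_setE d2 m2).
  rewrite -[cadd _ _ A]/(p.1%:E * dirac_charge p.2 A + list_charge l A)%E e /d1
    /d2 /mscale /cscale /=.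
  rewrite /dirac_charge /charge_of_finite_measure diracE.
  rewrite -(fineK g1) -(fineK g2) -!EFinM -!EFinD; split => //.
  by rewrite [X in X * _]a12 /=; congr (_%:E); ring.
have d1y : (d1 D < +oo)%E.
  rewrite (_ : d1 D = (a1%:num%:E * @dirac _ R p.2 R D)%E)//.
  by rewrite diracE -EFinM ltry.
have d2y : (d2 D < +oo)%E.
  rewrite (_ : d2 D = (a2%:num%:E * @dirac _ R p.2 R D)%E)//.
  by rewrite diracE -EFinM ltry.
rewrite (charge_integral_represents rep')// !Rintegral_measure_add ?ltey_eq ?f1 ?f2//.
rewrite !Rintegral_mscale_dirac// ev_cons -IH// (charge_integral_represents rep)//.
by rewrite a12; ring.
Qed.

End charge_integral_linear.

(** * The reproducing kernel Hilbert space *)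

Section path_extension.
Variable R : realType.
Implicit Types (h g : C01 R) (f : R -> R).

(** Paths live on a subtype, whereas [ev] acts on functions of a real variable; 0 is the default
    value off [0, 1]. *)
Definition pext h (t : R) : R := if insub t is Some u then h u else 0.

Lemma pext_val h (u : unit_itv R) : pext h (val u) = h u.
Proof. by rewrite /pext valK. Qed.

Lemma unit_itv_val (t : R) : 0 <= t <= 1 -> exists u : unit_itv R, val u = t.
Proof.
move=> t01; have tI : t \in unit_itv R by rewrite inE; exact/unit_itvP.
by exists (SigSub tI).
Qed.

Lemma val_unit_itv (u : unit_itv R) : 0 <= val u <= 1.
Proof. by apply/unit_itvP; exact: (set_valP u). Qed.

Lemma pext_within_continuous h : {within `[0, 1], continuous (pext h)}.
Proof.
apply/subspace_sigL_continuousP.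
rewrite (_ : sigL _ _ = (h : unit_itv R -> R)); first exact: C01_continuous.
by apply/funext => u; rewrite /sigL /= pext_val.
Qed.

Lemma pextB h g t : pext (h - g) t = pext h t - pext g t.
Proof. by rewrite /pext; case: insub => [u|]; rewrite ?subr0. Qed.

Lemma pext_const (x t : R) : 0 <= t <= 1 -> pext (const_path x) t = x.
Proof. by move=> /unit_itv_val[u <-]; rewrite pext_val. Qed.

Lemma pext_le_norm h t : `|pext h t| <= `|h|.
Proof.
rewrite /pext; case: insub => [u|]; last by rewrite normr0 (normr_ge0 h).
have := le_sup_norm h u; exact.
Qed.

Lemma norm_le_pext h r : (forall t, 0 <= t <= 1 -> `|pext h t| <= r) -> `|h| <= r.
Proof.
move=> hr; apply: (@sup_norm_le _ h r) => u.
by rewrite -pext_val; apply: hr; exact: val_unit_itv.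
Qed.

Lemma pext_restrict f t : {within `[0, 1], continuous f} -> 0 <= t <= 1 ->
  pext (restrict_path f) t = f t.
Proof. by move=> cf /unit_itv_val[u <-]; rewrite pext_val restrict_pathE. Qed.

Lemma ev_pextB h g l : ev (pext (h - g)) l = ev (pext h) l - ev (pext g) l.
Proof. by rewrite -evN -evD; apply: eq_ev => p _; rewrite pextB. Qed.

Lemma ev_pext_le h l : `|ev (pext h) l| <= `|h| * norm1 l.
Proof.
rewrite /norm1; elim: l => [|p l IH]; first by rewrite ev_nil normr0 big_nil mulr0.
rewrite ev_cons big_cons mulrDr (le_trans (ler_normD _ _))// lerD//.
by rewrite normrM mulrC ler_wpM2r// pext_le_norm.
Qed.

End path_extension.

Section l2_partial_norm.
Variable R : realType.
Implicit Types (a b : nat -> R).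

Definition l2 m a : R := Num.sqrt (\sum_(i < m) a i ^+ 2).

Lemma l2_ge0 m a : 0 <= l2 m a. Proof. exact: sqrtr_ge0. Qed.

Lemma sqr_l2 m a : l2 m a ^+ 2 = \sum_(i < m) a i ^+ 2.
Proof. by rewrite sqr_sqrtr// sumr_ge0// => i _; exact: sqr_ge0. Qed.

Lemma l2D m a b : l2 m (fun i => a i + b i) <= l2 m a + l2 m b.
Proof.
rewrite -ler_sqr ?nnegrE ?addr_ge0 ?l2_ge0// sqrrD !sqr_l2.
have cs : \sum_(i < m) a i * b i <= l2 m a * l2 m b.
  rewrite (le_trans (ler_norm _))// -ler_sqr ?nnegrE ?mulr_ge0 ?l2_ge0//.
  by rewrite real_normK ?num_real// exprMn !sqr_l2 CauchySchwarz_sum.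
under eq_bigr do rewrite sqrrD.
by rewrite !big_split /= lerD2r lerD2l mulr2n lerD.
Qed.

Lemma l2_le_add m a b : l2 m a <= l2 m b + l2 m (fun i => a i - b i).
Proof.
apply: le_trans (l2D _ _ _); rewrite le_eqVlt; apply/orP; left; apply/eqP.
by congr Num.sqrt; apply: eq_bigr => i _; rewrite addrC subrK.
Qed.

Lemma l2N m a b : l2 m (fun i => a i - b i) = l2 m (fun i => b i - a i).
Proof. by congr Num.sqrt; apply: eq_bigr => i _; rewrite -sqrrN opprB. Qed.

Lemma l2Z m (c : R) a : 0 <= c -> l2 m (fun i => c * a i) = c * l2 m a.
Proof.
move=> c0; rewrite /l2; under eq_bigr do rewrite exprMn.
by rewrite -mulr_sumr sqrtrM ?sqr_ge0// sqrtr_sqr ger0_norm.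
Qed.

Lemma l2_le m a b : (forall i, `|a i| <= b i) -> l2 m a <= l2 m b.
Proof.
move=> ab; rewrite ler_sqrt ?sumr_ge0// => [|i _]; last exact: sqr_ge0.
apply: ler_sum => i _; rewrite -real_normK ?num_real// ler_sqr ?nnegrE//.
exact: le_trans (ab i).
Qed.

End l2_partial_norm.

Section rkhs_energy.
Variables (R : realType) (H : R).
Hypothesis H01 : 0 < H < 1.
Local Notation k := (fbm_cov H).
Hypothesis kpsd : psd k.
Local Notation T := (dense_times R).
Local Notation kc := (cond_cov k T).
Local Notation e_ := (chol k T).
Local Notation C_ := (coord k T).
Local Notation D := (unit_itv R).
Local Notation T0 := (@dense_times_ge0 R).
Local Notation L nu := (charge_integral nu D).

Let ksym := fbm_cov_sym H.

Let T01 j : (0 < j)%N -> 0 < T j <= 1.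
Proof. by move=> _; exact: dense_times01. Qed.

Lemma bounded_measurable_cov t : bounded_measurable (k t).
Proof.
apply: continuous_bounded_measurable.
rewrite (_ : k t = k ^~ t); first exact: fbm_cov_within_continuous.
by apply/funext => s; rewrite ksym.
Qed.

Lemma bounded_measurable_ev_cov l : bounded_measurable (fun s => ev (k s) l).
Proof. by apply: continuous_bounded_measurable; exact: bil_cov_within_continuous. Qed.

Lemma bounded_measurable_chol i : bounded_measurable (e_ i).
Proof.
rewrite (_ : e_ i = fun s => ev (k s) (C_ i)); first exact: bounded_measurable_ev_cov.
by apply/funext => s; rewrite ev_cov_coord.
Qed.

Section charge.
Variable nu : {charge set R -> \bar R}.

Let series m t := \sum_(i < m) e_ i t * L nu (e_ i).

Lemma bounded_measurable_series m : bounded_measurable (series m).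
Proof.
have [_] := @charge_integral_sum _ nu m (fun i t => L nu (e_ i) * e_ i t)
  (fun i => bounded_measurableZ _ (bounded_measurable_chol i)).
rewrite (_ : (fun t => _) = series m)//.
by apply/funext => t; apply: eq_bigr => i _; rewrite mulrC.
Qed.

(** A Mercer-like expansion: the kernel is the sum of the first [m] products of Cholesky factors
    plus [kc m], which tends to 0 uniformly, and integration against [nu] is bounded for the
    sup-norm. *)
Lemma potential_series (eta : R) : 0 < eta -> exists M, forall m, (M <= m)%N ->
  forall t, 0 <= t <= 1 -> `|potential k nu t - series m t| <= eta.
Proof.
move=> eta0; have [C C0 HC] := charge_integral_bounded nu.
have C1 : 0 < C + 1 by rewrite ltr_wpDl.
have [M HM] := cond_cov_small2 H01 kpsd (divr_gt0 eta0 C1).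
exists M => m Mm t t01.
pose f s := \sum_(i < m) e_ i t * e_ i s.
have [Lf bf] := @charge_integral_sum _ nu m (fun i s => e_ i t * e_ i s)
  (fun i => bounded_measurableZ _ (bounded_measurable_chol i)).
have bk : bounded_measurable (kc m t).
  rewrite (_ : kc m t = fun s => k t s + (-1) * f s).
    apply: bounded_measurableD; first exact: bounded_measurable_cov.
    exact: bounded_measurableZ.
  by apply/funext => s; rewrite (cond_cov_chol ksym kpsd T0) mulN1r.
have -> : potential k nu t - series m t = L nu (kc m t).
  have -> : potential k nu t = L nu (fun s => kc m t s + f s).
    congr charge_integral; apply/funext => s.
    by rewrite (cond_cov_chol ksym kpsd T0) subrK.
  rewrite charge_integralD// Lf.
  rewrite (_ : \sum_(i < m) _ = series m t) ?addrK//.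
  by apply: eq_bigr => i _; rewrite charge_integralZ//;
    exact: bounded_measurable_chol.
have Hk := HC _ _ (ltW (divr_gt0 eta0 C1)) bk (fun s s01 => HM m Mm t s t01 s01).
rewrite (le_trans Hk)// mulrA ler_pdivrMr// mulrC ler_wpM2l ?(ltW eta0)//.
by rewrite lerDl.
Qed.

(** Measurability comes from the pointwise convergence of the partial series. *)
Lemma bounded_measurable_potential : bounded_measurable (potential k nu).
Proof.
split.
  apply: (@measurable_fun_cvg _ _ _ _ series).
    by move=> m; have [] := bounded_measurable_series m.
  move=> t /unit_itvP t01; apply/cvgrPdist_le => eta eta0.
  have [M HM] := potential_series eta0.
  by near=> m; apply: HM => //; near: m; exact: nbhs_infty_ge.
have [M /(_ M (leqnn M)) HM] := potential_series ltr01.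
have [_ [B HB]] := bounded_measurable_series M.
exists (1 + B) => t t01; rewrite -(subrK (series M t) (potential k nu t)).
by rewrite (le_trans (ler_normD _ _))// lerD ?HM ?HB.
Unshelve. all: by end_near. Qed.

Lemma energy_series (eta : R) : 0 < eta -> exists M, forall m, (M <= m)%N ->
  `|energy k nu - \sum_(i < m) L nu (e_ i) ^+ 2| <= eta.
Proof.
move=> eta0; have [C C0 HC] := charge_integral_bounded nu.
have C1 : 0 < C + 1 by rewrite ltr_wpDl.
have [M HM] := potential_series (divr_gt0 eta0 C1).
exists M => m Mm.
have bp := bounded_measurable_potential; have bs := bounded_measurable_series m.
have bd : bounded_measurable (fun t => potential k nu t + (-1) * series m t).
  by apply: bounded_measurableD => //; exact: bounded_measurableZ.
have -> : energy k nu - \sum_(i < m) L nu (e_ i) ^+ 2 =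
    L nu (fun t => potential k nu t + (-1) * series m t).
  rewrite charge_integralD//; last exact: bounded_measurableZ.
  rewrite charge_integralZ// mulN1r; congr (_ - _).
  have [+ _] := @charge_integral_sum _ nu m (fun i t => L nu (e_ i) * e_ i t)
    (fun i => bounded_measurableZ _ (bounded_measurable_chol i)).
  rewrite (_ : (fun t => _) = series m) => [->|].
    apply: eq_bigr => i _; rewrite charge_integralZ ?expr2//.
    exact: bounded_measurable_chol.
  by apply/funext => t; apply: eq_bigr => i _; rewrite mulrC.
have bound t : 0 <= t <= 1 ->
    `|potential k nu t + (-1) * series m t| <= eta / (C + 1).
  by move=> t01; rewrite mulN1r; exact: HM.
rewrite (le_trans (HC _ _ (ltW (divr_gt0 eta0 C1)) bd bound))//.
rewrite mulrA ler_pdivrMr// mulrC ler_wpM2l ?(ltW eta0)//.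
by rewrite lerDl.
Qed.

Lemma l2_le_energy m : l2 m (fun i => L nu (e_ i)) <= Num.sqrt (energy k nu).
Proof.
rewrite ler_wsqrtr//; apply/ler_addgt0Pr => eta eta0.
have [M HM] := energy_series eta0.
apply: (@le_trans _ _ (\sum_(i < maxn m M) L nu (e_ i) ^+ 2)).
  rewrite -!(big_mkord xpredT (fun i => L nu (e_ i) ^+ 2)).
  rewrite [leRHS](@big_cat_nat _ _ _ m)//= ?leq_maxl// lerDl.
  by apply: sumr_ge0 => i _; exact: sqr_ge0.
have := HM (maxn m M) (leq_maxr _ _).
by rewrite ler_norml => /andP[h1 h2]; lra.
Qed.

Lemma energy_le_l2 (eta : R) : 0 < eta -> exists M, forall m, (M <= m)%N ->
  Num.sqrt (energy k nu) <= l2 m (fun i => L nu (e_ i)) + eta.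
Proof.
move=> eta0; have [M HM] := energy_series (ltac:(by rewrite exprn_gt0) : 0 <
  eta ^+ 2).
exists M => m Mm; set a := fun i => _.
have l0 := l2_ge0 m a.
have le0 : 0 <= l2 m a + eta by rewrite addr_ge0// ltW.
rewrite -[leRHS]ger0_norm// -sqrtr_sqr ler_wsqrtr// sqrrD sqr_l2.
have := HM m Mm; rewrite ler_norml => /andP[h1 h2].
have : 0 <= l2 m a * eta *+ 2 by rewrite mulrn_wge0// mulr_ge0// ltW.
by lra.
Qed.

Lemma ev_potential l : ev (potential k nu) l = L nu (fun s => ev (k s) l).
Proof.
elim: l => [|p l IH].
  rewrite ev_nil (_ : (fun s => _) = fun=> 0) ?charge_integral0//.
  by apply/funext => s; rewrite ev_nil.
rewrite ev_cons IH.
rewrite (_ : (fun s => ev (k s) (p :: l)) = fun s => p.1 * k p.2 s + ev (k s) l).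
  rewrite charge_integral_lin//; first exact: bounded_measurable_cov.
  exact: bounded_measurable_ev_cov.
by apply/funext => s; rewrite ev_cons ksym.
Qed.

Lemma coord_potential i : ev (potential k nu) (C_ i) = L nu (e_ i).
Proof.
rewrite ev_potential; congr charge_integral; apply/funext => s.
by rewrite ev_cov_coord.
Qed.

End charge.

Local Notation coords h := (fun i => ev (pext h) (C_ i)).

Lemma l2_coords m (h : C01 R) : l2 m (coords h) ^+ 2 = energy_upto H (pext h) m.
Proof. exact: sqr_l2. Qed.

Definition l2_norm (a : nat -> R) (r : R) :=
  (forall m, l2 m a <= r) /\ forall eta, 0 < eta -> exists m, r - eta <= l2 m a.

Lemma l2_norm_unique a r r' : l2_norm a r -> l2_norm a r' -> r = r'.
Proof.
move=> [ub lb] [ub' lb']; apply/eqP; rewrite eq_le; apply/andP; split;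
  apply/ler_addgt0Pr => eta eta0.
  by have [m] := lb _ eta0; rewrite lerBlDr => /le_trans; apply; rewrite lerD2r ub'.
by have [m] := lb' _ eta0; rewrite lerBlDr => /le_trans; apply; rewrite lerD2r ub.
Qed.

Lemma l2_norm_exists (a : nat -> R) B : (forall m, l2 m a <= B) ->
  exists2 r, l2_norm a r & 0 <= r <= B.
Proof.
move=> aB; pose A := range (fun m => l2 m a).
have hs : has_sup A.
  by split; [exists (l2 0 a), 0%N|exists B => _ [m _ <-]].
exists (sup A).
  split=> [m|eta eta0]; first by apply: (sup_upper_bound hs); exists m.
  by have [_ [m _ <-] /ltW h] := sup_adherent eta0 hs; exists m.
apply/andP; split.
  by apply: le_trans (l2_ge0 0 a) _; apply: (sup_upper_bound hs); exists 0%N.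
by apply: ge_sup; [exists (l2 0 a), 0%N|move=> _ [m _ <-]].
Qed.

(** The coordinates map the energy norm isometrically into square summable sequences, and each of
    them is continuous for the sup-norm. The Cauchy condition thus passes to the limit path
    coordinatewise, and the norms converge. *)
Lemma rkhs_approx_norm (lam : nat -> {charge set R -> \bar R}) (h : C01 R) :
  rkhs_approx k lam h -> exists2 r, l2_norm (coords h) r &
    Num.sqrt (energy k (lam m)) @[m --> \oo] --> r.
Proof.
move=> [cauchy [h_ hE hh]].
pose a m i := L (lam m) (e_ i).
have aE m i : a m i = ev (pext (h_ m)) (C_ i).
  rewrite /a -coord_potential; apply: eq_ev => p pC.
  have /allP/(_ p pC) := coord_times01 H T01 i.
  by move=> /unit_itv_val[u <-]; rewrite pext_val hE.
have ah m i : `|a m i - ev (pext h) (C_ i)| <= `|h_ m - h| * norm1 (C_ i).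
  by rewrite aE -ev_pextB ev_pext_le.
have dist_l2 J m : l2 J (fun i => a m i - ev (pext h) (C_ i)) <=
    `|h_ m - h| * l2 J (fun i => norm1 (C_ i)).
  by rewrite -l2Z ?normr_ge0//; apply: l2_le => i; exact: ah.
have F2 e : 0 < e -> exists N, forall i j, (N <= i)%N -> (N <= j)%N ->
    forall J, l2 J (fun l => a i l - a j l) <= e.
  move=> /cauchy[N HN]; exists N => i j Ni Nj J.
  rewrite (le_trans _ (ltW (HN i j Ni Nj)))//.
  rewrite (le_trans _ (l2_le_energy (csub (lam i) (lam j)) J))//.
  rewrite le_eqVlt; apply/orP; left; apply/eqP; congr Num.sqrt.
  apply: eq_bigr => l _; congr (_ ^+ 2).
  by rewrite charge_integral_csub//; exact: bounded_measurable_chol.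
have F3 e : 0 < e -> exists N, forall i, (N <= i)%N ->
    forall J, l2 J (fun l => a i l - ev (pext h) (C_ l)) <= e.
  move=> /F2[N HN]; exists N => i Ni J; apply/ler_addgt0Pr => eta eta0.
  pose K := l2 J (fun i => norm1 (C_ i)) + 1.
  have K0 : 0 < K by rewrite ltr_wpDl// l2_ge0.
  have /cvgrPdist_le/(_ _ (divr_gt0 eta0 K0))[N' _ HN'] := hh.
  (* This index may depend on [J] and [eta]: the Cauchy bound [HN] is uniform in both indices and in
     [J], so [j] disappears from the conclusion. *)
  pose j := maxn N N'.
  have hj : `|h_ j - h| <= eta / K.
    by rewrite distrC; apply: HN'; rewrite /= leq_maxr.
  apply: (@le_trans _ _ (l2 J (fun l => a i l - a j l) +
      l2 J (fun l => a j l - ev (pext h) (C_ l)))).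
    apply: le_trans (l2D _ _ _); rewrite le_eqVlt; apply/orP; left; apply/eqP.
    by congr Num.sqrt; apply: eq_bigr => l _; rewrite addrA subrK.
  apply: lerD; first by apply: HN => //; exact: leq_maxl.
  rewrite (le_trans (dist_l2 J j))//.
  apply: (@le_trans _ _ (eta / K * K)); last by rewrite divfK// gt_eqF.
  by apply: ler_pM => //; rewrite ?l2_ge0// lerDl.
have [N1 HN1] := F3 1 ltr01.
have [r nr r0] : exists2 r, l2_norm (coords h) r &
    0 <= r <= Num.sqrt (energy k (lam N1)) + 1.
  apply: l2_norm_exists => J; rewrite (le_trans (l2_le_add J _ (a N1)))//.
  by apply: lerD; [exact: l2_le_energy|rewrite l2N; exact: HN1].
exists r => //; apply/cvgrPdist_le => e e0.
have e2 : 0 < e / 2 by rewrite divr_gt0.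
have [N HN] := F3 _ e2; exists N => // i Ni /=.
have [ub lb] := nr.
rewrite ler_distlC; apply/andP; split.
  rewrite lerBlDr.
  have [J HJ] := lb _ e2.
  have h1 := l2_le_add J (coords h) (a i).
  have h2 := HN i Ni J; rewrite l2N in h2.
  have h3 := l2_le_energy (lam i) J.
  by move: h1 h2 h3 HJ; rewrite -/(a i); lra.
have [J /(_ J (leqnn J)) HJ] := energy_le_l2 (lam i) e2.
have h1 := l2_le_add J (a i) (coords h).
have h2 := HN i Ni J.
have h3 := ub J.
by move: HJ; rewrite -/(a i); lra.
Qed.

Lemma rkhs_normE (h : C01 R) r : rkhs k h -> l2_norm (coords h) r ->
  rkhs_norm k h = r.
Proof.
move=> [lam lamh] nr; rewrite /rkhs_norm.
set A := [set s | _].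
have rA : A r.
  have [r' nr' cr'] := rkhs_approx_norm lamh.
  by exists lam => //; rewrite (l2_norm_unique nr nr').
have [lam' lamh' cr] : A (get A) by exact: (@getI _ A r rA).
have [r' nr' cr'] := rkhs_approx_norm lamh'.
rewrite (l2_norm_unique nr nr').
exact: (cvg_unique _ cr cr').
Qed.

(** The approximating measures are the discrete ones whose potentials are the projections of [h]:
    tails of a convergent series make them Cauchy, and [proj_cvg] gives uniform convergence. *)
Lemma energy_rkhs (h : C01 R) B : (forall m, l2 m (coords h) <= B) -> rkhs k h.
Proof.
move=> hB; have B0 : 0 <= B by rewrite (le_trans (l2_ge0 0 (coords h))).
have hB2 m : energy_upto H (pext h) m <= B ^+ 2.
  by rewrite -l2_coords ler_sqr ?nnegrE// l2_ge0.
pose c i := ev (pext h) (C_ i).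
exists (fun m => list_charge (coord_comb H T m c)).
have comb01 m : times01 (coord_comb H T m c) by exact: coord_comb_times01.
have aE m i : L (list_charge (coord_comb H T m c)) (e_ i) = if (i < m)%N then c
  i else 0.
  rewrite charge_integral_list//; last exact: bounded_measurable_chol.
  rewrite ev_coord_comb.
  under eq_bigr do rewrite (ev_chol_coord ksym kpsd T0).
  case: ifPn => [im|nim].
    rewrite (bigD1 (Ordinal im)) //= eqxx /= big1 ?addr0 => [|j ji].
      have [v0|v0] := eqVneq (cond_var k T i) 0; rewrite ?mulr1//.
      by rewrite mulr0 /c coord_degenerate.
    rewrite [_ == _](_ : _ = false) ?mulr0//; apply/negbTE.
    by apply: contraNneq ji => ij; apply/eqP/val_inj.
  apply: big1 => j _; case: eqVneq => [ij|]; last by rewrite mulr0.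
  by move: nim; rewrite -ij ltn_ord.
split.
  move=> e e0; have [r [ub lb] /andP[r0 rB]] := l2_norm_exists hB.
  (* A difference of squares is the difference times the sum, here at most [2 * (B + 1)]; the
     product is [(e / 2) ^+ 2]. *)
  have e4 : 0 < e ^+ 2 / (8 * (B + 1)).
    by rewrite divr_gt0 ?exprn_gt0// mulr_gt0// ltr_wpDl.
  have [N HN] := lb _ e4; exists N => i j Ni Nj.
  set nu := csub _ _.
  have [M HM] := energy_le_l2 nu (ltac:(by rewrite divr_gt0) : 0 < e / 4).
  apply: (le_lt_trans (HM (maxn M N) (leq_maxl _ _))).
  set J := maxn M N.
  suff : l2 J (fun l => L nu (e_ l)) <= e / 2 by lra.
  rewrite -ler_sqr ?nnegrE ?l2_ge0 ?divr_ge0 ?(ltW e0)// sqr_l2.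
  apply: (@le_trans _ _ (l2 J c ^+ 2 - l2 N c ^+ 2)).
    rewrite !sqr_l2 -!(big_mkord xpredT (fun l => c l ^+ 2)).
    rewrite (@big_cat_nat _ _ _ N 0 J)//= ?leq_maxr// addrAC subrr add0r.
    rewrite -(big_mkord xpredT (fun l => L nu (e_ l) ^+ 2)).
    rewrite (@big_cat_nat _ _ _ N 0 J)//= ?leq_maxr//.
    have nuE l : L nu (e_ l) = (if (l < i)%N then c l else 0) -
        (if (l < j)%N then c l else 0).
      by rewrite charge_integral_csub ?aE//; exact: bounded_measurable_chol.
    rewrite big_nat big1 ?add0r; last first.
      move=> l /andP[_ lN]; rewrite nuE (leq_trans lN Ni) (leq_trans lN Nj).
      by rewrite subrr expr0n.
    apply: ler_sum => l _; rewrite nuE.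
    by case: ifP => _; case: ifP => _;
      rewrite ?subrr ?subr0 ?sub0r ?sqrrN ?expr0n ?lexx ?sqr_ge0.
  have h1 := ub J; have h2 := l2_ge0 J c; have h3 := l2_ge0 N c.
  have h4 := ub N.
  have -> : l2 J c ^+ 2 - l2 N c ^+ 2 = (l2 J c - l2 N c) * (l2 J c + l2 N c) by ring.
  apply: (@le_trans _ _ (e ^+ 2 / (8 * (B + 1)) * (2 * (B + 1)))).
    apply: (@le_trans _ _ (e ^+ 2 / (8 * (B + 1)) * (l2 J c + l2 N c))).
      by rewrite ler_wpM2r ?addr_ge0//; rewrite -/c in HN; lra.
    by rewrite ler_wpM2l ?(ltW e4)//; rewrite -/c in h1 h4; lra.
  rewrite le_eqVlt; apply/orP; left; apply/eqP.
  by field; rewrite gt_eqF// ltr_wpDl.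
exists (fun m => restrict_path (partial_path k T c m)).
  move=> m t; rewrite -pext_val pext_restrict ?val_unit_itv//; last first.
    exact: partial_path_within_continuous.
  rewrite /potential charge_integral_list//; last exact: bounded_measurable_cov.
  by rewrite ev_cov_coord_comb.
apply/cvgrPdist_le => eta eta0.
have [M HM] := proj_cvg H01 kpsd (@pext_within_continuous R h) B0 hB2 eta0.
exists M => // m /= Mm; apply: norm_le_pext => t t01.
rewrite pextB pext_restrict//; first exact: HM.
exact: partial_path_within_continuous.
Qed.

(** A sublevel condition becomes countably many inequalities, each on finitely many values of the
    path. The starting point needs no separate clause on the right: finite energy forces it through
    [energy_at0]. *)
Theorem rate_function_le (x : R) (h : C01 R) (a : R) :
  (rate_function H x h <= a%:E)%E <->
  forall m, 2^-1 * energy_upto H (pext (h - const_path x)) m <= a.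
Proof.
rewrite /rate_function; split.
  case: asboolP => [[_ hr]|_]; last by rewrite leye_eq.
  rewrite lee_fin => ra m; rewrite (le_trans _ ra)// ler_wpM2l// -l2_coords.
  have [lam /rkhs_approx_norm[r nr _]] := hr.
  rewrite (rkhs_normE hr nr) ler_sqr ?nnegrE ?l2_ge0//; first by case: nr.
  by apply: le_trans (l2_ge0 0 (coords (h - const_path x))) _; case: nr.
move=> ha; have a0 : 0 <= a.
  by have := ha 0%N; rewrite /energy_upto big_ord0 mulr0.
pose B := Num.sqrt (2 * a).
have B2 : B ^+ 2 = 2 * a by rewrite sqr_sqrtr// mulr_ge0.
have hB2 m : energy_upto H (pext (h - const_path x)) m <= B ^+ 2.
  by rewrite B2 -ler_pdivrMl.
have hB m : l2 m (coords (h - const_path x)) <= B.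
  by rewrite -ler_sqr ?nnegrE ?l2_ge0 ?sqrtr_ge0// l2_coords.
have hr := energy_rkhs hB.
have := energy_at0 H01 kpsd (@pext_within_continuous R _) (sqrtr_ge0 _) hB2.
rewrite pextB pext_const ?lexx ?ler01// => /eqP; rewrite subr_eq0 => /eqP h0.
rewrite ifT; last first.
  by apply/asboolP; split => //; rewrite -h0 -(pext_val h (unit0 R)).
have [r nr /andP[r0 rB]] := l2_norm_exists hB.
rewrite (rkhs_normE hr nr) lee_fin -ler_pdivlMl// invrK -B2.
by rewrite ler_sqr ?nnegrE// sqrtr_ge0.
Qed.

End rkhs_energy.

(** * Level sets and measurability in the path space *)

Section path_topology.
Variable R : realType.
Implicit Types (h g : C01 R) (K F G : set (C01 R)).

Lemma unit_itv_uniform_continuity (f : R -> R) (e : R) :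
  {within `[0, 1], continuous f} -> 0 < e ->
  exists2 delta, 0 < delta & forall s t, 0 <= s <= 1 -> 0 <= t <= 1 ->
    `|s - t| < delta -> `|f s - f t| <= e.
Proof.
move=> cf e0.
have /compact_near_coveringP/near_covering_withinP := @segment_compact R 0 1.
move=> /(_ R 0^'+ (fun delta t => forall s, 0 <= s <= 1 -> `|s - t| < delta ->
  `|f s - f t| <= e)) cov.
have [] : \forall delta \near 0^'+, `[0, 1]%classic `<=` (fun t => forall s,
    0 <= s <= 1 -> `|s - t| < delta -> `|f s - f t| <= e).
  apply: cov => t; rewrite /= in_itv /= => t01.
  have [d d0 Hd] := within_itv_near cf t01 (ltac:(by rewrite divr_gt0) : 0 < e / 2).
  have d2 : 0 < d / 2 by rewrite divr_gt0.
  near=> t' delta => /=; rewrite in_itv /= => t'01 s s01 st.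
  have tt' : `|t' - t| < d / 2.
    rewrite distrC; near: t'; exact: (@nbhsx_ballx R R t (d / 2) d2).
  have dd : delta < d / 2 by near: delta; exact: nbhs_right_lt.
  have h1 : `|s - t| < d.
    rewrite -(subrKA t') (le_lt_trans (ler_normD _ _))//.
    by rewrite (splitr d) ltrD// (lt_trans st).
  have h2 : `|t' - t| < d by rewrite (lt_trans tt')//; lra.
  have := Hd s s01 h1; have := Hd t' t'01 h2.
  by rewrite !ltr_norml ler_norml => /andP[? ?] /andP[? ?]; lra.
move=> d /= d0 Hd; exists (d / 2); first by rewrite divr_gt0.
move=> s t s01 t01 st; apply: (Hd (d / 2)) => //=.
- by rewrite sub0r normrN gtr0_norm ?divr_gt0//; lra.
- by rewrite divr_gt0.
Unshelve. all: by end_near. Qed.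

Lemma compact_closed_separated K F : compact K -> closed F -> K `&` F = set0 ->
  exists2 r, 0 < r & forall h g, K h -> F g -> r <= `|g - h|.
Proof.
move=> cK cF KF.
have /near_covering_withinP := iffLR (@compact_near_coveringP (C01 R) K) cK.
move=> /(_ R 0^'+ (fun r h => forall g, F g -> r <= `|g - h|)) cov.
have [] : \forall r \near 0^'+, K `<=` (fun h => forall g, F g -> r <= `|g - h|).
  apply: cov => h Kh.
  have nFh : nbhs h (~` F).
    apply: open_nbhs_nbhs; split; first exact: closed_openC.
    by move=> Fh; have : (K `&` F) h by []; rewrite KF.
  have /nbhs_ballP[r /= r0 Hr] := nFh.
  have r2 : 0 < r / 2 by rewrite divr_gt0.
  near=> h' rho => _ g Fg.
  have hh' : `|h - h'| < r / 2.
    by near: h'; have := nbhsx_ballx h (r / 2) r2; rewrite -ball_normE.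
  have rr : rho < r / 2 by near: rho; exact: nbhs_right_lt.
  rewrite leNgt; apply/negP => gh'.
  apply: (Hr g) => //; rewrite -ball_normE /=.
  rewrite -(subrKA h') (le_lt_trans (ler_normD _ _))//.
  by rewrite (splitr r) ltrD// distrC (lt_trans gh').
move=> d /= d0 Hd; exists (d / 2); first by rewrite divr_gt0.
move=> h g Kh Fg; apply: (Hd (d / 2)) => //=.
- by rewrite sub0r normrN gtr0_norm ?divr_gt0//; lra.
- by rewrite divr_gt0.
Unshelve. all: by end_near. Qed.

Lemma ultra_bounded_cvg (F : set_system (C01 R)) (phi : C01 R -> R) (M : R) :
  UltraFilter F -> F [set h | `|phi h| <= M] ->
  exists y, forall e, 0 < e -> F [set h | `|phi h - y| < e].
Proof.
move=> FU FM; have PF := ultra_proper.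
have cM : compact `[- M, M] by exact: segment_compact.
have FI : (phi @ F) `[- M, M]%classic.
  by apply: (@filterS _ F _ _ (phi @^-1` _)) FM => h /=; rewrite in_itv /= ler_norml.
have [y [_ Fy]] := cM (phi @ F) _ FI.
exists y => e e0.
have [//|nF] := in_ultra_setVsetC [set h | `|phi h - y| < e] FU.
have [z [/= z1 z2]] := Fy [set z | ~ `|z - y| < e] (ball y e) nF
  (nbhsx_ballx y e e0).
by exfalso; apply: z1; rewrite distrC.
Qed.

(** Paths uniformly close to a step function of mesh 1 / m with values in the multiples of 1 / (k +
    1). There are countably many cells, and each is defined by countably many evaluations, so they
    transfer measurability from evaluations to open sets. *)
Definition path_cell (k m : nat) (q : seq int) : set (C01 R) :=
  [set h | forall j, (0 < j)%N -> `|pext h (dense_times R j) -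
     (nth 0 q (Num.truncn (m%:R * dense_times R j)))%:~R / k.+1%:R| <=
     2 / k.+1%:R].

Lemma open_path_cell G h : open G -> G h ->
  exists k m (q : seq int), path_cell k m q h /\ path_cell k m q `<=` G.
Proof.
move=> oG Gh.
have /nbhs_ballP[r /= r0 Hr] := open_nbhs_nbhs (conj oG Gh).
(* Two paths of one cell are at distance at most [4 / k.+1], which this makes less than [r]. *)
pose k := Num.truncn (4 / r).
have k0 : 0 < k.+1%:R :> R by rewrite ltr0n.
have kr : k.+1%:R^-1 < r / 4.
  rewrite -[ltRHS]invrK invf_div ltf_pV2 ?posrE// ?divr_gt0//.
  by rewrite truncnS_gt.
have k2 : 0 < k.+1%:R^-1 :> R by rewrite invr_gt0.
have [d d0 Hd] := unit_itv_uniform_continuity (@pext_within_continuous R h) k2.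
pose m := (Num.truncn d^-1).+1.
have m0 : 0 < m%:R :> R by rewrite ltr0n.
have md : m%:R^-1 < d by rewrite invf_plt ?posrE// truncnS_gt.
pose q := [seq Num.floor (k.+1%:R * pext h (i%:R / m%:R)) | i <- iota 0 m.+1].
have cell : path_cell k m q h.
  move=> j j0; have t01 := dense_times01 R j; set t := dense_times R j in t01 *.
  have t0 : 0 <= t by exact: dense_times_ge0.
  have mt0 : 0 <= m%:R * t by rewrite mulr_ge0// ltW.
  have /andP[i1 i2] := truncn_itv mt0.
  set i := Num.truncn _ in i1 i2 *.
  have im : (i <= m)%N.
    rewrite -(ler_nat R) (le_trans i1)// -[leRHS]mulr1 ler_pM2l//.
    by case/andP: t01.
  rewrite (nth_map 0%N) ?size_iota// nth_iota// add0n.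
  have it : `|t - i%:R / m%:R| < d.
    apply: le_lt_trans md; rewrite -(ler_pM2l m0) divff ?gt_eqF//.
    rewrite -[X in X * `|_|]gtr0_norm// -normrM mulrBr mulrCA divff ?gt_eqF//.
    rewrite mulr1 ger0_norm ?subr_ge0// lerBlDl.
    by rewrite -natr1 in i2; rewrite (ltW i2).
  have i01 : 0 <= (i%:R / m%:R : R) <= 1.
    by rewrite divr_ge0 ?ler0n//= ler_pdivrMr// mul1r ler_nat.
  have := Hd t (i%:R / m%:R) (ltac:(by rewrite t0 /=; case/andP: t01)) i01 it.
  set y := pext h (i%:R / m%:R).
  have /andP[f1 f2] := floor_itv (k.+1%:R * y).
  rewrite intrD in f2.
  move=> hy; have fy : `|y - (Num.floor (k.+1%:R * y))%:~R / k.+1%:R| <= k.+1%:R^-1.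
    rewrite -(ler_pM2l k0) divff ?gt_eqF//.
    rewrite -[X in X * `|_|]gtr0_norm// -normrM mulrBr mulrCA divff ?gt_eqF//.
    by rewrite mulr1 ger0_norm ?subr_ge0// lerBlDl addrC ltW// addrC.
  rewrite -(subrKA y) (le_trans (ler_normD _ _))//.
  by rewrite [leRHS]mulr_natl mulr2n lerD.
exists k, m, q; split=> // g gq; apply: Hr; rewrite -ball_normE /=.
apply: (@le_lt_trans _ _ (4 * k.+1%:R^-1));
  last by move: (k.+1%:R^-1) kr => u kr; lra.
apply: norm_le_pext.
apply: (dense01_le (@dense01_dense_times R) (@pext_within_continuous R _)).
move=> _ [j j0 ->] _; rewrite pextB.
have := cell j j0; have := gq j j0.
move: (k.+1%:R^-1) (_%:~R / _) => u z; rewrite !ler_norml => /andP[? ?] /andP[? ?].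
by apply/andP; split; lra.
Qed.

Lemma measurable_open_preimage d (Om : measurableType d) (U : Om -> C01 R) G :
  (forall t, 0 <= t <= 1 -> measurable_fun setT (fun w => pext (U w) t)) ->
  open G -> measurable (U @^-1` G).
Proof.
move=> mU oG.
pose D := [set c : nat * nat * seq int | path_cell c.1.1 c.1.2 c.2 `<=` G].
rewrite [X in measurable X](_ : _ =
  \bigcup_c (if c \in D then U @^-1` path_cell c.1.1 c.1.2 c.2 else set0));
  last first.
  apply/seteqP; split => [w Gw|w [c _]]; last first.
    by case: ifPn => // /set_mem cG; exact: cG.
  have [k [m [q [Uw qG]]]] := open_path_cell oG Gw.
  by exists ((k, m), q) => //; rewrite mem_set.
apply: countable_bigcupT_measurable => [|[[k m] q]]; first exact: countableP.
case: ifPn => //= _.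
rewrite [X in measurable X](_ : _ = \bigcap_(j in [set j | (0 < j)%N])
  [set w | `|pext (U w) (dense_times R j) -
     (nth 0 q (Num.truncn (m%:R * dense_times R j)))%:~R / k.+1%:R| <=
     2 / k.+1%:R]); last by [].
apply: bigcap_measurable => [|j /= _]; first by exists 1%N.
have t01 := (ltac:(have /andP[t0 ->] := dense_times01 R j; rewrite ltW//) :
  0 <= dense_times R j <= 1).
set z := _%:~R / _.
rewrite -[X in measurable X]setTI; apply: measurable_fun_le => //.
  apply: measurableT_comp => //; apply: measurable_funB => //; exact: mU.
Qed.

End path_topology.

(** * Compactness of the level sets *)

Section rate_function_level_sets.
Variables (R : realType) (H : R).
Hypothesis H01 : 0 < H < 1.
Local Notation k := (fbm_cov H).
Hypothesis kpsd : psd k.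
Local Notation T := (dense_times R).
Local Notation C_ := (coord k T).

Let H0 : 0 < H. Proof. by case/andP: H01. Qed.

Lemma powR_small (B c : R) : 0 <= B -> 0 < c -> exists2 delta, 0 < delta &
  forall u, 0 <= u < delta -> B * u `^ H <= c.
Proof.
move=> B0 c0; have B1 : 0 < B + 1 by rewrite ltr_wpDl.
have cB : 0 < c / (B + 1) by rewrite divr_gt0.
exists ((c / (B + 1)) `^ H^-1); first by rewrite powR_gt0.
move=> u /andP[u0 ud]; apply: (@le_trans _ _ ((B + 1) * (c / (B + 1)))); last first.
  by rewrite mulrCA divff ?mulr1// gt_eqF.
apply: ler_pM; rewrite ?powR_ge0// ?lerDl//.
rewrite [leRHS](_ : _ = ((c / (B + 1)) `^ H^-1) `^ H); last first.
  by rewrite -powRrM mulVf ?gt_eqF// powRr1// ltW.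
by apply: ge0_ler_powR; rewrite ?nnegrE ?powR_ge0 ?(ltW H0) ?(ltW ud).
Qed.

Lemma hoelder_within_continuous (f : R -> R) (B : R) : 0 <= B ->
  (forall t s, 0 <= t <= 1 -> 0 <= s <= 1 -> `|f t - f s| <= B * `|t - s| `^ H) ->
  {within `[0, 1], continuous f}.
Proof.
move=> B0 fB; apply/subspace_continuousP => t; rewrite /= in_itv /= => t01.
apply/cvgrPdist_le => e e0; rewrite near_withinE.
have [d d0 Hd] := powR_small B0 e0.
near=> s; rewrite /= in_itv /= => s01; rewrite (le_trans (fB t s t01 s01))// Hd//.
rewrite normr_ge0 /=; near: s; exact: (@nbhsx_ballx R R t d d0).
Unshelve. all: by end_near. Qed.

(** An Arzelà-Ascoli argument along an ultrafilter: pointwise limits exist by boundedness, the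
    common Hölder bound makes the convergence uniform, and partial energies, which involve finitely
    many values, pass to the limit. *)
Lemma compact_energy_level (x a : R) : compact [set h : C01 R |
  forall m, 2^-1 * energy_upto H (pext (h - const_path x)) m <= a].
Proof.
set K := [set h | _]; rewrite compact_ultra => F FU FK.
have PF : ProperFilter F by exact: ultra_proper.
have a0 : 0 <= a.
  have [h /(_ 0%N)] := filter_ex FK.
  by rewrite /energy_upto big_ord0 mulr0.
pose B := Num.sqrt (2 * a); have B0 : 0 <= B by exact: sqrtr_ge0.
have B2 : B ^+ 2 = 2 * a by rewrite sqr_sqrtr// mulr_ge0.
have KB h : K h -> forall m, energy_upto H (pext (h - const_path x)) m <= B ^+ 2.
  by move=> Kh m; rewrite B2 -ler_pdivrMl//; exact: Kh.
have hoelder h : K h -> forall t s, 0 <= t <= 1 -> 0 <= s <= 1 ->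
    `|pext h t - pext h s| <= B * `|t - s| `^ H.
  move=> Kh t s t01 s01.
  have := energy_hoelder H01 kpsd (@pext_within_continuous R _) B0 (KB h Kh) t01 s01.
  by rewrite !pextB !pext_const// opprB addrA subrK.
have bounded h t : K h -> 0 <= t <= 1 -> `|pext h t| <= `|x| + B.
  move=> Kh t01; have z01 : 0 <= (0 : R) <= 1 by rewrite lexx ler01.
  have h0 : pext h 0 = x.
    apply/eqP; rewrite -subr_eq0; apply/eqP.
    have := energy_at0 H01 kpsd (@pext_within_continuous R _) B0 (KB h Kh).
    by rewrite pextB pext_const.
  rewrite -(subrK (pext h 0) (pext h t)) addrC h0 (le_trans (ler_normD _ _))// lerD2l.
  rewrite -h0 (le_trans (hoelder h Kh t 0 t01 z01))// -[leRHS]mulr1 ler_wpM2l//.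
  case/andP: t01 => t0 t1; rewrite subr0 ger0_norm//.
  rewrite [leRHS](_ : 1 = 1 `^ H); last by rewrite powR1.
  by apply: ge0_ler_powR; rewrite ?nnegrE ?(ltW H0).
pose Y t y := forall e, 0 < e -> F [set h | `|pext h t - y| < e].
pose y t := xget 0 (Y t).
have yP t : 0 <= t <= 1 -> Y t (y t).
  move=> t01; have [z Yz] := ultra_bounded_cvg (phi := fun h => pext h t) (M :=
    `|x| + B) FU
    (filterS (fun h Kh => bounded h t Kh t01) FK).
  exact: xgetI Yz.
have yH t s : 0 <= t <= 1 -> 0 <= s <= 1 -> `|y t - y s| <= B * `|t - s| `^ H.
  move=> t01 s01; apply/ler_addgt0Pr => e e0.
  have e2 : 0 < e / 2 by rewrite divr_gt0.
  have [h [[/= h1 h2] Kh]] := filter_ex (filterI (filterI (yP t t01 _ e2) (yP s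
    s01 _ e2)) FK).
  have := hoelder h Kh t s t01 s01; move: h1 h2; set b := B * _.
  rewrite !ltr_norml !ler_norml => /andP[? ?] /andP[? ?] /andP[? ?].
  by apply/andP; split; lra.
have cy := hoelder_within_continuous B0 yH.
pose p := restrict_path y.
have Fp r : 0 < r -> F [set h | `|p - h| < r].
  move=> r0; have r4 : 0 < r / 4 by rewrite divr_gt0.
  have [d d0 Hd] := powR_small B0 r4.
  have [M HM] := dense_times_net d0.
  have Fj m : F [set h | forall j, (0 < j <= m)%N -> `|pext h (T j) - y (T j)|
    < r / 8].
    elim: m => [|m IH]; first by apply: filterS filterT => h _ [|j].
    have T1 : 0 <= T m.+1 <= 1 by have /andP[/ltW -> ->] := dense_times01 R m.+1.
    have r8 : 0 < r / 8 by rewrite divr_gt0.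
    apply: filterS (filterI IH (yP _ T1 _ r8)) => h [/= h1 h2] j /andP[j0].
    by rewrite leq_eqVlt => /orP[/eqP ->//|jm]; apply: h1; rewrite j0.
  apply: filterS (filterI (Fj M) FK) => h [/= hj Kh].
  (* Two terms for the oscillation of [h] and of [y] between [t] and [T j], one for their distance
     at [T j]. *)
  apply: (@le_lt_trans _ _ (r / 4 + r / 4 + r / 8)); last by lra.
  apply: norm_le_pext => t t01; rewrite pextB (pext_restrict cy t01).
  have [j jM tj] := HM M (leqnn M) t t01.
  have T1 : 0 <= T j <= 1 by have /andP[/ltW -> ->] := dense_times01 R j.
  have bd : B * `|t - T j| `^ H <= r / 4 by apply: Hd; rewrite normr_ge0.
  have := le_trans (hoelder h Kh t (T j) t01 T1) bd.
  have := le_trans (yH t (T j) t01 T1) bd; have := hj j jM.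
  rewrite !ltr_norml !ler_norml => /andP[? ?] /andP[? ?] /andP[? ?].
  by apply/andP; split; lra.
exists p; split.
  move=> m; rewrite ler_pdivrMl// -B2 -l2_coords.
  rewrite ler_sqr ?nnegrE ?l2_ge0//; apply/ler_addgt0Pr => e e0.
  set c := l2 m (fun i => norm1 (C_ i)).
  have c1 : 0 < c + 1 by rewrite ltr_wpDl// l2_ge0.
  have [h [/= ph Kh]] := filter_ex (filterI (Fp _ (divr_gt0 e0 c1)) FK).
  rewrite (le_trans (l2_le_add _ _ (fun i => ev (pext (h - const_path x)) (C_ i))))//.
  rewrite lerD//.
    rewrite -ler_sqr ?nnegrE ?l2_ge0// l2_coords; exact: KB.
  apply: (@le_trans _ _ (l2 m (fun i => `|p - h| * norm1 (C_ i)))).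
    apply: l2_le => i; rewrite -ev_pextB opprB addrA subrK; exact: ev_pext_le.
  rewrite l2Z ?normr_ge0//; apply: (@le_trans _ _ (e / (c + 1) * (c + 1))).
    by rewrite ler_pM ?normr_ge0 ?l2_ge0// ?(ltW ph)// lerDl.
  by rewrite divfK// gt_eqF.
move=> S /nbhs_ballP[r /= r0 rS]; apply: filterS (Fp _ r0) => h ph.
by apply: rS; rewrite -ball_normE.
Qed.

Lemma compact_rate_level (x a : R) : compact [set h | (rate_function H x h <=
  a%:E)%E].
Proof.
rewrite (_ : [set h | _] = [set h : C01 R |
  forall m, 2^-1 * energy_upto H (pext (h - const_path x)) m <= a]).
  exact: compact_energy_level.
by apply/seteqP; split => h /= /rate_function_le; exact.
Qed.

End rate_function_level_sets.

(** * The conditional process near the last conditioning time *)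

Section conditional_increments.
Variables (R : realType) (H : R).
Hypothesis H01 : 0 < H < 1.
Local Notation k := (fbm_cov H).

Let ksym := fbm_cov_sym H.

Lemma negligible_dist_powR (a s : R) : 0 < a ->
  negligible (fun h => `|a + h - s| `^ (2 * H) - `|a - s| `^ (2 * H)) H.
Proof.
move=> a0; have [H0 H1] := andP H01.
have [->|sa] := eqVneq s a.
  apply: (@negligible_powR _ _ H (2 * H) 1 1) => //; first by lra.
  move=> h /andP[h0 _]; have -> : a + h - a = h by ring.
  rewrite subrr normr0 powR0; last by rewrite gt_eqF// mulr_gt0.
  by rewrite subr0 mul1r ger0_norm ?powR_ge0// gtr0_norm.
have u0 : 0 < `|a - s| by rewrite normr_gt0 subr_eq0 eq_sym.
have dp : derivable (fun u : R => u `^ (2 * H)) `|a - s| 1.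
  by apply: derivable_powR; rewrite in_itv/= u0.
have [L [d d0 HL]] := derivable_lipschitz dp.
have m0 : 0 < Num.min d `|a - s| by rewrite lt_min d0.
apply: (@negligible_powR _ _ H 1 L (Num.min d `|a - s|)) => //.
move=> h; rewrite lt_min => /and3P[h0 hd hx].
rewrite powRr1 ?(ltW h0)//.
have [sa'|as'] := ltP s a.
  have := HL h; rewrite !(gtr0_norm h0) => /(_ hd); apply: le_trans.
  rewrite (gtr0_norm (_ : 0 < a - s)) ?subr_gt0//.
  by rewrite addrAC (gtr0_norm (_ : 0 < a - s + h))// addr_gt0// subr_gt0.
have {}as' : a < s by rewrite lt_neqAle as' eq_sym sa.
have as0 : `|a - s| = s - a by rewrite distrC gtr0_norm// subr_gt0.
have := HL (- h); rewrite normrN !(gtr0_norm h0) => /(_ hd); apply: le_trans.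
rewrite as0 in hx *; rewrite (distrC (a + h)) (gtr0_norm (_ : 0 < s - (a +
  h))); last by lra.
by rewrite opprD addrA.
Qed.

Lemma negligible_fbm_cov (a s : R) : 0 < a ->
  negligible (fun h => k (a + h) s - k a s) H.
Proof.
move=> a0; have [H0 H1] := andP H01.
have dp : derivable (fun u : R => u `^ (2 * H)) a 1.
  by apply: derivable_powR; rewrite in_itv/= a0.
have := negligibleZ 2^-1 (negligibleD (negligible_derivable H1 dp)
  (negligibleZ (-1) (negligible_dist_powR s a0))).
by apply: negligible_ext => h _; rewrite /fbm_cov; field.
Qed.

(** By [ev_cov_dl] the coefficient is a fixed finite combination of kernel sections. *)
Lemma negligible_cond_coef (T : nat -> R) i b a : 0 < a ->
  negligible (fun h => cond_coef (cond_cov k T i) b (a + h) -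
                       cond_coef (cond_cov k T i) b a) H.
Proof.
move=> a0; pose l := dl k T i b.
have := negligibleZ (cond_cov k T i b b)^-1 (@negligible_ev _
  (fun s h => k (a + h) s - k a s) H l (fun p _ => negligible_fbm_cov p.2 a0)).
apply: negligible_ext => h _; rewrite evD evN !(ev_cov_dl T ksym) /cond_coef.
by rewrite !(cond_cov_sym T ksym i b) mulrC mulrBl.
Qed.

Lemma cond_coef_incr_le (T : nat -> R) n a (eta : R) : 0 < a -> 0 < eta ->
  exists2 e0, 0 < e0 & forall e, 0 < e < e0 -> forall t, 0 <= t <= 1 ->
  forall i, (i < n)%N ->
    `|cond_coef (cond_cov k T i) (T i.+1) (a + e * t) -
      cond_coef (cond_cov k T i) (T i.+1) a| <= eta * e `^ H.
Proof.
move=> a0 eta0; elim: n => [|n [d d0 IH]]; first by exists 1.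
have [d' d'0 Hd'] := negligible_cond_coef T n (T n.+1) a0 eta0.
exists (Num.min d d'); first by rewrite lt_min d0.
move=> e; rewrite lt_min => /and3P[e0 ed ed'] t t01 i.
rewrite ltnS leq_eqVlt => /orP[/eqP ->|]; last by apply: IH => //; rewrite e0.
(* [negligible] speaks of positive increments only, so [t = 0] is treated apart. *)
case/andP: t01; rewrite le_eqVlt => /orP[/eqP <- _|t0 t1].
  by rewrite mulr0 addr0 subrr normr0 mulr_ge0 ?powR_ge0// ltW.
have [H0 H1] := andP H01.
have et : e * t <= e by rewrite -[leRHS]mulr1 ler_pM2l.
rewrite (le_trans (Hd' (e * t) _))//.
  by rewrite mulr_gt0//= (le_lt_trans et).
by rewrite ler_wpM2l ?(ltW eta0)// ge0_ler_powR ?nnegrE ?(ltW H0) ?(ltW e0)//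
  mulr_ge0// ltW.
Qed.

Lemma eq_cond_cov (T T' : nat -> R) i :
  (forall j, (0 < j <= i)%N -> T j = T' j) -> cond_cov k T i = cond_cov k T' i.
Proof.
elim: i => [//|i IH] TT' /=.
rewrite IH ?TT' ?ltnS ?leqnn// => j /andP[j0 ji].
by apply: TT'; rewrite j0 ltnW.
Qed.

Section process.
Context d (Om : measurableType d) (P : probability Om R).
Variables (X : R -> {RV P >-> R}) (x : nat -> R).

(** Allows the sequence of times to be altered beyond the last conditioning time. *)
Lemma eq_cond_process (T T' : nat -> R) i :
  (forall j, (0 < j <= i)%N -> T j = T' j) ->
  cond_process k X T x i = cond_process k X T' x i.
Proof.
elim: i => [//|i IH] TT' /=.
have TT j : (0 < j <= i)%N -> T j = T' j.
  by move=> /andP[j0 ji]; apply: TT'; rewrite j0 ltnW.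
by rewrite IH// (eq_cond_cov TT) TT' ?ltnS ?leqnn.
Qed.

Lemma cond_process_sum (T : nat -> R) m u w :
  cond_process k X T x m u w = X u w - \sum_(i < m)
    cond_coef (cond_cov k T i) (T i.+1) u *
    (cond_process k X T x i (T i.+1) w - x i.+1).
Proof.
elim: m => [|m IH]; first by rewrite big_ord0 subr0.
by rewrite big_ord_recr /= IH opprD addrA.
Qed.

Lemma cond_process_ev (T : nat -> R) m u : (forall j, (0 < j)%N -> 0 <= T j) ->
  0 <= u -> exists l c, nonneg_times l /\
    forall w, cond_process k X T x m u w = ev (X ^~ w) l + c.
Proof.
move=> T0; elim: m u => [|m IH] u u0.
  exists [:: (1, u)], 0; split; first by rewrite /nonneg_times /= u0.
  by move=> w; rewrite ev1 mul1r addr0.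
have [l [c [l0 E]]] := IH u u0.
have [l' [c' [l'0 E']]] := IH (T m.+1) (T0 m.+1 isT).
pose b := cond_coef (cond_cov k T m) (T m.+1) u.
exists (l ++ scal (- b) l'), (c - b * (c' - x m.+1)); split.
  rewrite /nonneg_times all_cat; apply/andP; split=> //.
  by rewrite all_map.
by move=> w /=; rewrite E E' -/b ev_cat ev_scal; ring.
Qed.

Lemma cond_process_interpolates (T : nat -> R) m w :
  cond_cov k T m (T m.+1) (T m.+1) != 0 ->
  cond_process k X T x m.+1 (T m.+1) w = x m.+1.
Proof.
by move=> v0 /=; rewrite /cond_coef divff// mul1r opprB addrC subrK.
Qed.

Hypothesis fX : fBm P H X.

Lemma cond_process_tail (T : nat -> R) n : (forall j, (0 < j)%N -> 0 <= T j) ->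
  exists K, exists2 M0, 0 < K /\ 0 < M0 & forall M, M0 <= M ->
  forall i, (i < n)%N ->
  (P [set w | (M <= `|cond_process k X T x i (T i.+1) w - x i.+1|)%R] <=
     (2 * expR (- (M ^+ 2 / K)))%:E)%E.
Proof.
move=> T0; elim: n => [|n [K [M0 [K0 M00] IH]]]; first by exists 1, 1.
have [l [c [l0 E]]] := cond_process_ev n T0 (T0 n.+1 isT).
pose b := bil k l l + 1.
have b0 : 0 < b by rewrite ltr_wpDl//; exact: (fbm_psd fX).
(* For M at least twice the constant term, |Z| must reach M / 2, whence the exponent (M / 2) ^ 2 /
   (2 b). The 1 added in [b] keeps it positive for a degenerate variable. *)
pose K' := Num.max K (8 * b); pose M0' := Num.max M0 (2 * `|c - x n.+1|).
exists K', M0'; first by rewrite !lt_max K0 M00.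
move=> M; rewrite ge_max => /andP[M1 M2] i; rewrite ltnS leq_eqVlt.
have M_gt0 := lt_le_trans M00 M1.
have mono (y : R) : 0 < y -> y <= K' ->
    ((2 * expR (- (M ^+ 2 / y)))%:E <= (2 * expR (- (M ^+ 2 / K')))%:E)%E.
  move=> y0 yK; rewrite lee_fin ler_pM2l// ler_expR lerN2 ler_wpM2l ?sqr_ge0//.
  by rewrite lef_pV2 ?posrE// (lt_le_trans y0).
case/orP => [/eqP ->{i}|im]; last first.
  by rewrite (le_trans (IH M M1 i im))// mono// le_max lexx.
pose Z w := ev (X ^~ w) l.
have mZ : measurable_fun setT Z by exact: measurable_ev.
apply: (@le_trans _ _ (P [set w | (M / 2 <= `|Z w|)%R])).
  apply: le_measure; rewrite ?inE.
  - have -> : [set w | M <= `|cond_process k X T x n (T n.+1) w - x n.+1|] =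
      [set w | M <= `|Z w + (c - x n.+1)|].
      by apply/seteqP; split => w /=; rewrite E addrA.
    apply: measurable_norm_ge; exact: measurable_funD.
  - exact: measurable_norm_ge.
  move=> w /=; rewrite E -addrA => Mw.
  have := le_trans Mw (ler_normD _ _); rewrite -/(Z w) => ?; lra.
rewrite -density_cst1//; last exact: measurable_norm_ge.
apply: le_trans (mono (8 * b) _ _); last 2 first.
- by rewrite mulr_gt0.
- by rewrite le_max lexx orbT.
rewrite [X in (_ <= (2 * expR (- X))%:E)%E](_ : _ = (M / 2) ^+ 2 / (2 * b)).
  apply: chernoff_density_abs => //; first by rewrite divr_ge0// ltW.
  move=> a; under eq_integral do rewrite mule1.
  rewrite (fbm_mgf fX l0) lee_fin ler_expR mulr0 add0r.
  by rewrite ler_pM2r// ler_wpM2l ?sqr_ge0// lerDl.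
by field; rewrite gt_eqF.
Qed.

End process.
End conditional_increments.

Lemma ev_shift (R : realType) (f : R -> R) a e (l : seq (R * R)) :
  ev f ([seq (p.1, a + e * p.2) | p <- l] ++ [seq (- p.1, a) | p <- l]) =
  ev (fun t => f (a + e * t) - f a) l.
Proof.
rewrite ev_cat; elim: l => [|p l IH]; first by rewrite !ev_nil addr0.
by rewrite /= !ev_cons -IH /=; ring.
Qed.

(** * Decomposition of the shifted path into an increment and a perturbation *)

Section shifted_process.
Context (R : realType) d (Om : measurableType d) (P : probability Om R).
Variables (H : R) (X : R -> {RV P >-> R}) (n : nat) (T x : nat -> R).
Hypothesis H01 : 0 < H < 1.
Hypothesis fX : fBm P H X.
Hypothesis n1 : (1 <= n)%N.
Hypothesis T_gt0 : forall j, (0 < j)%N -> 0 < T j.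
Hypothesis T_incr : forall j, (1 <= j < n)%N -> T j < T j.+1.

Local Notation k := (fbm_cov H).
Local Notation a := (T n).
Local Notation U := (shifted_path H X T x n).
Local Notation coef i := (cond_coef (cond_cov k T i) (T i.+1)).

Let kpsd : psd k := fbm_psd fX.
Let H0 : 0 < H. Proof. by case/andP: H01. Qed.
Let a0 : 0 < a. Proof. exact: T_gt0. Qed.
Let T_ge0 j : (0 < j)%N -> 0 <= T j. Proof. by move=> /T_gt0/ltW. Qed.

Definition increment e t w := X (a + e * t) w - X a w.

Definition innovation i w := cond_process k X T x i (T i.+1) w - x i.+1.

Definition perturbation e t w :=
  \sum_(i < n) (coef i (a + e * t) - coef i a) * innovation i w.

Lemma T_lt i j : (0 < i)%N -> (i < j)%N -> (j <= n)%N -> T i < T j.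
Proof.
move=> i0; elim: j => [//|j IH]; rewrite ltnS leq_eqVlt => /orP[/eqP <-|ij] jn.
  by apply: T_incr; rewrite i0.
apply: lt_trans (IH ij (ltnW jn)) _; apply: T_incr.
by rewrite jn (leq_trans i0)// ltnW.
Qed.

Lemma cond_process_last w : cond_process k X T x n a w = x n.
Proof.
rewrite -(prednK n1); apply: cond_process_interpolates; apply/eqP => v0.
have [j /andP[j0 jn] Tj] := fbm_nondegenerate H01 kpsd T_gt0 v0.
rewrite (prednK n1) in Tj.
have : T j < T n by apply: T_lt => //; rewrite -(prednK n1) ltnS.
by rewrite Tj ltxx.
Qed.

Lemma pext_shifted_path e t w : 0 < e -> 0 <= t <= 1 ->
  pext (U e w) t = x n + increment e t w - perturbation e t w.
Proof.
move=> e0 /unit_itv_val[u <-]; rewrite pext_val shifted_pathE//.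
(* Writing [x n] as the value of the process at [a], the claim is the difference of two instances of
   [cond_process_sum]. *)
rewrite -[in RHS](cond_process_last w) !cond_process_sum /perturbation.
under [X in _ = _ - X]eq_bigr do rewrite mulrBl.
by rewrite sumrB /increment /innovation; ring.
Qed.

Lemma measurable_shifted_path e (G : set (C01 R)) : 0 < e -> open G ->
  measurable (U e @^-1` G).
Proof.
move=> e0; apply: measurable_open_preimage => t t01.
have t0 : 0 <= t by case/andP: t01.
have at0 : 0 <= a + e * t by rewrite addr_ge0 ?mulr_ge0 ?(ltW a0) ?(ltW e0).
have [l [c [l0 E]]] := cond_process_ev H X x n T_ge0 at0.
rewrite (_ : (fun w => _) = fun w => ev (X ^~ w) l + c).
  by apply: measurable_funD => //; exact: measurable_ev.
apply/funext => w; rewrite -E.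
by move: t01 => /unit_itv_val[u <-]; rewrite pext_val shifted_pathE.
Qed.

Lemma measurable_increment e t : measurable_fun setT (increment e t).
Proof. exact: measurable_funB. Qed.

Lemma increment_within_continuous e w : 0 < e ->
  {within `[0, 1], continuous (increment e ^~ w)}.
Proof.
move=> e0; apply: (@within_continuousD _ (fun t => X (a + e * t) w) (fun=> - X a w)).
  apply: (@within_continuous_comp _ _ _ _ (fun u => a + e * u) (X ^~ w)).
    move=> _ /set_mem[u /= + <-]; rewrite in_itv/= => /andP[u0 _].
    apply: (@cond_process_continuous _ _ _ _ H X T x 0 w) => //.
    by rewrite (lt_le_trans a0)// lerDl mulr_ge0// ltW.
  apply: continuous_subspaceT => u.
  apply: (@continuousD _ R^o); first exact: cst_continuous.
  by apply: continuousM => //; exact: cst_continuous.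
by move=> t; exact: cst_continuous.
Qed.

Lemma increment0 e w : increment e 0 w = 0.
Proof. by rewrite /increment mulr0 addr0 subrr. Qed.

Lemma increment_mgf e l : 0 < e -> times01 l ->
  has_gaussian_mgf P (fun w => ev (increment e ^~ w) l) 0
    ((e `^ H) ^+ 2 * bil k l l).
Proof.
move=> e0 l01.
pose l' := [seq (p.1, a + e * p.2) | p <- l] ++ [seq (- p.1, a) | p <- l].
have l'0 : nonneg_times l'.
  rewrite /nonneg_times all_cat !all_map; apply/andP; split; last first.
    by apply/allP => p _ /=; exact: ltW.
  apply/allP => p pl /=; have /allP/(_ p pl)/andP[p0 _] := l01.
  by rewrite addr_ge0 ?mulr_ge0// ltW.
have -> : (fun w => ev (increment e ^~ w) l) = fun w => ev (X ^~ w) l'.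
  by apply/funext => w; rewrite ev_shift.
rewrite (_ : _ * _ = bil k l' l'); first exact: fbm_mgf.
rewrite /bil ev_shift -evZ; apply: eq_ev => p pl; rewrite !ev_shift.
rewrite -evN -evD -evZ; apply: eq_ev => q ql.
have /allP/(_ p pl)/andP[p0 _] := l01; have /allP/(_ q ql)/andP[q0 _] := l01.
rewrite -powR_mulrn ?powR_ge0// -powRrM (mulrC H).
by rewrite -(fbm_cov_scaling H01 (ltW a0) e0 p0 q0); ring.
Qed.

(** The rate [B] is arbitrary: the exceptional set is where some innovation exceeds [L / g], and [L]
    can be taken large because the coefficients are o(g). *)
Lemma perturbation_small (delta B : R) : 0 < delta -> 0 < B ->
  exists2 e0, 0 < e0 & forall e, 0 < e < e0 -> exists A : set Om,
    [/\ measurable A,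
        (P A <= ((2 * n%:R) * expR (- (B / (e `^ H) ^+ 2)))%:E)%E &
        forall w, ~ A w -> forall t, 0 <= t <= 1 ->
          `|perturbation e t w| <= delta].
Proof.
move=> delta0 B0.
have [K [M0 [K0 M00] tail]] := cond_process_tail x fX n T_ge0.
have n0 : 0 < n%:R :> R by rewrite ltr0n.
(* Then [L ^+ 2 >= K * B], which is what the tail needs, and [eta] is such that
   [n * (eta * g) * (L / g) = delta]. *)
pose L := K * B + 1.
have L1 : 1 <= L by rewrite lerDr mulr_ge0// ltW.
have L0 : 0 < L by rewrite (lt_le_trans ltr01).
pose eta := delta / (n%:R * L).
have eta0 : 0 < eta by rewrite divr_gt0// mulr_gt0.
have [e1 e10 He] := cond_coef_incr_le H01 T n a0 eta0.
(* Below [e2] one has [g <= M0^-1], so [L / g] is in the range of the tail estimate. *)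
pose e2 := M0^-1 `^ H^-1.
have e20 : 0 < e2 by rewrite powR_gt0// invr_gt0.
exists (Num.min e1 e2); first by rewrite lt_min e10.
move=> e; rewrite lt_min => /and3P[e0 ee1 ee2].
set g := e `^ H; have g0 : 0 < g by rewrite powR_gt0.
have gM : g <= M0^-1.
  have -> : M0^-1 = e2 `^ H.
    by rewrite /e2 -powRrM mulVf ?gt_eqF// powRr1// invr_ge0 ltW.
  by apply: ge0_ler_powR; rewrite ?nnegrE ?(ltW H0) ?(ltW e0) ?(ltW e20) ?(ltW ee2).
have ML : M0 <= L / g.
  rewrite ler_pdivlMr// (le_trans _ L1)//; apply: (@le_trans _ _ (M0 * M0^-1)).
    by rewrite ler_pM2l.
  by rewrite divff// gt_eqF.
pose A := \big[setU/set0]_(i < n) [set w | L / g <= `|innovation i w|].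
have mi i : measurable [set w | L / g <= `|innovation i w|].
  apply: measurable_norm_ge; have [l [c [l0 E]]] := cond_process_ev H X x i
    T_ge0 (T_ge0 (ltn0Sn i)).
  rewrite (_ : innovation i = fun w => ev (X ^~ w) l + (c - x i.+1)).
    by apply: measurable_funD => //; exact: measurable_ev.
  by apply/funext => w; rewrite /innovation E addrA.
exists A; split.
- by apply: bigsetU_measurable => i _; exact: mi.
- apply: (@le_trans _ _ (\sum_(i < n) P [set w | (L / g <= `|innovation i w|)%R])%E).
    by apply: measure_bigsetU_le => i; exact: mi.
  apply: (@le_trans _ _ (\sum_(i < n) (2 * expR (- (B / g ^+ 2)))%:E)%E).
    apply: lee_sum => i _; apply: le_trans (tail _ ML i (ltn_ord i)) _.
    rewrite lee_fin ler_pM2l// ler_expR lerN2.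
    rewrite expr_div_n mulrAC ler_pdivrMr ?exprn_gt0//.
    rewrite divfK ?gt_eqF ?exprn_gt0// ler_pdivlMr// mulrC expr2.
    apply: (@le_trans _ _ L); first by rewrite lerDl.
    by rewrite ler_peMl// ltW.
  rewrite sumEFin sumr_const card_ord lee_fin -[leLHS]mulr_natl.
  by rewrite mulrA (mulrC n%:R).
move=> w Aw t t01; have xi_le (i : 'I_n) : `|innovation i w| <= L / g.
  rewrite leNgt; apply/negP => iw; apply: Aw.
  by rewrite /A (bigD1 i)//=; left => /=; exact: ltW.
rewrite (le_trans (ler_norm_sum _ _ _))//.
apply: (@le_trans _ _ (\sum_(i < n) delta / n%:R)).
  apply: ler_sum => i _; rewrite normrM.
  apply: (@le_trans _ _ (eta * g * (L / g))).
    apply: ler_pM => //; apply: He => //; by rewrite e0.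
  rewrite le_eqVlt; apply/orP; left; apply/eqP; rewrite /eta.
  by field; rewrite !gt_eqF.
by rewrite sumr_const card_ord -[leLHS]mulr_natl mulrCA divff ?mulr1// gt_eqF.
Qed.

End shifted_process.

(** * The large deviation bounds *)

Section exponential_rates.
Variables (R : realType) (H : R).
Hypothesis H01 : 0 < H < 1.
Implicit Types (p : R -> \bar R) (b C e : R).

Lemma powR_sqr_small (B c : R) : 0 <= B -> 0 < c -> exists2 delta, 0 < delta &
  forall e, 0 < e < delta -> B * (e `^ H) ^+ 2 <= c.
Proof.
(* From [(B + 1) * g <= min c 1] follow [g <= 1] and [B * g <= c], hence the bound on
   [B * g ^+ 2]. *)
move=> B0 c0; have m0 : 0 < Num.min c 1 by rewrite lt_min c0 ltr01.
have [delta d0 Hd] := powR_small H01 (ltac:(by rewrite ler_wpDl) : 0 <= B + 1) m0.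
exists delta => // e /andP[e0 ed].
have := Hd e; rewrite (ltW e0) ed => /(_ isT); set g := e `^ H.
have g0 : 0 <= g by exact: powR_ge0.
rewrite le_min => /andP[h1 h2].
have Bg : 0 <= B * g by exact: mulr_ge0.
have g1 : g <= 1 by rewrite mulrDl mul1r in h2; lra.
rewrite expr2 mulrA; apply: (@le_trans _ _ (B * g)).
  by rewrite -[leRHS]mulr1 ler_wpM2l.
by rewrite mulrDl mul1r in h1; lra.
Qed.

Lemma powR_cvg0 : e `^ H @[e --> 0^'+] --> 0.
Proof.
apply/cvgrPdist_le => c c0; have [d d0 Hd] := powR_small H01 (@ler01 R) c0.
near=> e; rewrite sub0r normrN ger0_norm ?powR_ge0// -[leLHS]mul1r Hd//.
by apply/andP; split; near: e; [exact: nbhs_right_ge|exact: nbhs_right_lt].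
Unshelve. all: by end_near. Qed.

Lemma ln_exponential_rate b C e : 0 < C -> 0 < e ->
  (((e `^ H) ^+ 2)%:E * lne (C * expR (- (b / (e `^ H) ^+ 2)))%:E)%E =
  ((e `^ H) ^+ 2 * ln C - b)%:E.
Proof.
move=> C0 e0; have g0 : 0 < (e `^ H) ^+ 2 by rewrite exprn_gt0// powR_gt0.
rewrite lne_EFin ?mulr_gt0 ?expR_gt0// -EFinM lnM ?posrE ?expR_gt0// expRK.
by rewrite mulrDr mulrN mulrCA divff ?mulr1// gt_eqF.
Qed.

Lemma limf_esup_exponential_le p b C e0 : 0 < C -> 0 < e0 ->
  (forall e, (0 <= p e)%E) ->
  (forall e, 0 < e < e0 -> (p e <= (C * expR (- (b / (e `^ H) ^+ 2)))%:E)%E) ->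
  (limf_esup (fun e => ((e `^ H) ^+ 2)%:E * lne (p e)) 0^'+ <= (- b)%:E)%E.
Proof.
move=> C0 e00 p0 pC; apply/lee_addgt0Pr => delta delta0.
have [d d0 Hd] := powR_sqr_small (normr_ge0 (ln C)) delta0.
pose V := [set e : R | 0 < e < Num.min e0 d].
have m0 : 0 < Num.min e0 d by rewrite lt_min e00.
apply: (@le_trans _ _ (ereal_sup
  ((fun e => (((e `^ H) ^+ 2)%:E * lne (p e))%E) @` V))).
  apply: ereal_inf_lbound; exists V => //.
  near=> e; rewrite /V /=; apply/andP.
  by split; near: e; [exact: nbhs_right_gt|exact: nbhs_right_lt].
apply: ge_ereal_sup => _ [e /= /andP[e_gt0 em] <-].
have [ee0 ed] : e < e0 /\ e < d by move: em; rewrite lt_min => /andP.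
apply: (@le_trans _ _ (((e `^ H) ^+ 2)%:E *
    lne (C * expR (- (b / (e `^ H) ^+ 2)))%:E)%E).
  rewrite lee_wpmul2l ?lee_fin ?sqr_ge0//.
  rewrite lee_lne ?in_itv /= ?leey ?andbT; first by apply: pC; rewrite e_gt0.
  - exact: p0.
  - by rewrite lee_fin mulr_ge0 ?expR_ge0// ltW.
rewrite ln_exponential_rate// -EFinD lee_fin addrC lerD2l.
apply: le_trans (Hd e _); last by rewrite e_gt0.
by rewrite mulrC ler_wpM2r ?sqr_ge0// ler_norm.
Unshelve. all: by end_near. Qed.

Lemma limf_einf_exponential_ge p b e0 : 0 < e0 -> (forall e, (0 <= p e)%E) ->
  (forall e, 0 < e < e0 -> ((expR (- (b / (e `^ H) ^+ 2)))%:E <= p e)%E) ->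
  ((- b)%:E <= limf_einf (fun e => ((e `^ H) ^+ 2)%:E * lne (p e)) 0^'+)%E.
Proof.
move=> e00 p0 pC; rewrite limf_einfE.
pose V := [set e : R | 0 < e < e0].
apply: (@le_trans _ _ (ereal_inf
  ((fun e => (((e `^ H) ^+ 2)%:E * lne (p e))%E) @` V))); last first.
  apply: ereal_sup_ubound; exists V => //.
  near=> e; rewrite /V /=; apply/andP.
  by split; near: e; [exact: nbhs_right_gt|exact: nbhs_right_lt].
apply: le_ereal_inf_tmp => _ [e /= /andP[e_gt0 ee0] <-].
apply: (@le_trans _ _ (((e `^ H) ^+ 2)%:E *
    lne (1 * expR (- (b / (e `^ H) ^+ 2)))%:E)%E).
  by rewrite ln_exponential_rate// ln1 mulr0 sub0r.
rewrite mul1r lee_wpmul2l ?lee_fin ?sqr_ge0//.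
rewrite lee_lne ?in_itv /= ?leey ?andbT; first by apply: pC; rewrite e_gt0.
- by rewrite lee_fin expR_ge0.
- exact: p0.
Unshelve. all: by end_near. Qed.

End exponential_rates.

Section bounds.
Context (R : realType) d (Om : measurableType d) (P : probability Om R).
Variables (H : R) (X : R -> {RV P >-> R}) (n : nat) (T x : nat -> R).
Hypothesis H01 : 0 < H < 1.
Hypothesis fX : fBm P H X.
Hypothesis n1 : (1 <= n)%N.
Hypothesis T_gt0 : forall j, (0 < j)%N -> 0 < T j.
Hypothesis T_incr : forall j, (1 <= j < n)%N -> T j < T j.+1.

Local Notation k := (fbm_cov H).
Local Notation U := (shifted_path H X T x n).
Local Notation V := (increment X n T).
Local Notation S := (dense_times R).
Local Notation I := (rate_function H (x n)).

Let ksym := fbm_cov_sym H.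
Let kpsd : psd k := fbm_psd fX.
Let H0 : 0 < H. Proof. by case/andP: H01. Qed.
Let S01 j : (0 < j)%N -> 0 < S j <= 1. Proof. by move=> _; exact: dense_times01. Qed.
Local Notation S0 := (@dense_times_ge0 R).

Lemma rate_partial_path (c : nat -> R) m b : \sum_(i < m) c i ^+ 2 <= 2 * b ->
  (I (restrict_path (fun t => (x n + partial_path k S c m t)%R)) <= b%:E)%E.
Proof.
move=> cb; apply/(rate_function_le H01 kpsd) => m'; rewrite ler_pdivrMl//.
apply: le_trans cb; apply: le_trans (energy_upto_mono _ _ (leq_maxr m m')) _.
have cpath : {within `[0, 1], continuous (fun t => x n + partial_path k S c m t)}.
  apply: within_continuousD => [t|]; first exact: cst_continuous.
  exact: partial_path_within_continuous.
rewrite -(big_mkord xpredT (fun i => c i ^+ 2)).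
rewrite (big_nat_widen _ _ _ _ _ (leq_maxl m m')) big_mkord [leRHS]big_mkcond.
apply: ler_sum => i _ /=.
rewrite (_ : ev _ _ = ev (partial_path k S c m) (coord k S i)).
  rewrite (ev_partial_path ksym kpsd S0).
  case: ltnP => //= _; last by rewrite expr0n.
  by case: ifP => _; rewrite ?expr0n ?sqr_ge0.
apply: eq_ev => p pl; have p01 := allP (coord_times01 H S01 i) p pl.
by rewrite pextB pext_const// pext_restrict// addrAC subrr add0r.
Qed.

Lemma measurable_preimage_closed (F : set (C01 R)) e : closed F -> 0 < e ->
  measurable (U e @^-1` F).
Proof.
move=> cF e0; rewrite -[F]setCK preimage_setC; apply: measurableC.
exact: (measurable_shifted_path x H01 fX n1 T_gt0 e0 (closed_openC cF)).
Qed.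

(** The event is covered by a large energy of the projection ([E1]), a large residual ([E2]) and the
    exceptional set of the perturbation. Elsewhere the shifted path is within [r / 2] of a point of
    the level set [K], against the separation. *)
Lemma closed_upper_bound (F : set (C01 R)) b : closed F -> 0 < b ->
  (b%:E < ereal_inf (I @` F))%E ->
  exists C, exists2 e0, 0 < C /\ 0 < e0 & forall e, 0 < e < e0 ->
    (P (U e @^-1` F) <= (C * expR (- (b / (e `^ H) ^+ 2)))%:E)%E.
Proof.
move=> cF b0 bF.
(* The gap between [b] and [b1] pays for the factor lost in the finite net of [coords_tail]. *)
have [b1 bb1 b1F] : exists2 b1, b < b1 & (b1%:E < ereal_inf (I @` F))%E.
  case: (ereal_inf _) bF => [r| |] //; rewrite ?lte_fin => br.
    by exists ((b + r) / 2); rewrite ?lte_fin; lra.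
  by exists (b + 1); rewrite ?ltry// ltrDl.
have b10 := lt_trans b0 bb1.
pose K := [set h | (I h <= b1%:E)%E].
have KF : K `&` F = set0.
  apply/seteqP; split => // h [/= Kh Fh].
  have : (ereal_inf (I @` F) <= I h)%E by apply: ereal_inf_lbound; exists h.
  by move=> /le_trans/(_ Kh); rewrite leNgt b1F.
have [r r0 sep] :=
  compact_closed_separated (@compact_rate_level R H H01 kpsd (x n) b1) cF KF.
have r4 : 0 < r / 4 by rewrite divr_gt0.
have cH := chaining_const_gt0 H0.
(* Chosen so that the exponent given by [residual_tail] is exactly [b / g ^+ 2]. *)
pose s := chaining_const H * (r / 4) ^+ 2 / (2 * b).
have s0 : 0 < s by apply: divr_gt0; rewrite mulr_gt0// exprn_gt0.
have [m kcm] := cond_cov_small H01 kpsd (ltac:(by rewrite exprn_gt0) : 0 < s ^+ 2).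
(* The net is fine enough for [(1 - m / N) ^+ 2 * b1] to remain above [b]. *)
pose N := (Num.truncn (2 * m%:R * b1 / (b1 - b)) + m).+1.
have mN : (m <= N)%N by rewrite /N leqW// leq_addl.
have N0 : 0 < N%:R :> R by rewrite ltr0n.
have theta : b <= (1 - m%:R / N%:R) ^+ 2 * b1.
  have y2 : 2 * (m%:R / N%:R) * b1 <= b1 - b.
    rewrite mulrA mulrAC ler_pdivrMr// [leRHS]mulrC -ler_pdivrMr ?subr_gt0//.
    rewrite (le_trans (ltW (truncnS_gt _)))// ler_nat /N ltnS; exact: leq_addr.
  move: (m%:R / N%:R) y2 => y y2.
  have y20 : 0 <= y ^+ 2 * b1 by rewrite mulr_ge0 ?sqr_ge0// ltW.
  have -> : (1 - y) ^+ 2 * b1 = b1 - 2 * y * b1 + y ^+ 2 * b1 by ring.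
  by lra.
pose rho := Num.sqrt (2 * b1).
have rho0 : 0 < rho by rewrite sqrtr_gt0 mulr_gt0.
have rho2 : rho ^+ 2 = 2 * b1 by rewrite sqr_sqrtr// mulr_ge0// ltW.
have [e1 e10 pert] := perturbation_small x H01 fX n1 T_gt0 r4 b0.
have [e2 e20 thr] := powR_sqr_small H01 (ltW (chaining_threshold_gt0 H0)) b0.
set M := #|{: {ffun 'I_m -> bool * 'I_N.+1}}|.
exists (M%:R + 4 + 2 * n%:R), (Num.min e1 e2).
  by rewrite lt_min e10 e20; split=> //; rewrite ltr_wpDr ?mulr_ge0// ltr_wpDl.
move=> e; rewrite lt_min => /and3P[e0 ee1 ee2].
have [A [mA PA HA]] := pert e (ltac:(by rewrite e0)).
set g := e `^ H in PA *; have g0 : 0 < g by rewrite powR_gt0.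
have g20 : 0 < g ^+ 2 by rewrite exprn_gt0.
have mV t : 0 <= t <= 1 -> measurable_fun setT (V e t).
  by move=> _; exact: measurable_increment.
have cV w : {within `[0, 1], continuous (V e ^~ w)}.
  exact: (@increment_within_continuous _ _ _ _ _ _ _ _ x H01 fX n1 T_gt0 e w e0).
have V0 := increment0 X n T e.
have Vmgf l (l01 : times01 l) := increment_mgf H01 fX n1 T_gt0 e0 l01.
pose E1 := [set w | rho ^+ 2 <= \sum_(i < m) ev (V e ^~ w) (coord k S i) ^+ 2].
pose E2 := exceeds (residual H (V e) S m) (r / 4).
have mE1 : measurable E1 by apply: (measurable_coords_ge H mV S01).
have mE2 : measurable E2.
  apply: measurable_exceeds => [t t01|w].
    exact: (measurable_residual H mV S01).
  exact: (residual_within_continuous H01 kpsd cV S01).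
have FE : U e @^-1` F `<=` E1 `|` (E2 `|` A).
  move=> w Fw; have [A_w|nA] := pselect (A w); first by right; right.
  have [E2w|nE2] := pselect (E2 w); first by right; left.
  left; rewrite /E1 /= leNgt; apply/negP; rewrite rho2 => E1w.
  pose c i := ev (V e ^~ w) (coord k S i).
  pose h := restrict_path (fun t => x n + partial_path k S c m t).
  have Kh : K h by exact: rate_partial_path (ltW E1w).
  have := sep h (U e w) Kh Fw; apply/negP; rewrite -ltNge.
  apply: (@le_lt_trans _ _ (r / 4 + r / 4)); last by lra.
  apply: norm_le_pext => t t01; rewrite pextB pext_shifted_path//
    pext_restrict//; last first.
    apply: within_continuousD => [u|]; first exact: cst_continuous.
    exact: partial_path_within_continuous.
  have -> : x n + V e t w - perturbation H X n T x e t w -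
      (x n + partial_path k S c m t) =
      residual H (V e) S m t w - perturbation H X n T x e t w.
    have <- : \sum_(i < m) chol k S i t * c i = partial_path k S c m t.
      by apply: eq_bigr => i _; rewrite mulrC.
    by rewrite residualE//; ring.
  rewrite (le_trans (ler_normB _ _))// lerD ?HA//.
  by rewrite leNgt; apply/negP => rt; apply: nE2; exists t.
have PE1 : (P E1 <= (M%:R * expR (- (b / g ^+ 2)))%:E)%E.
  apply: le_trans (coords_tail kpsd g0 mV Vmgf S01 (ltn0Sn _) mN rho0) _.
  rewrite lee_fin ler_wpM2l// ler_expR lerN2 exprMn rho2.
  have -> : (1 - m%:R / N%:R) ^+ 2 * (2 * b1) / (2 * g ^+ 2) =
      (1 - m%:R / N%:R) ^+ 2 * b1 / g ^+ 2.
    by move: (1 - _) => y; field; rewrite gt_eqF.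
  by rewrite ler_wpM2r// invr_ge0 ltW.
have sE : chaining_const H * (r / 4) ^+ 2 / (g ^+ 2 * (2 * s)) = b / g ^+ 2.
  by rewrite /s; field; rewrite !gt_eqF.
have PE2 : (P E2 <= (4 * expR (- (b / g ^+ 2)))%:E)%E.
  rewrite -sE; apply: (residual_tail H01 kpsd g0 mV cV V0 Vmgf S01) => //.
    exact: kcm.
  by rewrite sE ler_pdivlMr// thr// e0.
apply: (@le_trans _ _ (P (E1 `|` (E2 `|` A)))).
  apply: le_measure => //; rewrite inE.
    exact: measurable_preimage_closed.
  by apply: measurableU => //; exact: measurableU.
apply: (@le_trans _ _ (P E1 + (P E2 + P A))%E).
  apply: (@le_trans _ _ (P E1 + P (E2 `|` A))%E).
    by apply: measureU2 => //; exact: measurableU.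
  by rewrite leeD2l//; apply: measureU2.
apply: le_trans (leeD PE1 (leeD PE2 PA)) _.
by rewrite -!EFinD lee_fin -addrA !mulrDl.
Qed.

(** A projection of the target is within [r / 4] of it and is the potential of a finite combination
    [l], along which the law is tilted; half of [delta] pays for the width of the tube. *)
Lemma open_lower_bound (G : set (C01 R)) h b delta : open G -> G h ->
  (I h <= b%:E)%E -> 0 < delta ->
  exists2 e0, 0 < e0 & forall e, 0 < e < e0 ->
    ((expR (- ((b + delta) / (e `^ H) ^+ 2)))%:E <= P (U e @^-1` G))%E.
Proof.
move=> oG Gh /(rate_function_le H01 kpsd) Ib delta0.
have b0 : 0 <= b by have := Ib 0%N; rewrite /energy_upto big_ord0 mulr0.
have /nbhs_ballP[r /= r0 rG] := open_nbhs_nbhs (conj oG Gh).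
have r4 : 0 < r / 4 by rewrite divr_gt0.
pose f := pext (h - const_path (x n)).
pose B := Num.sqrt (2 * b).
have B2 : B ^+ 2 = 2 * b by rewrite sqr_sqrtr// mulr_ge0.
have fB m : energy_upto H f m <= B ^+ 2 by rewrite B2 -ler_pdivrMl//; exact: Ib.
have [m /(_ m (leqnn m)) fm] := proj_cvg H01 kpsd
  (@pext_within_continuous R (h - const_path (x n))) (sqrtr_ge0 _) fB r4.
pose c i := ev f (coord k S i); pose l := coord_comb H S m c.
have l01 : times01 l by exact: coord_comb_times01.
have bl : bil k l l <= 2 * b.
  by rewrite -B2 (le_trans (bil_coord_comb_le kpsd S01 m c))//; exact: fB.
have nl0 : 0 <= norm1 l by apply: sumr_ge0.
have nl1 : 0 < norm1 l + 1 by rewrite ltr_wpDl.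
pose r' := Num.min (r / 4) (delta / (2 * (norm1 l + 1))).
have r'0 : 0 < r' by rewrite lt_min r4 divr_gt0// mulr_gt0.
have r'l : r' * norm1 l <= delta / 2.
  apply: (@le_trans _ _ (delta / (2 * (norm1 l + 1)) * (norm1 l + 1))).
    by apply: ler_pM; rewrite ?(ltW r'0)// ?ge_min ?lexx ?orbT// lerDl.
  by rewrite le_eqVlt; apply/orP; left; apply/eqP; field; rewrite gt_eqF.
have H20 : 0 < 2 * H by rewrite mulr_gt0.
have q0 : 0 < chaining_const (2 * H) * r' ^+ 2.
  by rewrite mulr_gt0 ?exprn_gt0// chaining_const_gt0.
have bd : 0 < b + delta by rewrite ltr_wpDl.
have d2 : 0 < delta / 2 by rewrite divr_gt0.
(* The rate is above that of the tube, so that the exceptional set can be subtracted. *)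
have [e1 e10 pert] := perturbation_small x H01 fX n1 T_gt0 r4 bd.
have [e2 e20 thr] := powR_sqr_small H01 (ltW (chaining_threshold_gt0 H20)) q0.
have [e3 e30 thr3] := powR_sqr_small H01 (ler0n R 3) q0.
(* Makes [expR (delta / 2 / g ^+ 2)] at least [2 * (2 * n + 1)]: this absorbs the factor 1/2 of the
   tube and the mass [2 * n * z] of the exceptional set. *)
have [e4 e40 thr4] := powR_sqr_small H01 (ler0n R (2 * (2 * n + 1))) d2.
exists (Num.min (Num.min e1 e2) (Num.min e3 e4));
  first by rewrite !lt_min e10 e20 e30.
move=> e; rewrite !lt_min => /andP[e0 /andP[/andP[ee1 ee2] /andP[ee3 ee4]]].
have [A [mA PA HA]] := pert e (ltac:(by rewrite e0)).
have {}thr := thr e (ltac:(by rewrite e0)).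
have {}thr3 := thr3 e (ltac:(by rewrite e0)).
have {}thr4 := thr4 e (ltac:(by rewrite e0)).
set g := e `^ H in PA thr thr3 thr4 *; have g0 : 0 < g by rewrite powR_gt0.
have g20 : 0 < g ^+ 2 by rewrite exprn_gt0.
have mV t : 0 <= t <= 1 -> measurable_fun setT (V e t).
  by move=> _; exact: measurable_increment.
have cV w : {within `[0, 1], continuous (V e ^~ w)}.
  exact: (@increment_within_continuous _ _ _ _ _ _ _ _ x H01 fX n1 T_gt0 e w e0).
have V0 := increment0 X n T e.
have Vmgf l' (l'01 : times01 l') := increment_mgf H01 fX n1 T_gt0 e0 l'01.
pose E := ~` exceeds (fun t w => V e t w - ev (k t) l) r'.
have PE : ((2^-1 * expR (- ((b + delta / 2) / g ^+ 2)))%:E <= P E)%E.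
  apply: le_trans (tilted_lower_bound H01 g0 mV cV V0 Vmgf l01 r'0 _ _); last 2 first.
  - by rewrite ler_pdivlMr.
  - by rewrite ler_pdivlMr.
  rewrite lee_fin ler_pM2l ?invr_gt0// ler_expR lerN2 ler_pM2r ?invr_gt0//.
  by apply: lerD => //; lra.
have EG : E `<=` (U e @^-1` G) `|` A.
  move=> w Ew; have [A_w|nA] := pselect (A w); [by right|left].
  apply: rG; rewrite -ball_normE /=.
  apply: (@le_lt_trans _ _ (r / 4 + (r / 4 + r / 4))); last by lra.
  apply: norm_le_pext => t t01; rewrite pextB pext_shifted_path//.
  have -> : pext h t - (x n + V e t w - perturbation H X n T x e t w) =
    (f t - partial_path k S c m t) - ((V e t w - ev (k t) l) -
       perturbation H X n T x e t w).
    by rewrite /f pextB pext_const// ev_cov_coord_comb; ring.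
  rewrite (le_trans (ler_normB _ _))// lerD ?fm//.
  rewrite (le_trans (ler_normB _ _))// lerD ?HA//.
  apply: (@le_trans _ _ r'); last by rewrite ge_min lexx.
  by rewrite leNgt; apply/negP => rt; apply: Ew; exists t.
have mE : measurable E.
  apply: measurableC; apply: measurable_exceeds => [t t01|w].
    by apply: measurable_funB => //; exact: mV.
  rewrite (_ : (fun t => _) = fun t => V e t w + (-1) * ev (k t) l).
    apply: within_continuousD; first exact: cV.
    by apply: within_continuousZ; exact: bil_cov_within_continuous.
  by apply/funext => t; rewrite mulN1r.
have mG := measurable_shifted_path x H01 fX n1 T_gt0 e0 oG.
have PEG : (P E <= P (U e @^-1` G) + P A)%E.
  apply: (@le_trans _ _ (P ((U e @^-1` G) `|` A))).
    by apply: le_measure => //; rewrite inE//; exact: measurableU.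
  exact: measureU2.
set z := expR (- ((b + delta) / g ^+ 2)).
suff : (z%:E + (2 * n%:R * z)%:E <= P (U e @^-1` G) + (2 * n%:R * z)%:E)%E.
  by rewrite leeD2rE.
apply: (@le_trans _ _ (P (U e @^-1` G) + P A)%E); last by rewrite leeD2l.
apply: le_trans PEG; apply: le_trans PE; rewrite -EFinD lee_fin.
have -> : - ((b + delta / 2) / g ^+ 2) =
    delta / 2 / g ^+ 2 + - ((b + delta) / g ^+ 2) by field; rewrite gt_eqF.
rewrite expRD -/z; set y := delta / 2 / g ^+ 2.
have ey : 2 * (2 * n%:R + 1) <= expR y.
  apply: (@le_trans _ _ (1 + y)); last exact: expR_ge1Dx.
  rewrite ler_wpDl// ler_pdivlMr//; apply: le_trans thr4.
  by rewrite natrM natrD natrM.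
have z0 : 0 <= z by exact: expR_ge0.
have := ler_wpM2r z0 ey; rewrite -/z; lra.
Qed.
Lemma LDP_shifted_path : LDP P U (fun e => e `^ H) I.
Proof.
split.
- by move=> e G e0 oG; exact: (measurable_shifted_path x H01 fX n1 T_gt0 e0 oG).
- exact: powR_cvg0.
- by move=> a; exact: (@compact_rate_level R H H01 kpsd (x n) a).
- move=> G oG; rewrite leeNl; apply: le_ereal_inf_tmp => _ [h Gh <-].
  case Ih : (I h) => [b| |]; last 2 first.
  + exact: leey.
  + by move: Ih; rewrite /rate_function; case: ifP.
  rewrite leeNl; apply/lee_addgt0Pr => delta delta0.
  have Ib : (I h <= b%:E)%E by rewrite Ih.
  have [e0 e00 He] := open_lower_bound oG Gh Ib delta0.
  have := limf_einf_exponential_ge e00 (fun e => measure_ge0 P (U e @^-1` G)) He.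
  rewrite opprD EFinD => h1; rewrite -leeBlDr//.
- move=> F cF; set L := limf_esup _ _.
  (* For [b <= 0] the bound only says that probabilities are at most 1. *)
  have Lb b : (b%:E < ereal_inf (I @` F))%E -> (b%:E <= - L)%E.
    move=> bF; rewrite leeNr; have [b0|b0] := ltP 0 b.
      have [C [e0 [C0 e00] He]] := closed_upper_bound cF b0 bF.
      exact: limf_esup_exponential_le C0 e00 (fun e => measure_ge0 P _) He.
    apply: (limf_esup_exponential_le H01 ltr01 ltr01) => e.
      exact: measure_ge0.
    move=> /andP[e0 _]; rewrite mul1r.
    apply: le_trans (probability_le1 P (measurable_preimage_closed cF e0)) _.
    rewrite lee_fin -[leLHS]expR0 ler_expR -mulNr divr_ge0 ?sqr_ge0//.
    by rewrite oppr_ge0.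
  rewrite leeNr; case: (ereal_inf _) Lb => [r| |] Lb.
  + apply/lee_subgt0Pr => eps eps0; apply: Lb.
    by rewrite lte_fin; lra.
  + by rewrite leye_eq; apply/eqP/eqyP => r _; apply: Lb; exact: ltry.
  + exact: leNye.
Qed.

End bounds.

Unset Implicit Arguments.

Theorem theorem3p5 (R : realType) (d : measure_display) (Om : measurableType d)
    (P : probability Om R) (H : R) (X : R -> {RV P >-> R})
    (n : nat) (T x : nat -> R) :
  0 < H < 1 ->
  fBm P H X ->
  (1 <= n)%N ->
  0 < T 1%N ->
  (forall j, (1 <= j < n)%N -> T j < T j.+1) ->
  LDP P (shifted_path H X T x n) (fun e => e `^ H)
    (rate_function H (x n)).
Proof.
move=> H01 fX n1 T1 T_incr.
(* The preceding lemmas ask for positive times at all positive indices; beyond [n] the value 1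
   provides them without changing the process. *)
pose T' j := if (0 < j <= n)%N then T j else 1.
have TT' j : (0 < j <= n)%N -> T j = T' j by rewrite /T' => ->.
have T'_gt0 j : (0 < j)%N -> 0 < T' j.
  rewrite /T'; case: ifP => // + _; elim: j => // -[//|j] IH /andP[_ jn].
  apply: lt_trans (IH _) (T_incr _ _) => //; exact: ltnW.
have T'_incr j : (1 <= j < n)%N -> T' j < T' j.+1.
  move=> jn; have /andP[j1 j2] := jn.
  by rewrite -!TT' ?j1 ?(ltnW j2)//; exact: T_incr.
have -> : shifted_path H X T x n = shifted_path H X T' x n.
  apply/funext => e; apply/funext => w.
  by rewrite /shifted_path (eq_cond_process _ _ _ TT') TT' ?n1 ?leqnn.
exact: LDP_shifted_path.
Qed.
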